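(* For each $n$ (with $p=p(n)$), let $(x_i,y_i)\in\mathbb{R}^{p+1}\times\mathbb{R}$, $i\in[n]$, be i.i.d. and satisfy the feature and response assumptions (F1)-(F3) and (Y1)-(Y4) given in the context. Let $\hat\beta_k$, $k\in\{0\}\cup[K]$, be the gradient descent iterates with step sizes $\delta_0,\dots,\delta_{K-1}$ and initialization $\hat\beta_0$. Assume there are constants $\Delta,B_0,\zeta_L,\zeta_U$ (independent of $n,p$) such that (1) $\sum_{k=1}^K\delta_{k-1}\le\Delta$, (2) $\|\hat\beta_0\|_2\le B_0$, and (3) $0<\zeta_L\le p/n\le\zeta_U<\infty$. Furthermore, let $K=o\big(n(\log n)^{-3/2}\big)$. Suppose that $\psi:\mathbb{R}^2\to\mathbb{R}$ is differentiable and satisfies $\|\nabla\psi(u)\|_2\le C_\psi\|u\|_2+\bar C_\psi$ for all $u\in\mathbb{R}^2$ and for constants $C_\psi,\bar C_\psi\ge0$. Then, as $n,p\to\infty$, $$\max_{k\in[K]}\big|\widehat\Psi^{\mathrm{loo}}(\hat\beta_k)-\Psi(\hat\beta_k)\big|\longrightarrow0\quad\text{almost surely}.$$ Consequently, if $k_*=\arg\min_{k\in[K]}\widehat\Psi^{\mathrm{loo}}(\hat\beta_k)$, then as $n,p\to\infty$, $$\Big|\Psi(\hat\beta_{k_*})-\min_{k\in[K]}\Psi(\hat\beta_k)\Big|\longrightarrow0\quad\text{almost surely}.$$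
   Context: A distribution $\mu$ satisfies the $T_2$-inequality with constant $\sigma(\mu)\ge0$ if $W_2(\mu,\nu)\le\sqrt{2\sigma^2(\mu)D_{\mathrm{KL}}(\nu\|\mu)}$ for every distribution $\nu$, where $W_2$ is the 2-Wasserstein distance and $D_{\mathrm{KL}}$ the Kullback-Leibler divergence. Feature assumptions: (F1) $x_i^\top=((\Sigma^{1/2}z_i)^\top,1)$, where $z_i\in\mathbb{R}^p$ has i.i.d. entries drawn from a distribution $\mu_z$ and $\Sigma\in\mathbb{R}^{p\times p}$ is positive semidefinite. (F2) $\mu_z$ has mean $0$, variance $1$ and satisfies the $T_2$-inequality with constant $\sigma_z$. (F3) $\|\Sigma\|_{\mathrm{op}}\le\sigma_\Sigma$. Response assumptions: (Y1) $y_i=f(x_i)+\varepsilon_i$, where $\varepsilon_i$ is independent of $x_i$ and drawn from a distribution $\mu_\varepsilon$. (Y2) $\mu_\varepsilon$ has mean $0$ and satisfies the $T_2$-inequality with constant $\sigma_\varepsilon$. (Y3) $f:\mathbb{R}^{p+1}\to\mathbb{R}$ is $L_f$-Lipschitz continuous, where (without loss of generality) $L_f\le1$. (Y4) $\mathbb{E}[y_i^8]\le m_8$, $\mathbb{E}[y_i^4]\le m_4$, $\mathbb{E}[y_i^2]\le m_2$. The constants $\sigma_z,\sigma_\Sigma,\sigma_\varepsilon,m_2,m_4,m_8$ do not change with $n,p$. $[K]=\{1,\dots,K\}$; $K$ and the step sizes may depend on $n$. $X\in\mathbb{R}^{n\times(p+1)}$ has rows $x_i^\top$ and $y=(y_i)_{i\le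 n}$. Gradient descent with positive step sizes from a fixed (non-random) initial vector $\hat\beta_0\in\mathbb{R}^{p+1}$: $\hat\beta_k=\hat\beta_{k-1}+\frac{\delta_{k-1}}{n}X^\top(y-X\hat\beta_{k-1})$, $k\in[K]$. The leave-one-out iterate is the same procedure run without the $i$-th sample: $\hat\beta_{0,-i}=\hat\beta_0$ and $\hat\beta_{k,-i}=\hat\beta_{k-1,-i}+\frac{\delta_{k-1}}{n}X_{-i}^\top(y_{-i}-X_{-i}\hat\beta_{k-1,-i})$, where $X_{-i},y_{-i}$ are $X,y$ with the $i$-th row/entry removed. $\Psi(\hat\beta_k)=\mathbb{E}_{x_0,y_0}[\psi(y_0,x_0^\top\hat\beta_k)\mid X,y]$, where $(x_0,y_0)$ is independent of the training data with the same distribution as $(x_1,y_1)$, and $\widehat\Psi^{\mathrm{loo}}(\hat\beta_k)=\frac1n\sum_{i=1}^n\psi(y_i,x_i^\top\hat\beta_{k,-i})$. *)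

(* Defs.v *)
From HB Require Import structures.
From mathcomp Require Export all_boot all_order all_algebra.
From mathcomp Require Export all_classical all_reals all_analysis.
Set Implicit Arguments.
Unset Strict Implicit.
Unset Printing Implicit Defensive.
Import Order.TTheory GRing.Theory Num.Theory numFieldNormedType.Exports.
Local Open Scope classical_set_scope.
Local Open Scope ring_scope.

(* Product sigma-algebra on matrices, generated by the entries. *)
Definition mx_coord_sets d (T : measurableType d) m n : set (set 'M[T]_(m, n)) :=
  [set A | exists (i : 'I_m) (j : 'I_n) (B : set T),
     measurable B /\ A = [set M : 'M[T]_(m, n) | B (M i j)]].

Definition measure_matrix_display : measure_display -> measure_display.
Proof. exact. Qed.

Section measurable_matrix.
Context d (T : measurableType d) (m n : nat).

Let mx_sigma := <<s @mx_coord_sets d T m n >>.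

Let mx_sigma0 : mx_sigma set0.
Proof. exact: sigma_algebra0. Qed.

Let mx_sigmaC A : mx_sigma A -> mx_sigma (~` A).
Proof. exact: sigma_algebraC. Qed.

Let mx_sigma_bigcup (F : (set 'M[T]_(m, n))^nat) :
  (forall i, mx_sigma (F i)) -> mx_sigma (\bigcup_i F i).
Proof. exact: sigma_algebra_bigcup. Qed.

HB.instance Definition _ := @isMeasurable.Build (measure_matrix_display d)
  'M[T]_(m, n) mx_sigma mx_sigma0 mx_sigmaC mx_sigma_bigcup.

End measurable_matrix.

Section linear_algebra.
Context (R : realType).

(* The library norm on matrices is the sup norm. *)
Definition l2norm q (v : 'cV[R]_q) : R := Num.sqrt (\sum_(i < q) v i 0 ^+ 2).

Definition opnorm q (A : 'M[R]_q) : R :=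
  sup [set l2norm (A *m v) | v in [set v : 'cV[R]_q | l2norm v <= 1]].

Definition psd q (A : 'M[R]_q) : Prop :=
  A^T = A /\ forall v : 'cV[R]_q, 0 <= (v^T *m A *m v) 0 0.

(* Characterizes A^{1/2} uniquely. *)
Definition is_psd_sqrt q (S A : 'M[R]_q) : Prop := psd S /\ S *m S = A.

Definition l2_lipschitz q (L : R) (f : 'cV[R]_q -> R) : Prop :=
  forall u v, `|f u - f v| <= L * l2norm (u - v).

Definition l2norm2 (u : R * R) : R := Num.sqrt (u.1 ^+ 2 + u.2 ^+ 2).

Definition grad2 (psi : R * R -> R) (u : R * R) : R * R :=
  ('D_(1, 0) psi u, 'D_(0, 1) psi u).

(* The scaling 1/n is a parameter distinct from the number m of rows, because
   leave-one-out descent keeps the factor 1/n with n - 1 rows. *)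
Fixpoint gd n m q (X : 'M[R]_(m, q)) (Y : 'cV[R]_m) (delta : nat -> R)
    (b0 : 'cV[R]_q) (k : nat) : 'cV[R]_q :=
  if k is k'.+1 then
    let b := gd n X Y delta b0 k' in
    b + (delta k' / n%:R) *: (X^T *m (Y - X *m b))
  else b0.

Definition design n q (x : 'I_n -> 'cV[R]_q) : 'M[R]_(n, q) :=
  \matrix_(i, j) x i j 0.

Definition response n (y : 'I_n -> R) : 'cV[R]_n := \col_i y i.

Definition gd_iter n q (x : 'I_n -> 'cV[R]_q) (y : 'I_n -> R)
    (delta : nat -> R) (b0 : 'cV[R]_q) (k : nat) : 'cV[R]_q :=
  gd n (design x) (response y) delta b0 k.

Definition gd_loo n q (x : 'I_n -> 'cV[R]_q) (y : 'I_n -> R)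
    (delta : nat -> R) (b0 : 'cV[R]_q) (k : nat) (i : 'I_n) : 'cV[R]_q :=
  gd n (row' i (design x)) (row' i (response y)) delta b0 k.

Definition loss q (psi : R * R -> R) (y : R) (x b : 'cV[R]_q) : R :=
  psi (y, (x^T *m b) 0 0).

Definition loo_risk n q (psi : R * R -> R) (x : 'I_n -> 'cV[R]_q)
    (y : 'I_n -> R) (delta : nat -> R) (b0 : 'cV[R]_q) (k : nat) : R :=
  n%:R^-1 * \sum_(i < n) loss psi (y i) (x i) (gd_loo x y delta b0 k i).

End linear_algebra.

Section transport.
Local Open Scope charge_scope.
Context (R : realType).

Definition is_coupling (mu nu : probability R R) (pi : probability (R * R)%type R)
  : Prop :=
  forall A : set R, measurable A ->
    pi (fst @^-1` A) = mu A /\ pi (snd @^-1` A) = nu A.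

Definition wasserstein2 (mu nu : probability R R) : \bar R :=
  sqrte (ereal_inf [set (\int[pi]_u ((u.1 - u.2) ^+ 2)%:E)%E
                   | pi in [set pi | is_coupling mu nu pi]]).

Definition KL (nu mu : probability R R) : \bar R :=
  if `[< nu `<< mu >] then
    (\int[nu]_t (ln (fine ('d (charge_of_finite_measure nu) '/d mu t)))%:E)%E
  else +oo%E.

(* The library sets 0 * +oo = 0, so the inequality is required only where the
   divergence is finite; elsewhere its right-hand side is read as +oo, also when
   sigma = 0. *)
Definition T2_inequality (mu : probability R R) (sigma : R) : Prop :=
  0 <= sigma /\
  forall nu : probability R R, (KL nu mu < +oo)%E ->
    (wasserstein2 mu nu <= sqrte ((2 * sigma ^+ 2)%:E * KL nu mu))%E.

End transport.

Section random_elements.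
Context d (T : measurableType d) (R : realType) (P : probability T R).

Definition has_law dU (U : measurableType dU) (X : T -> U)
    (mu : probability U R) : Prop :=
  forall B : set U, measurable B -> P (X @^-1` B) = mu B.

Definition same_law dU (U : measurableType dU) (X Y : T -> U) : Prop :=
  forall B : set U, measurable B -> P (X @^-1` B) = P (Y @^-1` B).

Definition independent_of dU (U : measurableType dU) dV (V : measurableType dV)
    (X : T -> U) (Y : T -> V) : Prop :=
  forall (A : set U) (B : set V), measurable A -> measurable B ->
    P (X @^-1` A `&` Y @^-1` B) = (P (X @^-1` A) * P (Y @^-1` B))%E.

Definition mutually_independent (J : finType) dU (U : measurableType dU)
    (X : J -> T -> U) : Prop :=
  forall (S : {set J}) (B : J -> set U), (forall j, measurable (B j)) ->
    P (\bigcap_(j in [set` S]) X j @^-1` B j) =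
    (\prod_(j in S) P (X j @^-1` B j))%E.

Definition iid (J : finType) dU (U : measurableType dU) (X : J -> T -> U)
  : Prop :=
  mutually_independent X /\ forall i j, same_law (X i) (X j).

Definition sigma_of dU (U : measurableType dU) (X : T -> U) : set (set T) :=
  preimage_set_system setT X measurable.

(* Z is a version of E[Y | G]. *)
Definition is_cond_exp (G : set (set T)) (Y Z : T -> R) : Prop :=
  [/\ forall B : set R, measurable B -> G (Z @^-1` B),
      P.-integrable setT (EFin \o Z) &
      forall A, G A ->
        (\int[P]_(w in A) (Z w)%:E = \int[P]_(w in A) (Y w)%:E)%E].

End random_elements.

(* Main.v *)
(* On the event that the design matrix has operator norm O(sqrt n) and the
   responses have norm O(sqrt n), the matrix of the differences between the
   iterates and their leave-one-out versions obeys the recursion [loo_gapS], so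
   Gronwall's lemma bounds it, and its variation with the data, in Frobenius
   norm.  Hence on this event the error (leave-one-out risk minus population
   risk) is a Lipschitz function of the data with constant O(1 / sqrt n) and is
   within O(1 / sqrt n) of an average of losses that are centred given the other
   samples.  The T2 inequalities are used through their dual form
   [transport_bound], which tensorizes and yields subgaussian concentration, both
   for the error and, through a net, for the operator norm.  The resulting tail
   exp (c - sqrt n * eps), summed over the at most n iterates, is summable in n,
   and Borel-Cantelli concludes.  A conditional expectation of a function of
   independent data and test point is a.s. the partial integral. *)
From HB Require Import structures.
Require Import Defs.
From mathcomp Require Import measurable_realfun ring lra.
Set Implicit Arguments.
Unset Strict Implicit.
Unset Printing Implicit Defensive.
Import Order.TTheory GRing.Theory Num.Theory numFieldNormedType.Exports.
Local Open Scope classical_set_scope.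
Local Open Scope ring_scope.

(** Neither the descent nor the loss is globally Lipschitz: the iterates are polynomial in the data
    and [psi] may grow quadratically. Hence the restriction to a good event. No Lipschitz extension
    is needed there: the dual inequality compares two functions, and off the event one is set to a
    low and the other to a high constant. This costs the supremum of the scaled error times the
    probability of the bad event, which is exponentially small in [n]. The gaps are handled as one
    matrix because a bound O(1) on its Frobenius norm makes the average column norm O(1 / sqrt n);
    bounding the columns separately would involve the largest feature norm and the largest residual.
    Gronwall sees the step sizes only through their sum, so the constants are uniform in the number
    of steps, which enters through the union bound. Concentration is around the mean, and the mean
    must be shown to vanish separately. The leave-one-out losses are centred over the whole space
    but not over the good event; a second-moment bound pays for the difference. *)

Lemma le_of_eq disp (T : porderType disp) (a b : T) : a = b -> (a <= b)%O.
Proof. by move=> ->. Qed.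

Lemma sqr_le4 (R : realDomainType) (t : R) : t ^+ 2 <= 1 + t ^+ 4.
Proof.
have -> : t ^+ 4 = (t ^+ 2) ^+ 2 by rewrite -exprM.
have := sqr_ge0 (t ^+ 2 - 1); have := sqr_ge0 t; nra.
Qed.

(** From [1 + u <= expR u] at [u = t / m], raised to the power [m]. It turns exponential tails into
    polynomial ones and exponential moments into fourth moments. *)
Lemma exp_ge_power (R : realType) (t : R) (m : nat) : (0 < m)%N -> 0 <= t -> (t / m%:R) ^+ m <= expR t.
Proof.
move=> m0 t0; have mR : 0 < m%:R :> R by rewrite ltr0n.
have -> : expR t = expR (t / m%:R) ^+ m.
  by rewrite -expRM_natl mulrC divfK// lt0r_neq0.
apply: lerXn2r; rewrite ?nnegrE ?divr_ge0 ?expR_ge0//.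
by apply: le_trans (expR_ge1Dx _); rewrite lerDr.
Qed.

(** * Finite sums and the Cauchy-Schwarz inequality *)

Section sums.
Context (R : realType) (I : finType).
Implicit Types a b : I -> R.

Lemma sumr_sqr_ge0 (P : pred I) a : 0 <= \sum_(i | P i) a i ^+ 2.
Proof. by apply: sumr_ge0 => i _; exact: sqr_ge0. Qed.

Lemma cauchy_schwarz a b :
  \sum_i a i * b i <= Num.sqrt (\sum_i a i ^+ 2) * Num.sqrt (\sum_i b i ^+ 2).
Proof.
set s := Num.sqrt _; set t := Num.sqrt _.
have s0 : 0 <= s by exact: sqrtr_ge0.
have t0 : 0 <= t by exact: sqrtr_ge0.
have ss : s ^+ 2 = \sum_i a i ^+ 2 by rewrite sqr_sqrtr// sumr_sqr_ge0.
have tt : t ^+ 2 = \sum_i b i ^+ 2 by rewrite sqr_sqrtr// sumr_sqr_ge0.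
have zero (c : I -> R) : \sum_i c i ^+ 2 = 0 -> forall i, c i = 0.
  move=> c0 i; apply/eqP; rewrite -sqrf_eq0; apply/eqP.
  exact: (psumr_eq0P (fun i _ => sqr_ge0 (c i)) c0).
have [s00|sn0] := eqVneq s 0.
  rewrite big1 ?s00 ?mul0r// => i _.
  by rewrite (zero a) ?mul0r// -ss s00 expr0n.
have [t00|tn0] := eqVneq t 0.
  rewrite big1 ?t00 ?mulr0// => i _.
  by rewrite (zero b) ?mulr0// -tt t00 expr0n.
(* The sum expands to [2 * s * t * (s * t - \sum_i a i * b i)], and [s * t] is positive here. *)
have : \sum_i (t * a i - s * b i) ^+ 2 >= 0 by exact: sumr_sqr_ge0.
have -> : \sum_i (t * a i - s * b i) ^+ 2 =
    t ^+ 2 * \sum_i a i ^+ 2 - 2 * (s * t) * \sum_i a i * b i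
    + s ^+ 2 * \sum_i b i ^+ 2.
  rewrite !mulr_sumr -sumrB -big_split /=; apply: eq_bigr => i _; ring.
rewrite -ss -tt; set S := \sum_i _ => h.
have st : 0 < s * t by rewrite mulr_gt0// lt0r ?sn0 ?tn0.
rewrite -(ler_pM2l st); nra.
Qed.

Lemma ler_sqrt_sum (P : pred I) a c : 0 <= c ->
  \sum_(i | P i) a i ^+ 2 <= c ^+ 2 -> Num.sqrt (\sum_(i | P i) a i ^+ 2) <= c.
Proof.
move=> c0 h; rewrite -(ler_pXn2r (n := 2))// ?nnegrE ?sqrtr_ge0//.
by rewrite sqr_sqrtr// sumr_sqr_ge0.
Qed.

End sums.

(** * Frobenius norms and operator-norm bounds *)

Section frobenius.
Context (R : realType).

(** Summing over index pairs makes the triangle inequality an instance of [cauchy_schwarz] over one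
    finite type. *)
Definition frob m n (A : 'M[R]_(m, n)) : R :=
  Num.sqrt (\sum_(ij : 'I_m * 'I_n) A ij.1 ij.2 ^+ 2).

Lemma frob_ge0 m n (A : 'M[R]_(m, n)) : 0 <= frob A.
Proof. exact: sqrtr_ge0. Qed.

Lemma frob_sqr m n (A : 'M[R]_(m, n)) : frob A ^+ 2 = \sum_i \sum_j A i j ^+ 2.
Proof. by rewrite sqr_sqrtr ?sumr_sqr_ge0// pair_bigA. Qed.

Lemma frob_sqr_col m n (A : 'M[R]_(m, n)) :
  frob A ^+ 2 = \sum_j \sum_i A i j ^+ 2.
Proof. by rewrite frob_sqr exchange_big. Qed.

Lemma l2normE q (v : 'cV[R]_q) : l2norm v = frob v.
Proof.
rewrite /l2norm /frob -(pair_bigA _ (fun i j => v i j ^+ 2)) /=.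
by congr Num.sqrt; apply: eq_bigr => i _; rewrite big_ord1.
Qed.

Lemma l2norm_ge0 q (v : 'cV[R]_q) : 0 <= l2norm v.
Proof. exact: sqrtr_ge0. Qed.

Lemma l2norm_sqr q (v : 'cV[R]_q) : l2norm v ^+ 2 = \sum_i v i 0 ^+ 2.
Proof. by rewrite sqr_sqrtr// sumr_sqr_ge0. Qed.

Lemma frob_sqr_sum_col m n (A : 'M[R]_(m, n)) :
  frob A ^+ 2 = \sum_j l2norm (col j A) ^+ 2.
Proof.
rewrite frob_sqr_col; apply: eq_bigr => j _.
by rewrite l2norm_sqr; apply: eq_bigr => i _; rewrite mxE.
Qed.

Lemma frob0 m n : frob (0 : 'M[R]_(m, n)) = 0.
Proof.
by rewrite /frob big1 ?sqrtr0// => ij _; rewrite mxE expr0n.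
Qed.

Lemma frobZ m n (c : R) (A : 'M[R]_(m, n)) : frob (c *: A) = `|c| * frob A.
Proof.
rewrite /frob -sqrtr_sqr -sqrtrM ?sqr_ge0// mulr_sumr; congr Num.sqrt.
by apply: eq_bigr => ij _; rewrite mxE exprMn.
Qed.

Lemma frobN m n (A : 'M[R]_(m, n)) : frob (- A) = frob A.
Proof. by rewrite -scaleN1r frobZ normrN1 mul1r. Qed.

Lemma frob_tr m n (A : 'M[R]_(m, n)) : frob A^T = frob A.
Proof.
apply/eqP; rewrite -(eqrXn2 (n := 2))// ?frob_ge0//; apply/eqP.
rewrite frob_sqr_col frob_sqr.
by apply: eq_bigr => i _; apply: eq_bigr => j _; rewrite mxE.
Qed.

Lemma frobD m n (A B : 'M[R]_(m, n)) : frob (A + B) <= frob A + frob B.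
Proof.
apply: ler_sqrt_sum; first by rewrite addr_ge0 ?frob_ge0.
rewrite sqrrD !sqr_sqrtr ?sumr_sqr_ge0//.
under eq_bigr do rewrite mxE sqrrD.
rewrite !big_split /= lerD2r lerD2l mulr2n.
by rewrite lerD// cauchy_schwarz.
Qed.

Lemma frobB m n (A B : 'M[R]_(m, n)) : frob (A - B) <= frob A + frob B.
Proof. by rewrite (le_trans (frobD _ _))// frobN. Qed.

Lemma frob_distC m n (A B : 'M[R]_(m, n)) : frob (A - B) = frob (B - A).
Proof. by rewrite -frobN opprB. Qed.

Lemma ler_frob_dist m n (A B : 'M[R]_(m, n)) : `|frob A - frob B| <= frob (A - B).
Proof.
have := frobD (A - B) B; have := frobD (B - A) A.
rewrite !subrK (frob_distC B A) => h1 h2.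
by rewrite ler_norml; apply/andP; split; lra.
Qed.

Lemma ler_abs_frob m n (A : 'M[R]_(m, n)) i j : `|A i j| <= frob A.
Proof.
rewrite -(ler_pXn2r (n := 2))// ?nnegrE ?frob_ge0// real_normK ?num_real//.
rewrite sqr_sqrtr ?sumr_sqr_ge0// (bigD1 (i, j))//= lerDl.
exact: sumr_sqr_ge0.
Qed.

(* [c] bounds the operator norm of [A]. *)
Definition opb m n (A : 'M[R]_(m, n)) (c : R) : Prop :=
  0 <= c /\ forall v : 'cV[R]_n, frob (A *m v) <= c * frob v.

Lemma opb_ge0 m n (A : 'M[R]_(m, n)) c : opb A c -> 0 <= c.
Proof. by case. Qed.

(** The squared Frobenius norm is a sum over columns, and the operator bound applies to each column
    of [B]. *)
Lemma frob_opb m n p (A : 'M[R]_(m, n)) (B : 'M[R]_(n, p)) c :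
  opb A c -> frob (A *m B) <= c * frob B.
Proof.
move=> [c0 cA].
rewrite -(ler_pXn2r (n := 2))// ?nnegrE ?mulr_ge0 ?frob_ge0//.
rewrite exprMn !frob_sqr_sum_col mulr_sumr; apply: ler_sum => j _.
rewrite -exprMn ler_pXn2r// ?nnegrE ?mulr_ge0 ?l2norm_ge0//.
by rewrite !l2normE !colE -mulmxA cA.
Qed.

Lemma dot_frob q (u v : 'cV[R]_q) : `|(u^T *m v) 0 0| <= frob u * frob v.
Proof.
rewrite -!l2normE mxE.
have le (u' : 'cV[R]_q) : \sum_j u'^T 0 j * v j 0 <= l2norm u' * l2norm v.
  by under eq_bigr do rewrite mxE; exact: cauchy_schwarz.
rewrite ler_norml le andbT lerNl -sumrN.
rewrite (le_trans _ (le_trans (le (- u)) _))//; last by rewrite !l2normE frobN.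
by apply: ler_sum => i _; rewrite !mxE mulNr.
Qed.

Lemma frob_sqr_dot q (v : 'cV[R]_q) : frob v ^+ 2 = (v^T *m v) 0 0.
Proof.
rewrite -l2normE l2norm_sqr mxE.
by apply: eq_bigr => i _; rewrite !mxE expr2.
Qed.

(** Duality: the squared norm of [A^T *m v] is the inner product of [v] with [A *m (A^T *m v)], at
    most [frob v * (c * frob (A^T *m v))]; one factor cancels. *)
Lemma opb_tr m n (A : 'M[R]_(m, n)) c : opb A c -> opb A^T c.
Proof.
move=> [c0 cA]; split=> // v.
have [->|n0] := eqVneq (frob (A^T *m v)) 0; first by rewrite mulr_ge0 ?frob_ge0.
have n1 : 0 < frob (A^T *m v) by rewrite lt0r n0 frob_ge0.
rewrite -(ler_pM2r n1) -expr2 frob_sqr_dot trmx_mul trmxK -mulmxA.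
rewrite (le_trans (ler_norm _))// (le_trans (dot_frob _ _))//.
rewrite mulrAC (mulrC (c * _)) ler_wpM2l ?frob_ge0//.
Qed.

Lemma opb_frob m n (A : 'M[R]_(m, n)) : opb A (frob A).
Proof.
split=> [|v]; first exact: frob_ge0.
rewrite -(ler_pXn2r (n := 2))// ?nnegrE ?mulr_ge0 ?frob_ge0//.
rewrite exprMn (frob_sqr A) (frob_sqr (A *m v)) mulr_suml.
apply: ler_sum => i _; rewrite big_ord1 mxE -real_normK ?num_real//.
have := dot_frob (row i A)^T v; rewrite trmxK frob_tr => h.
have -> : \sum_j A i j * v j 0 = (row i A *m v) 0 0.
  by rewrite mxE; apply: eq_bigr => j _; rewrite mxE.
have -> : \sum_j A i j ^+ 2 = frob (row i A) ^+ 2.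
  by rewrite frob_sqr big_ord1; apply: eq_bigr => j _; rewrite mxE.
by rewrite -exprMn ler_pXn2r// nnegrE mulr_ge0 ?frob_ge0.
Qed.

Lemma frob_mul m n p (A : 'M[R]_(m, n)) (B : 'M[R]_(n, p)) :
  frob (A *m B) <= frob A * frob B.
Proof. exact: frob_opb (opb_frob A). Qed.

End frobenius.

(** * A discrete Gronwall inequality *)

Section gronwall.
Context (R : realType) (K : nat) (delta : nat -> R) (Delta : R).
Hypothesis delta_ge0 : forall k, (k < K)%N -> 0 <= delta k.
Hypothesis sum_delta : \sum_(0 <= k < K) delta k <= Delta.

Lemma sum_delta_ge0 k : (k <= K)%N -> 0 <= \sum_(0 <= j < k) delta j.
Proof.
move=> kK; rewrite big_nat sumr_ge0// => j /andP[_ jk].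
exact: delta_ge0 (leq_trans jk kK).
Qed.

Lemma sum_delta_le k : (k <= K)%N -> \sum_(0 <= j < k) delta j <= Delta.
Proof.
move=> kK; apply: le_trans sum_delta.
rewrite [leRHS](@big_cat_nat _ _ _ k)//= lerDl.
rewrite big_nat sumr_ge0// => j /andP[_ jK]; exact: delta_ge0.
Qed.

(** Only the total step size enters, so the bound is the same for every number of steps. *)
Lemma gronwall (a : nat -> R) (c e : R) : 0 <= a 0%N -> 0 <= c -> 0 <= e ->
  (forall k, (k < K)%N -> a k.+1 <= a k + delta k * (c * a k + e)) ->
  forall k, (k <= K)%N -> a k <= (a 0%N + Delta * e) * expR (c * Delta).
Proof.
move=> a0 c0 e0 step k kK; pose t k := \sum_(0 <= j < k) delta j.
(* The induction is run with the partial sum [t k] in place of [Delta]; it grows by exactly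
   [delta k], which matches [1 + c * delta k <= expR (c * delta k)]. *)
suff h : a k <= (a 0%N + t k * e) * expR (c * t k).
  apply: (le_trans h); have tk := sum_delta_le kK.
  have tk0 := sum_delta_ge0 kK.
  apply: ler_pM; rewrite ?expR_ge0 ?addr_ge0 ?mulr_ge0//.
    by rewrite lerD2l ler_wpM2r.
  by rewrite ler_expR ler_wpM2l.
elim: k kK => [|k ih] kK; first by rewrite /t big_geq// mulr0 expR0 mul0r addr0 mulr1.
have dk := delta_ge0 kK; have tk0 := sum_delta_ge0 (ltnW kK).
have tS : t k.+1 = t k + delta k by rewrite /t big_nat_recr.
have {}ih := ih (ltnW kK).
have cd0 : 0 <= c * delta k by exact: mulr_ge0.
have E1 := expR_ge1Dx (c * delta k).
have E2 : 1 <= expR (c * t k.+1).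
  by rewrite -expR0 ler_expR mulr_ge0// tS addr_ge0.
have EE : expR (c * t k.+1) = expR (c * t k) * expR (c * delta k).
  by rewrite tS mulrDr expRD.
apply: (le_trans (step _ kK)).
have -> : a k + delta k * (c * a k + e) = (1 + c * delta k) * a k + delta k * e.
  ring.
apply: (@le_trans _ _ ((1 + c * delta k) * ((a 0%N + t k * e) * expR (c * t k))
   + delta k * e)); first by rewrite lerD2r ler_wpM2l// addr_ge0.
have -> : (a 0%N + t k.+1 * e) * expR (c * t k.+1) =
    (a 0%N + t k * e) * expR (c * t k.+1) + delta k * e * expR (c * t k.+1).
  by rewrite -mulrDl; congr (_ * _); rewrite tS; ring.
apply: lerD.
  rewrite EE (mulrC (1 + _)) -!mulrA ler_wpM2l ?addr_ge0 ?mulr_ge0//.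
  by rewrite ler_wpM2l ?expR_ge0.
by rewrite ler_peMr ?mulr_ge0.
Qed.

End gronwall.

(** * Gradient descent and its leave-one-out versions *)

Section descent.
Context (R : realType).

Definition diagc n (M : 'M[R]_n) : 'cV[R]_n := \col_i M i i.

Definition diagm n (r : 'cV[R]_n) : 'M[R]_n := diag_mx r^T.

Lemma frob_diagc n (M : 'M[R]_n) : frob (diagc M) <= frob M.
Proof.
rewrite -l2normE; apply: ler_sqrt_sum; first exact: frob_ge0.
rewrite frob_sqr; apply: ler_sum => i _; rewrite mxE (bigD1 i)//= lerDl.
exact: sumr_sqr_ge0.
Qed.

Lemma frob_diagm n (r : 'cV[R]_n) : frob (diagm r) = frob r.
Proof.
apply/eqP; rewrite -(eqrXn2 (n := 2))// ?frob_ge0//; apply/eqP.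
rewrite !frob_sqr; apply: eq_bigr => i _; rewrite big_ord1 (bigD1 i)//= !mxE.
rewrite eqxx mulr1n big1 ?addr0// => j ji.
by rewrite !mxE eq_sym (negbTE ji) mulr0n expr0n.
Qed.

Lemma diagmB n (r s : 'cV[R]_n) : diagm (r - s) = diagm r - diagm s.
Proof. by rewrite /diagm linearB /= linearB. Qed.

Lemma diagcB n (A B : 'M[R]_n) : diagc (A - B) = diagc A - diagc B.
Proof. by apply/colP => i; rewrite !mxE. Qed.

Lemma mul_trmx_diagm n q (X : 'M[R]_(n, q)) r i j :
  (X^T *m diagm r) j i = X i j * r i 0.
Proof.
rewrite mxE (bigD1 i)//= big1 ?addr0 ?mxE ?eqxx ?mulr1n ?mxE// => l li.
by rewrite !mxE (negbTE li) mulr0n mulr0.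
Qed.

Section loo.
Context n q (x : 'I_n -> 'cV[R]_q) (y : 'I_n -> R) (delta : nat -> R)
  (b0 : 'cV[R]_q).
Let X := design x.
Let Y := response y.

Definition loo_pred k : 'cV[R]_n :=
  \col_i ((x i)^T *m gd_loo x y delta b0 k i) 0 0.

(** Column [i] is the effect of deleting sample [i]; with all columns in one matrix, a single norm
    controls the sum of their squares. *)
Definition loo_gap k : 'M[R]_(q, n) :=
  \matrix_(a, i) (gd_iter x y delta b0 k a 0 - gd_loo x y delta b0 k i a 0).

(** The gradient is a sum over samples, so deleting a row removes one summand. *)
Lemma row'_normal_eq (i : 'I_n) (b : 'cV[R]_q) :
  (row' i X)^T *m (row' i Y - row' i X *m b) =
  X^T *m (Y - X *m b) - (y i - ((x i)^T *m b) 0 0) *: x i.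
Proof.
have rE j : (Y - X *m b) j 0 = y j - ((x j)^T *m b) 0 0.
  rewrite !mxE; congr (_ - _); apply: eq_bigr => l _; by rewrite !mxE.
apply/colP => a; rewrite !mxE (bigD1_ord i)//= rE !mxE.
rewrite [X in _ = X]addrAC (mulrC (x i a 0)) subrr add0r.
apply: eq_bigr => j _; rewrite !mxE; congr (_ * (_ - _)).
by apply: eq_bigr => l _; rewrite !mxE.
Qed.

Lemma gd_looS k i : gd_loo x y delta b0 k.+1 i =
  let b := gd_loo x y delta b0 k i in
  b + (delta k / n%:R) *: (X^T *m (Y - X *m b)
    - (y i - ((x i)^T *m b) 0 0) *: x i).
Proof. by rewrite /gd_loo /= row'_normal_eq. Qed.

Lemma loo_gap0 : loo_gap 0 = 0.
Proof. by apply/matrixP => a i; rewrite !mxE subrr. Qed.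

(** With the predictions expressed through the full iterate and the gap, [loo_gapS] becomes a closed
    recursion once the full iterate is bounded. *)
Lemma loo_predE k :
  loo_pred k = X *m gd_iter x y delta b0 k - diagc (X *m loo_gap k).
Proof.
apply/colP => i; rewrite !mxE -sumrB; apply: eq_bigr => a _.
rewrite !mxE; ring.
Qed.

(** The summands removed from the [n] gradients assemble, column by column, into [X^T] times a
    diagonal matrix of leave-one-out residuals. On good data its Frobenius norm is at most the
    operator norm of [X] times the norm of the residuals, of order [n], which the factor [1 / n]
    compensates. *)
Lemma loo_gapS k : loo_gap k.+1 = loo_gap k
  - (delta k / n%:R) *: (X^T *m (X *m loo_gap k))
  + (delta k / n%:R) *: (X^T *m diagm (Y - loo_pred k)).
Proof.
apply/matrixP => a i.
have colX (M : 'M[R]_(q, n)) : (X^T *m (X *m M)) a i = (X^T *m (X *m col i M)) a 0.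
  rewrite !mxE; apply: eq_bigr => j _; congr (_ * _); rewrite !mxE.
  by apply: eq_bigr => l _; rewrite !mxE.
have -> : loo_gap k.+1 a i = (gd_iter x y delta b0 k.+1 - gd_loo x y delta b0 k.+1 i) a 0.
  by rewrite !mxE.
rewrite gd_looS /= /gd_iter /= -/(gd_iter x y delta b0 k).
set b := gd_iter _ _ _ _ _; set c := gd_loo _ _ _ _ _ _.
have -> : forall (M N : 'M[R]_(q, n)) s t, (loo_gap k - s *: M + t *: N) a i =
    loo_gap k a i - s * M a i + t * N a i by move=> *; rewrite !mxE.
rewrite mul_trmx_diagm colX.
have -> : col i (loo_gap k) = b - c by apply/colP => l; rewrite !mxE.
have -> : (Y - loo_pred k) i 0 = y i - ((x i)^T *m c) 0 0 by rewrite !mxE.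
rewrite !mulmxBr.
have -> : forall (u v w : 'cV[R]_q) s t, (b + s *: (u - v) - (c + s *: (u - w - t *: x i))) a 0
   = (b a 0 - c a 0) - s * (v - w) a 0 + s * (x i a 0 * t).
  move=> u v w s t; rewrite !mxE; ring.
by rewrite !mxE.
Qed.

End loo.

End descent.

(** * Deterministic bounds for good data *)

Section good.
Context (R : realType) (A : R).

(* [n] is the scaling of the descent, not the number [m] of rows. *)
Definition good n m q (X : 'M[R]_(m, q)) (Y : 'cV[R]_m) : Prop :=
  opb X (A * Num.sqrt n%:R) /\ frob Y <= A * Num.sqrt n%:R.

Lemma frob_tr_good n m q p (X : 'M[R]_(m, q)) Y (B : 'M[R]_(m, p)) c :
  good n X Y -> frob B <= c ->
  frob (X^T *m B) <= A * Num.sqrt n%:R * c.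
Proof.
move=> [oX _] Bc; apply: le_trans (frob_opb _ (opb_tr oX)) _.
by rewrite ler_wpM2l// (opb_ge0 oX).
Qed.

Lemma frob_good n m q p (X : 'M[R]_(m, q)) Y (B : 'M[R]_(q, p)) c :
  good n X Y -> frob B <= c ->
  frob (X *m B) <= A * Num.sqrt n%:R * c.
Proof.
move=> [oX _] Bc; apply: le_trans (frob_opb _ oX) _.
by rewrite ler_wpM2l// (opb_ge0 oX).
Qed.

End good.

Lemma subrBB (V : zmodType) (a b c d : V) : a - b - (c - d) = a - c - (b - d).
Proof. by rewrite !opprB addrACA [RHS]addrACA (addrC (- b)). Qed.

Lemma frob_le_mul (R : realType) m n p (A : 'M[R]_(m, n)) (B : 'M[R]_(n, p)) a b :
  frob A <= a -> frob B <= b -> frob (A *m B) <= a * b.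
Proof.
move=> Aa Bb; apply: (le_trans (frob_mul _ _)).
by apply: ler_pM; rewrite ?frob_ge0.
Qed.

Section bounds.
Context (R : realType) (A Delta B0 : R).

(** Gronwall's bound for an iterate: growth rate and forcing are both [A ^+ 2], the factor [1 / n]
    having absorbed two factors [sqrt n]. *)
Definition iter_bound : R := (B0 + Delta * A ^+ 2) * expR (A ^+ 2 * Delta).

(** The rate doubles to [2 * A ^+ 2] since the gap also feeds back through the residuals. *)
Definition gap_bound : R :=
  (Delta * (A ^+ 2 * (1 + iter_bound))) * expR (2 * A ^+ 2 * Delta).

(** The unit is [d / sqrt n]: a change [d] of the data is multiplied by one factor [sqrt n] and
    divided by [n]. *)
Definition iter_lip : R :=
  (Delta * (2 * A * (1 + iter_bound))) * expR (A ^+ 2 * Delta).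

Definition gap_lip : R :=
  (Delta * (A * (2 + 2 * iter_bound + 4 * gap_bound + A * iter_lip)))
  * expR (2 * A ^+ 2 * Delta).

(** Here the unit is [d]: multiplication by [X] cancels the gain [1 / sqrt n] of the iterates, and
    the average over the samples will restore it. *)
Definition pred_lip : R := iter_bound + gap_bound + A * iter_lip + A * gap_lip.

Context (K : nat) (delta : nat -> R).
Hypothesis A_ge0 : 0 <= A.
Hypothesis delta_ge0 : forall k, (k < K)%N -> 0 <= delta k.
Hypothesis sum_delta : \sum_(0 <= k < K) delta k <= Delta.

Let Delta_ge0 : 0 <= Delta.
Proof. exact: le_trans (sum_delta_ge0 delta_ge0 (leqnn K)) sum_delta. Qed.

Section fixed_size.
Context (n q : nat) (b0 : 'cV[R]_q).
Hypothesis n_gt0 : (0 < n)%N.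
Hypothesis b0B : frob b0 <= B0.

Let s : R := Num.sqrt n%:R.

Let s_gt0 : 0 < s. Proof. by rewrite sqrtr_gt0 ltr0n. Qed.

Let ss : s * s = n%:R. Proof. by rewrite -expr2 sqr_sqrtr// ler0n. Qed.

Let B0_ge0 : 0 <= B0. Proof. exact: le_trans (frob_ge0 _) b0B. Qed.

Let iter_bound_ge0 : 0 <= iter_bound.
Proof.
by rewrite mulr_ge0 ?expR_ge0// addr_ge0// mulr_ge0// sqr_ge0.
Qed.

Let gap_bound_ge0 : 0 <= gap_bound.
Proof.
by rewrite mulr_ge0 ?expR_ge0// mulr_ge0// mulr_ge0 ?sqr_ge0// addr_ge0.
Qed.

Let iter_lip_ge0 : 0 <= iter_lip.
Proof.
by rewrite mulr_ge0 ?expR_ge0// mulr_ge0// !mulr_ge0// addr_ge0.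
Qed.

Lemma step_ge0 k : (k < K)%N -> 0 <= delta k / n%:R.
Proof. by move=> kK; rewrite divr_ge0// delta_ge0. Qed.

Lemma frob_step k m p (M : 'M[R]_(m, p)) c : (k < K)%N ->
  frob M <= A * s * c -> frob ((delta k / n%:R) *: M) <= delta k * (A * (c / s)).
Proof.
move=> kK Mc; rewrite frobZ ger0_norm ?step_ge0//.
apply: le_trans (ler_wpM2l (step_ge0 kK) Mc) _.
rewrite -ss; apply: le_of_eq; field; exact: lt0r_neq0.
Qed.

Lemma gd_bound m (X : 'M[R]_(m, q)) Y k : good A n X Y -> (k <= K)%N ->
  frob (gd n X Y delta b0 k) <= iter_bound.
Proof.
move=> gXY kK.
apply: le_trans (gronwall delta_ge0 sum_delta
  (a := fun k => frob (gd n X Y delta b0 k)) (c := A ^+ 2) (e := A ^+ 2)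
  (frob_ge0 _) (sqr_ge0 _) (sqr_ge0 _) _ kK) _; last first.
  by rewrite ler_wpM2r ?expR_ge0// lerD2r.
move=> j jK /=; set b := gd _ _ _ _ _ _.
apply: le_trans (frobD _ _) _; rewrite lerD2l.
have h : frob (Y - X *m b) <= A * s * (1 + frob b).
  apply: le_trans (frobB _ _) _; rewrite mulrDr mulr1.
  by apply: lerD; [exact: gXY.2|exact: frob_good gXY _].
apply: le_trans (frob_step jK (frob_tr_good gXY h)) _.
rewrite ler_wpM2l ?delta_ge0//; apply: le_of_eq.
rewrite -?/s; field; exact: lt0r_neq0.
Qed.

Section one_sample.
Context (x : 'I_n -> 'cV[R]_q) (y : 'I_n -> R).
Let X := design x.
Let Y := response y.
Hypothesis gXY : good A n X Y.

(** Deleting a row lowers Frobenius norms and commutes with multiplication on the right, so both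
    bounds survive with the same scale [n]. *)
Lemma good_loo i : good A n (row' i X) (row' i Y).
Proof.
have le p (M : 'M[R]_(n, p)) : frob (row' i M) <= frob M.
  rewrite -(ler_pXn2r (n := 2))// ?nnegrE ?frob_ge0// !frob_sqr.
  rewrite [leRHS](bigD1_ord i)//=.
  under eq_bigr do under eq_bigr do rewrite mxE.
  by rewrite lerDr sumr_sqr_ge0.
case: gXY => [[c0 oX] Yc]; split; last exact: le_trans (le _ _) Yc.
split=> // v; apply: le_trans (oX v).
have -> : row' i X *m v = row' i (X *m v); last exact: le.
by apply/colP => j; rewrite !mxE; apply: eq_bigr => l _; rewrite !mxE.
Qed.

Lemma gd_iter_bound k : (k <= K)%N -> frob (gd_iter x y delta b0 k) <= iter_bound.
Proof. exact: gd_bound. Qed.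

Lemma gd_loo_bound k i : (k <= K)%N ->
  frob (gd_loo x y delta b0 k i) <= iter_bound.
Proof. exact/gd_bound/good_loo. Qed.

Lemma loo_pred_le k : (k <= K)%N -> frob (loo_pred x y delta b0 k) <=
  A * s * (iter_bound + frob (loo_gap x y delta b0 k)).
Proof.
move=> kK; rewrite loo_predE mulrDr; apply: le_trans (frobB _ _) _; apply: lerD.
  exact: frob_good gXY (gd_iter_bound kK).
by apply: le_trans (frob_diagc _) _; apply: frob_good gXY _.
Qed.

Lemma loo_gap_bound k : (k <= K)%N -> frob (loo_gap x y delta b0 k) <= gap_bound.
Proof.
move=> kK.
apply: le_trans (gronwall delta_ge0 sum_delta
  (a := fun k => frob (loo_gap x y delta b0 k)) (c := 2 * A ^+ 2)
  (e := A ^+ 2 * (1 + iter_bound)) (frob_ge0 _) _ _ _ kK) _.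
- by rewrite mulr_ge0// sqr_ge0.
- by rewrite mulr_ge0 ?sqr_ge0// addr_ge0.
- move=> j jK /=; rewrite loo_gapS; set G := loo_gap _ _ _ _ _.
  apply: le_trans (frobD _ _) _; apply: le_trans (lerD (frobB _ _) (lexx _)) _.
  rewrite -addrA lerD2l.
  have h1 := frob_step jK (frob_tr_good gXY (frob_good gXY (lexx (frob G)))).
  have h2 : frob (diagm (Y - loo_pred x y delta b0 j)) <=
      A * s * (1 + iter_bound + frob G).
    rewrite frob_diagm; apply: le_trans (frobB _ _) _.
    rewrite -addrA (mulrDr _ 1) mulr1.
    by apply: lerD; [exact: gXY.2|exact: loo_pred_le (ltnW jK)].
  apply: le_trans (lerD h1 (frob_step jK (frob_tr_good gXY h2))) _.
  rewrite -mulrDr ler_wpM2l ?delta_ge0//; apply: le_of_eq.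
  by rewrite -/G -/s; field; exact: lt0r_neq0.
- by rewrite loo_gap0 frob0 add0r.
Qed.

Lemma loo_pred_bound k : (k <= K)%N -> frob (loo_pred x y delta b0 k) <=
  A * s * (iter_bound + gap_bound).
Proof.
move=> kK; apply: le_trans (loo_pred_le kK) _.
by rewrite ler_wpM2l ?mulr_ge0 ?sqrtr_ge0// lerD2l loo_gap_bound.
Qed.

Lemma residual_bound k : (k <= K)%N ->
  frob (Y - loo_pred x y delta b0 k) <= A * s * (1 + iter_bound + gap_bound).
Proof.
move=> kK; apply: le_trans (frobB _ _) _; rewrite -addrA (mulrDr _ 1) mulr1.
by apply: lerD; [exact: gXY.2|exact: loo_pred_bound].
Qed.

End one_sample.

Section two_samples.
Context (x x' : 'I_n -> 'cV[R]_q) (y y' : 'I_n -> R) (d : R).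
Let X := design x.
Let Y := response y.
Let X' := design x'.
Let Y' := response y'.
Hypothesis gXY : good A n X Y.
Hypothesis gXY' : good A n X' Y'.
Hypothesis dX : frob (X - X') <= d.
Hypothesis dY : frob (Y - Y') <= d.

Let d_ge0 : 0 <= d. Proof. exact: le_trans (frob_ge0 _) dX. Qed.

(** The splitting [(M - M') *m N + M' *m (N - N')] uses the operator bound of [M'] and the Frobenius
    norm of [N], never that of [M], which for a design matrix would grow with the dimension. *)
Lemma frob_mulB p m1 m2 (M M' : 'M[R]_(m1, m2)) (N N' : 'M[R]_(m2, p)) a b c f :
  opb M' a -> frob (M - M') <= b -> frob N <= c -> frob (N - N') <= f ->
  frob (M *m N - M' *m N') <= b * c + a * f.
Proof.
move=> oM MM Nc NN.
have -> : M *m N - M' *m N' = (M - M') *m N + M' *m (N - N').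
  by rewrite mulmxBl mulmxBr addrA subrK.
apply: le_trans (frobD _ _) _; apply: lerD; first exact: frob_le_mul.
by apply: le_trans (frob_opb _ oM) _; rewrite ler_wpM2l// (opb_ge0 oM).
Qed.

Lemma gd_iter_lip k : (k <= K)%N ->
  frob (gd_iter x y delta b0 k - gd_iter x' y' delta b0 k) <= iter_lip * (d / s).
Proof.
move=> kK.
apply: le_trans (gronwall delta_ge0 sum_delta
  (a := fun k => frob (gd_iter x y delta b0 k - gd_iter x' y' delta b0 k))
  (c := A ^+ 2) (e := (2 * A * (1 + iter_bound)) * (d / s))
  (frob_ge0 _) (sqr_ge0 _) _ _ kK) _.
- by rewrite mulr_ge0 ?divr_ge0 ?(ltW s_gt0)// !mulr_ge0// addr_ge0.
- move=> j jK; rewrite /gd_iter /= -/X -/Y -/X' -/Y'.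
  set b := gd _ X _ _ _ _; set b' := gd _ X' _ _ _ _.
  rewrite opprD addrACA -scalerBr; apply: le_trans (frobD _ _) _; rewrite lerD2l.
  have bB : frob b <= iter_bound by exact: gd_iter_bound (ltnW jK).
  have h1 : frob (Y - X *m b) <= A * s * (1 + iter_bound).
    apply: le_trans (frobB _ _) _; rewrite mulrDr mulr1.
    by apply: lerD; [exact: gXY.2|exact: frob_good gXY _].
  have h2 : frob ((Y - X *m b) - (Y' - X' *m b')) <=
      d + (d * iter_bound + A * s * frob (b - b')).
    rewrite subrBB.
    apply: le_trans (frobB _ _) _; apply: lerD => //.
    exact: frob_mulB gXY'.1 dX bB (lexx _).
  have dXt : frob (X^T - X'^T) <= d by rewrite -linearB frob_tr.
  have h3 := frob_mulB (opb_tr gXY'.1) dXt h1 h2.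
  apply: le_trans (frob_step jK (c := 2 * d * (1 + iter_bound)
    + A * s * frob (b - b')) _) _.
    apply: le_trans h3 _; apply: le_of_eq; rewrite -?/s; ring.
  rewrite ler_wpM2l ?delta_ge0//; apply: le_of_eq.
  by rewrite -?/s; field; exact: lt0r_neq0.
- rewrite subrr frob0 add0r; apply: le_of_eq.
  rewrite /iter_lip; ring.
Qed.

(** The gap difference stays on the right because the recursion behind [loo_gap_lip] feeds it
    back. *)
Lemma loo_pred_lip_le k : (k <= K)%N ->
  frob (loo_pred x y delta b0 k - loo_pred x' y' delta b0 k) <=
  d * (iter_bound + A * iter_lip + gap_bound) +
  A * s * frob (loo_gap x y delta b0 k - loo_gap x' y' delta b0 k).
Proof.
move=> kK; rewrite !loo_predE -/X -/X' opprB addrACA (addrC (- diagc _)).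
set G := loo_gap x _ _ _ _; set G' := loo_gap x' _ _ _ _.
set b := gd_iter x _ _ _ _; set b' := gd_iter x' _ _ _ _.
have -> : X *m b + diagc (X' *m G') + (- (X' *m b') - diagc (X *m G)) =
   (X *m b - X' *m b') - diagc (X *m G - X' *m G').
  by rewrite diagcB opprB addrACA.
apply: le_trans (frobB _ _) _.
apply: le_trans (lerD (lexx _) (frob_diagc _)) _.
have h1 := frob_mulB gXY'.1 dX (gd_iter_bound gXY kK) (gd_iter_lip kK).
have h2 := frob_mulB gXY'.1 dX (loo_gap_bound gXY kK) (lexx (frob (G - G'))).
apply: le_trans (lerD h1 h2) _; apply: le_of_eq.
rewrite -?/s; field; exact: lt0r_neq0.
Qed.

Lemma loo_gap_lip k : (k <= K)%N ->
  frob (loo_gap x y delta b0 k - loo_gap x' y' delta b0 k) <= gap_lip * (d / s).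
Proof.
move=> kK.
apply: le_trans (gronwall delta_ge0 sum_delta
  (a := fun k => frob (loo_gap x y delta b0 k - loo_gap x' y' delta b0 k))
  (c := 2 * A ^+ 2) (e := (A * (2 + 2 * iter_bound + 4 * gap_bound + A * iter_lip))
   * (d / s))
  (frob_ge0 _) _ _ _ kK) _.
- by rewrite mulr_ge0// sqr_ge0.
- rewrite mulr_ge0 ?divr_ge0 ?(ltW s_gt0)// mulr_ge0//.
  by have := mulr_ge0 A_ge0 iter_lip_ge0; have := iter_bound_ge0; have := gap_bound_ge0; lra.
- move=> j jK; rewrite !loo_gapS -/X -/Y -/X' -/Y'.
  set G := loo_gap x _ _ _ _; set G' := loo_gap x' _ _ _ _.
  set u := loo_pred x _ _ _ _; set u' := loo_pred x' _ _ _ _.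
  set t := delta j / n%:R.
  have -> : forall P P' Q Q' : 'M[R]_(q, n),
      G - t *: P + t *: Q - (G' - t *: P' + t *: Q') =
      (G - G') - t *: (P - P') + t *: (Q - Q').
    by move=> P P' Q Q'; apply/matrixP => a b; rewrite !mxE; ring.
  apply: le_trans (frobD _ _) _; apply: le_trans (lerD (frobB _ _) (lexx _)) _.
  rewrite -addrA lerD2l.
  have dXt : frob (X^T - X'^T) <= d by rewrite -linearB frob_tr.
  have GB : frob G <= gap_bound by exact: loo_gap_bound (ltnW jK).
  have h1 := frob_mulB gXY'.1 dX GB (lexx (frob (G - G'))).
  have h2 := frob_mulB (opb_tr gXY'.1) dXt (frob_good gXY GB) h1.
  have h3 : frob (diagm (Y - u) - diagm (Y' - u')) <= d +
    (d * (iter_bound + A * iter_lip + gap_bound) + A * s * frob (G - G')).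
    rewrite -diagmB frob_diagm.
    rewrite subrBB.
    apply: le_trans (frobB _ _) _; apply: lerD => //.
    exact: loo_pred_lip_le (ltnW jK).
  have h4 : frob (diagm (Y - u)) <= A * s * (1 + iter_bound + gap_bound).
    by rewrite frob_diagm; exact: residual_bound (ltnW jK).
  have h5 := frob_mulB (opb_tr gXY'.1) dXt h4 h3.
  apply: le_trans (lerD (frob_step jK (c := 2 * d * gap_bound
    + A * s * frob (G - G')) _) (frob_step jK (c := d * (1 + iter_bound + gap_bound)
     + (d + (d * (iter_bound + A * iter_lip + gap_bound) + A * s * frob (G - G')))) _)) _.
  + apply: le_trans h2 _; apply: le_of_eq; rewrite -?/s; ring.
  + apply: le_trans h5 _; apply: le_of_eq; rewrite -?/s; ring.
  rewrite -mulrDr ler_wpM2l ?delta_ge0//; apply: le_of_eq.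
  by rewrite -?/s; field; exact: lt0r_neq0.
- rewrite !loo_gap0 subrr frob0 add0r; apply: le_of_eq.
  rewrite /gap_lip; ring.
Qed.

Lemma loo_pred_lip k : (k <= K)%N ->
  frob (loo_pred x y delta b0 k - loo_pred x' y' delta b0 k) <= pred_lip * d.
Proof.
move=> kK; apply: le_trans (loo_pred_lip_le kK) _.
have As : 0 <= A * s by rewrite mulr_ge0 ?sqrtr_ge0.
apply: le_trans (lerD (lexx _) (ler_wpM2l As (loo_gap_lip kK))) _.
apply: le_of_eq; rewrite /pred_lip.
by rewrite -?/s; field; exact: lt0r_neq0.
Qed.

End two_samples.

End fixed_size.

End bounds.

(** * Losses whose gradient grows linearly *)

Section local_lipschitz.
Context (R : realType) (psi : R * R -> R) (C_psi Cbar_psi : R).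
Hypothesis hpsi : forall u, differentiable psi u.
Hypothesis hC : 0 <= C_psi.
Hypothesis hCbar : 0 <= Cbar_psi.
Hypothesis hgrad :
  forall u, l2norm2 (grad2 psi u) <= C_psi * l2norm2 u + Cbar_psi.

Lemma l2norm2_le (u : R * R) : l2norm2 u <= `|u.1| + `|u.2|.
Proof.
rewrite -(ler_pXn2r (n := 2))// ?nnegrE ?sqrtr_ge0 ?addr_ge0//.
rewrite sqr_sqrtr ?addr_ge0 ?sqr_ge0// sqrrD !real_normK ?num_real//.
by rewrite -addrA lerD2l lerDr mulrn_wge0// mulr_ge0.
Qed.

Lemma ler_abs_l2norm2 (u : R * R) :
  `|u.1| <= l2norm2 u /\ `|u.2| <= l2norm2 u.
Proof.
split; rewrite -(ler_pXn2r (n := 2))// ?nnegrE ?sqrtr_ge0//;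
  rewrite sqr_sqrtr ?addr_ge0 ?sqr_ge0// real_normK ?num_real//.
  by rewrite lerDl sqr_ge0.
by rewrite lerDr sqr_ge0.
Qed.

Lemma psi_derive_le (u v : R * R) :
  `|'D_v psi u| <= (C_psi * (`|u.1| + `|u.2|) + Cbar_psi) * (`|v.1| + `|v.2|).
Proof.
have -> : 'D_v psi u = v.1 * (grad2 psi u).1 + v.2 * (grad2 psi u).2.
  rewrite /= !deriveE//.
  have -> : v = v.1 *: ((1, 0) : R * R) + v.2 *: ((0, 1) : R * R).
    case: v => a b; congr pair => /=; rewrite /GRing.scale /=.
      by rewrite mulr1 mulr0 addr0.
    by rewrite mulr1 mulr0 add0r.
  by rewrite linearD !linearZ /= /GRing.scale /= !mulr1 !mulr0 !addr0 !add0r.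
have [h1 h2] := ler_abs_l2norm2 (grad2 psi u).
have h : l2norm2 (grad2 psi u) <= C_psi * (`|u.1| + `|u.2|) + Cbar_psi.
  by apply: le_trans (hgrad u) _; rewrite lerD2r ler_wpM2l// l2norm2_le.
apply: le_trans (ler_normD _ _) _; rewrite !normrM mulrDr.
by apply: lerD; rewrite mulrC ler_wpM2r// (le_trans _ h).
Qed.

(** Mean value theorem along the segment between the two points, on which the gradient is at most
    linear in the norms of the endpoints. *)
Lemma psi_local_lip (a b a' b' : R) : `|psi (a, b) - psi (a', b')| <=
  (C_psi + Cbar_psi) * (1 + `|a| + `|b| + `|a'| + `|b'|) * (`|a - a'| + `|b - b'|).
Proof.
pose v : R * R := (a - a', b - b').
pose g (t : R) := psi ((a', b') + t *: v).
have dg (t : R) : is_derive t 1 g ('D_v psi ((a', b') + t *: v)).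
  set u := (a', b') + t *: v.
  have E : (fun h : R => h^-1 *: ((g \o shift t) (h *: 1) - g t)) =
           (fun h : R => h^-1 *: ((psi \o shift u) (h *: v) - psi u)).
    apply/funext => h /=; rewrite /g /u; congr (_ *: (psi _ - _)).
    by rewrite /shift/= [h *: 1]mulr1 scalerDl addrCA.
  have duv := diff_derivable (v := v) (hpsi u).
  split; first by rewrite /derivable E.
  by rewrite /derive E.
have [c c01 hc] : exists2 c, c \in `[(0:R), 1]%R & g 1 - g 0 = 'D_v psi ((a', b') + c *: v) * (1 - 0).
  apply: (@MVT_segment _ g) => //.
  apply: continuous_subspaceT => t; apply/differentiable_continuous/derivable1_diffP.
  exact: ex_derive.
have g1 : g 1 = psi (a, b) by rewrite /g scale1r; congr psi; congr pair => /=; ring.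
have g0 : g 0 = psi (a', b') by rewrite /g scale0r addr0.
rewrite -g1 -g0 hc subr0 mulr1; apply: le_trans (psi_derive_le _ _) _ => /=.
rewrite ler_wpM2r ?addr_ge0//.
move: c01; rewrite in_itv /= => /andP[c0 c1].
have conv (p q : R) : `|q + c *: (p - q)| <= `|p| + `|q|.
  have -> : q + c *: (p - q) = c * p + (1 - c) * q by rewrite /GRing.scale /=; ring.
  apply: le_trans (ler_normD _ _) _; rewrite !normrM (ger0_norm c0).
  rewrite (ger0_norm (_ : 0 <= 1 - c)) ?subr_ge0//.
  by apply: lerD; rewrite ler_piMl// gerBl.
have := conv a a'; have := conv b b' => h1 h2.
have h : `|a' + c *: (a - a')| + `|b' + c *: (b - b')|
    <= (`|a| + `|b| + `|a'| + `|b'|) by lra.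
have := ler_wpM2l hC h; set N := _ + _ + _ + _ => h3.
apply: le_trans (lerD h3 (lexx _)) _.
have N0 : 0 <= N by rewrite !addr_ge0.
have -> : 1 + `|a| + `|b| + `|a'| + `|b'| = 1 + N by rewrite /N; ring.
have -> : (C_psi + Cbar_psi) * (1 + N) = C_psi * N + Cbar_psi + (C_psi + Cbar_psi * N).
  by ring.
by rewrite lerDl addr_ge0// mulr_ge0.
Qed.

Definition psi_lip : R := C_psi + Cbar_psi.

Let psi_lip_ge0 : 0 <= psi_lip. Proof. exact: addr_ge0. Qed.

Definition absm n (a : 'cV[R]_n) : 'cV[R]_n := \col_i `|a i 0|.

Lemma frob_absm n (a : 'cV[R]_n) : frob (absm a) = frob a.
Proof.
by rewrite -!l2normE; congr Num.sqrt; apply: eq_bigr => i _;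
  rewrite mxE real_normK ?num_real.
Qed.

Lemma frob_const1 n : frob (const_mx 1 : 'cV[R]_n) = Num.sqrt n%:R.
Proof.
rewrite -l2normE; congr Num.sqrt.
under eq_bigr do rewrite mxE expr1n.
by rewrite sumr_const card_ord.
Qed.

(** Cauchy-Schwarz over the samples separates a size factor, of order [sqrt n] on good data, from a
    variation factor. *)
Lemma sum_psi_lip n (a b a' b' : 'cV[R]_n) :
  \sum_i `|psi (a i 0, b i 0) - psi (a' i 0, b' i 0)| <=
  psi_lip * (Num.sqrt n%:R + frob a + frob b + frob a' + frob b')
  * (frob (a - a') + frob (b - b')).
Proof.
pose p := const_mx 1 + absm a + absm b + absm a' + absm b'.
pose q := absm (a - a') + absm (b - b').
have pE i : p i 0 = 1 + `|a i 0| + `|b i 0| + `|a' i 0| + `|b' i 0|.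
  by rewrite !mxE.
have qE i : q i 0 = `|a i 0 - a' i 0| + `|b i 0 - b' i 0| by rewrite !mxE.
apply: (@le_trans _ _ (\sum_i psi_lip * (p i 0 * q i 0))).
  by apply: ler_sum => i _; rewrite pE qE mulrA; exact: psi_local_lip.
rewrite -mulr_sumr -mulrA ler_wpM2l//.
apply: le_trans (cauchy_schwarz _ _) _.
rewrite -/(l2norm p) -/(l2norm q) !l2normE.
apply: ler_pM; rewrite ?frob_ge0//; last first.
  by apply: le_trans (frobD _ _) _; rewrite !frob_absm.
do 4!(apply: le_trans (frobD _ _) _; rewrite frob_absm; apply: lerD => //).
by rewrite frob_const1.
Qed.

End local_lipschitz.

(** * The leave-one-out risk on good data *)

Section loo_risk.
Context (R : realType) (psi : R * R -> R) (C_psi Cbar_psi : R).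
Hypothesis hpsi : forall u, differentiable psi u.
Hypothesis hC : 0 <= C_psi.
Hypothesis hCbar : 0 <= Cbar_psi.
Hypothesis hgrad :
  forall u, l2norm2 (grad2 psi u) <= C_psi * l2norm2 u + Cbar_psi.
Context (A Delta B0 : R) (K : nat) (delta : nat -> R) (n q : nat) (b0 : 'cV[R]_q).
Hypothesis A_ge0 : 0 <= A.
Hypothesis delta_ge0 : forall k, (k < K)%N -> 0 <= delta k.
Hypothesis sum_delta : \sum_(0 <= k < K) delta k <= Delta.
Hypothesis n_gt0 : (0 < n)%N.
Hypothesis b0B : frob b0 <= B0.
Let s : R := Num.sqrt n%:R.
Let s_gt0 : 0 < s. Proof. by rewrite sqrtr_gt0 ltr0n. Qed.
Let ss : s * s = n%:R. Proof. by rewrite -expr2 sqr_sqrtr// ler0n. Qed.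
Let M := iter_bound A Delta B0.
Let D := gap_bound A Delta B0.
Let L := pred_lip A Delta B0.

Let Delta_ge0 : 0 <= Delta.
Proof. exact: le_trans (sum_delta_ge0 delta_ge0 (leqnn K)) sum_delta. Qed.

Let B0_ge0 : 0 <= B0. Proof. exact: le_trans (frob_ge0 _) b0B. Qed.

Lemma iter_bound_ge0 : 0 <= iter_bound A Delta B0.
Proof.
by rewrite mulr_ge0 ?expR_ge0// addr_ge0// mulr_ge0// sqr_ge0.
Qed.

Definition risk_bound : R := `|psi (0, 0)| +
  (C_psi + Cbar_psi) * (1 + A * (1 + M + D)) * (A * (1 + M + D)).

Definition risk_lip : R :=
  (C_psi + Cbar_psi) * (1 + 2 * (A * (1 + M + D))) * (1 + L).

Lemma loo_riskE (x : 'I_n -> 'cV[R]_q) y k :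
  loo_risk psi x y delta b0 k =
  n%:R^-1 * \sum_i psi (response y i 0, loo_pred x y delta b0 k i 0).
Proof.
rewrite /loo_risk; congr (_ * _); apply: eq_bigr => i _.
by rewrite /loss; congr (psi (_, _)); rewrite [in RHS]mxE.
Qed.

Lemma loo_risk_bound (x : 'I_n -> 'cV[R]_q) y k :
  good A n (design x) (response y) -> (k <= K)%N ->
  `|loo_risk psi x y delta b0 k| <= risk_bound.
Proof.
move=> g kK; rewrite loo_riskE normrM normfV normr_nat.
rewrite ler_pdivrMl ?ltr0n//.
apply: le_trans (ler_norm_sum _ _ _) _.
set u := loo_pred _ _ _ _ _.
have uB : frob u <= A * s * (M + D) by exact: (loo_pred_bound A_ge0 delta_ge0 sum_delta n_gt0 b0B g kK).
apply: (@le_trans _ _ (\sum_(i < n) (`|psi (0, 0)| +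
    `|psi (response y i 0, u i 0) - psi ((0 : 'cV[R]_n) i 0, (0 : 'cV[R]_n) i 0)|))).
  apply: ler_sum => i _; rewrite [(0 : 'cV[R]_n) i 0]mxE.
  by rewrite -[in leLHS](subrK (psi (0,0)) (psi _)) addrC (ler_normD _ _).
rewrite big_split /= sumr_const card_ord -(mulr_natl `|_|) /risk_bound mulrDr lerD2l.
apply: le_trans (sum_psi_lip hpsi hC hCbar hgrad _ _ _ _) _.
rewrite !frob0 !subr0 !addr0 /psi_lip -/s.
have h : frob (response y) + frob u <= s * (A * (1 + M + D)).
  have -> : s * (A * (1 + M + D)) = A * s + A * s * (M + D) by ring.
  by apply: lerD => //; exact: g.2.
rewrite -addrA -ss.
have -> : s * s * ((C_psi + Cbar_psi) * (1 + A * (1 + M + D)) * (A * (1 + M + D)))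
  = (C_psi + Cbar_psi) * (s + s * (A * (1 + M + D))) * (s * (A * (1 + M + D))).
  ring.
have h0 : 0 <= frob (response y) + frob u by rewrite addr_ge0 ?frob_ge0.
apply: ler_pM => //.
  by rewrite mulr_ge0 ?(addr_ge0 hC hCbar)// addr_ge0// ltW.
by rewrite ler_wpM2l ?addr_ge0// lerD2l.
Qed.

(** The average contributes [1 / n], the size factor of [sum_psi_lip] contributes [sqrt n], and the
    predictions vary by O(d). *)
Lemma loo_risk_lip (x x' : 'I_n -> 'cV[R]_q) y y' k d :
  good A n (design x) (response y) -> good A n (design x') (response y') ->
  frob (design x - design x') <= d -> frob (response y - response y') <= d ->
  (k <= K)%N ->
  `|loo_risk psi x y delta b0 k - loo_risk psi x' y' delta b0 k| <=
  risk_lip * (d / s).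
Proof.
move=> g g' dX dY kK; rewrite !loo_riskE -mulrBr -sumrB normrM normfV normr_nat.
rewrite ler_pdivrMl ?ltr0n//.
apply: le_trans (ler_norm_sum _ _ _) _.
apply: le_trans (sum_psi_lip hpsi hC hCbar hgrad _ _ _ _) _.
set u := loo_pred x _ _ _ _; set u' := loo_pred x' _ _ _ _.
have uB : frob u <= A * s * (M + D) by exact: (loo_pred_bound A_ge0 delta_ge0 sum_delta n_gt0 b0B g kK).
have uB' : frob u' <= A * s * (M + D) by exact: (loo_pred_bound A_ge0 delta_ge0 sum_delta n_gt0 b0B g' kK).
have uu : frob (u - u') <= L * d by exact: (loo_pred_lip A_ge0 delta_ge0 sum_delta n_gt0 b0B g g' dX dY kK).
have yB := g.2; have yB' := g'.2.
rewrite /psi_lip -/s.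
have -> : n%:R * (risk_lip * (d / s)) =
  (C_psi + Cbar_psi) * (s + A * s + A * s * (M + D) + A * s + A * s * (M + D)) *
  (d + L * d).
  rewrite -ss /risk_lip; field; exact: lt0r_neq0.
apply: ler_pM; rewrite ?mulr_ge0 ?addr_ge0 ?frob_ge0// ?(ltW s_gt0)//.
  by rewrite ler_wpM2l ?addr_ge0// !lerD.
exact: lerD.
Qed.

End loo_risk.

(** * Measurability and integrals *)

Section matrix_measurability.
Context d (T : measurableType d) dU (U : measurableType dU) (m n : nat).

Lemma measurable_mx_coord (i : 'I_m) (j : 'I_n) :
  measurable_fun setT (fun M : 'M[U]_(m, n) => M i j).
Proof.
move=> _ B mB; rewrite setTI; apply: sub_sigma_algebra.
by exists i, j, B.
Qed.

Lemma measurable_fun_mx (g : T -> 'M[U]_(m, n)) :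
  (forall i j, measurable_fun setT (fun t => g t i j)) -> measurable_fun setT g.
Proof.
move=> mg; have := @measurability _ _ T 'M[U]_(m, n) setT g (@mx_coord_sets _ U m n) erefl.
apply=> _ [_ [i [j [B [mB ->]]]] <-].
exact: mg.
Qed.

End matrix_measurability.

Section integrals.
Context d (T : measurableType d) (R : realType) (P : probability T R).

Lemma integrable_bounded (f : T -> R) (M : R) : measurable_fun setT f ->
  (forall w, `|f w| <= M) -> P.-integrable setT (EFin \o f).
Proof.
move=> mf fM; apply: measurable_bounded_integrable => //.
  by apply: le_lt_trans (probability_le1 P measurableT) _; rewrite ltry.
exists M; split; first exact: num_real.
by move=> r Mr w _; apply: le_trans (fM w) (ltW Mr).
Qed.

Lemma Rintegral_cstT (c : R) : \int[P]_w c = c.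
Proof. by rewrite Rintegral_cst//= probability_setT mulr1. Qed.

Lemma Rintegral_le_cst (f : T -> R) (c : R) : P.-integrable setT (EFin \o f) ->
  (forall w, f w <= c) -> \int[P]_w f w <= c.
Proof.
move=> fi fc; rewrite -[leRHS](Rintegral_cstT c).
apply: le_Rintegral => //; exact: finite_measure_integrable_cst.
Qed.

Lemma EFin_Rintegral (f : T -> R) : P.-integrable setT (EFin \o f) ->
  ((\int[P]_w f w)%R%:E = \int[P]_w (f w)%:E)%E.
Proof. by move=> fi; rewrite fineK//; exact: integrable_fin_num. Qed.

End integrals.

Section integrable_operations.
Context d (T : measurableType d) (R : realType) (P : probability T R).
Implicit Types f g : T -> R.

Lemma integrable_addR f g : P.-integrable setT (EFin \o f) ->
  P.-integrable setT (EFin \o g) -> P.-integrable setT (EFin \o (fun w => f w + g w)).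
Proof. by move=> h1 h2; exact: (integrableD measurableT h1 h2). Qed.

Lemma integrable_scaleR (c : R) f : P.-integrable setT (EFin \o f) ->
  P.-integrable setT (EFin \o (fun w => c * f w)).
Proof. by move=> h; exact: (integrableZl measurableT c h). Qed.

Lemma integrable_cstR (c : R) : P.-integrable setT (EFin \o (fun _ : T => c)).
Proof. exact: finite_measure_integrable_cst. Qed.

Lemma integrable_ler f g : measurable_fun setT f -> P.-integrable setT (EFin \o g) ->
  (forall w, `|f w| <= g w) -> P.-integrable setT (EFin \o f).
Proof.
move=> mf ig fg; apply: (le_integrable measurableT _ _ ig).
  exact: measurableT_comp.
by move=> w _ /=; rewrite lee_fin (le_trans (fg w))// ler_norm.
Qed.

Lemma integrable_of_sqr f : measurable_fun setT f ->
  P.-integrable setT (EFin \o (fun w => f w ^+ 2)) -> P.-integrable setT (EFin \o f).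
Proof.
move=> mf i2; apply: (integrable_ler mf (integrable_addR (integrable_cstR 1) i2)).
move=> w; rewrite -(real_normK (num_real (f w))).
by have := sqr_ge0 (`|f w| - 1); nra.
Qed.

End integrable_operations.

Section measurable_sublevel.
Context d (V : measurableType d) (R : realType) (a b : V -> R).
Hypothesis ma : measurable_fun setT a.
Hypothesis mb : measurable_fun setT b.

Lemma measurable_set_lt : measurable [set v | a v < b v].
Proof.
rewrite -[X in measurable X]setTI -preimage_true.
exact: (measurable_fun_ltr ma mb measurableT).
Qed.

Lemma measurable_set_le : measurable [set v | a v <= b v].
Proof.
rewrite -[X in measurable X]setTI -preimage_true.
exact: (measurable_fun_ler ma mb measurableT).
Qed.

End measurable_sublevel.

(** * Independence, laws and Fubini's theorem *)

Section independence.
Context d (T : measurableType d) (R : realType) (P : probability T R).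
Context dU (U : measurableType dU) dV (V : measurableType dV).
Context (X : T -> U) (Y : T -> V).
Hypothesis mX : measurable_fun setT X.
Hypothesis mY : measurable_fun setT Y.

Lemma independent_of_sym : independent_of P X Y -> independent_of P Y X.
Proof. by move=> XY A B mA mB; rewrite setIC XY// muleC. Qed.

HB.instance Definition _ := isMeasurableFun.Build _ _ _ _ X mX.
HB.instance Definition _ := isMeasurableFun.Build _ _ _ _ Y mY.

Lemma ge0_partial_integral (phi : U * V -> \bar R) u : measurable_fun setT phi ->
  (forall z, 0 <= phi z)%E ->
  (fubini_F (distribution P Y) phi u = \int[P]_w phi (u, Y w))%E.
Proof.
move=> mphi phi0; rewrite /fubini_F ge0_integral_distribution//.
exact: measurableT_comp (pair1_measurable u).
Qed.

(** No integrability is assumed: the integral is the [fine] part of a difference of two Tonelli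
    integrals, each measurable, whatever default value arises where they are infinite. *)
Lemma measurable_partial_integral (phi : U * V -> R) : measurable_fun setT phi ->
  measurable_fun setT (fun u => \int[P]_w phi (u, Y w)).
Proof.
move=> mphi.
have mE : measurable_fun setT (EFin \o phi) by exact: measurableT_comp.
apply: (measurableT_comp (fine_measurable measurableT)).
have -> : (fun u => \int[P]_w (phi (u, Y w))%:E)%E =
  (fun u => fubini_F (distribution P Y) ((EFin \o phi)^\+) u -
            fubini_F (distribution P Y) ((EFin \o phi)^\-) u)%E.
  apply/funext => u; rewrite integralE; congr (_ - _)%E.
    rewrite ge0_partial_integral//; last exact: measurable_funepos.
    by apply: eq_integral => w _; rewrite !funeposE.
  rewrite ge0_partial_integral//; last exact: measurable_funeneg.
  by apply: eq_integral => w _; rewrite !funenegE.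
by apply: emeasurable_funB; apply: measurable_fun_fubini_tonelli_F => //;
  [exact: measurable_funepos|exact: measurable_funeneg].
Qed.

Hypothesis XY : independent_of P X Y.

Let XYpair (w : T) := (X w, Y w).

Let mXY : measurable_fun setT XYpair.
Proof. exact: measurable_fun_pair. Qed.

HB.instance Definition _ := isMeasurableFun.Build _ _ _ _ XYpair mXY.

Lemma independent_law A : measurable A ->
  (distribution P X \x distribution P Y)%E A = distribution P XYpair A.
Proof.
by move=> mA; apply: product_measure_unique => // B C mB mC; exact: XY.
Qed.

Lemma independent_ge0_integral (phi : U * V -> \bar R) : measurable_fun setT phi ->
  (forall z, 0 <= phi z)%E ->
  (\int[P]_w phi (X w, Y w) = \int[P]_w \int[P]_w' phi (X w, Y w'))%E.
Proof.
move=> mphi phi0.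
transitivity (\int[distribution P XYpair]_z phi z)%E.
  by rewrite ge0_integral_distribution.
transitivity (\int[distribution P X \x distribution P Y]_z phi z)%E.
  by apply: eq_measure_integral => A mA _; apply/esym/independent_law.
rewrite fubini_tonelli1// ge0_integral_distribution//=; last 2 first.
- exact: measurable_fun_fubini_tonelli_F.
- by move=> u; exact: integral_ge0.
by apply: eq_integral => w _ /=; rewrite ge0_partial_integral.
Qed.

Lemma independent_integral (phi : U * V -> R) : measurable_fun setT phi ->
  P.-integrable setT (fun w => (phi (X w, Y w))%:E) ->
  (forall u, P.-integrable setT (fun w => (phi (u, Y w))%:E)) ->
  \int[P]_w phi (X w, Y w) = \int[P]_w \int[P]_w' phi (X w, Y w').
Proof.
move=> mphi iphi iphi1.
have mE : measurable_fun setT (EFin \o phi) by exact: measurableT_comp.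
have iE : (distribution P X \x distribution P Y)%E.-integrable setT (EFin \o phi).
  apply/integrableP; split=> //.
  rewrite (_ : integral _ _ _ =
      \int[distribution P XYpair]_z `|(EFin \o phi) z|)%E; last first.
    by apply: eq_measure_integral => A mA _; exact: independent_law.
  rewrite ge0_integral_distribution//; last exact: measurableT_comp.
  by have /integrableP[_] := iphi.
have mF := measurable_fubini_F iE.
rewrite /Rintegral; congr fine.
transitivity (\int[distribution P XYpair]_z (phi z)%:E)%E.
  by rewrite integral_distribution.
transitivity (\int[distribution P X \x distribution P Y]_z (phi z)%:E)%E.
  by apply: eq_measure_integral => A mA _; apply/esym/independent_law.
rewrite -(integral12_prod_meas1 iE) integral_distribution//=; last first.
  have /integrableP[_ iF] := integrable_fubini_F iE.
  apply/integrableP; split; first exact: measurableT_comp.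
  move: iF; rewrite ge0_integral_distribution//.
  exact: measurableT_comp.
apply: eq_integral => w _.
rewrite EFin_Rintegral /fubini_F /=; last exact: iphi1.
rewrite integral_distribution//; last exact: iphi1.
by apply: measurableT_comp => //; exact: measurableT_comp (pair1_measurable _).
Qed.

End independence.

Section row_sigma_algebra.
Context d (U : measurableType d) (m : nat).

Definition row_rectangles : set (set 'rV[U]_m) :=
  [set C | exists B : 'I_m -> set U, (forall j, measurable (B j)) /\
     C = [set M : 'rV[U]_m | forall j, B j (M 0 j)]].

Lemma row_rectangle_measurable C : row_rectangles C -> measurable C.
Proof.
move=> [B [mB ->]].
have -> : [set M : 'rV[U]_m | forall j, B j (M 0 j)] =
    \bigcap_(j in [set: 'I_m]) ((fun M : 'rV[U]_m => M 0 j) @^-1` B j).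
  by apply/seteqP; split=> M /= h j => [_|]; apply: h.
apply: fin_bigcap_measurable => // j _.
rewrite -[X in measurable X]setTI; exact: measurable_mx_coord.
Qed.

(** Unlike the generators that constrain a single entry, rectangles are stable under intersection,
    as Dynkin's theorem requires. *)
Lemma measurable_row_rectangles :
  (measurable : set (set 'rV[U]_m)) = <<s row_rectangles >>.
Proof.
apply/seteqP; split.
  apply: smallest_sub; first exact: smallest_sigma_algebra.
  move=> _ [i [j [B [mB ->]]]]; apply: sub_sigma_algebra.
  exists (fun l => if l == j then B else setT); split.
    by move=> l; case: ifP.
  apply/seteqP; split=> M /= h.
    by move=> l; case: eqP => // ->; rewrite -(ord1 i).
  by have := h j; rewrite eqxx (ord1 i).
apply: smallest_sub; last exact: row_rectangle_measurable.
exact: sigma_algebra_measurable.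
Qed.

Lemma setI_closed_row_rectangles : setI_closed row_rectangles.
Proof.
move=> _ _ [B [mB ->]] [C [mC ->]]; exists (fun j => B j `&` C j); split.
  by move=> j; exact: measurableI.
apply/seteqP; split=> M /=.
  by move=> [hB hC] j.
by move=> h; split=> j; have [] := h j.
Qed.

End row_sigma_algebra.

Section leave_one_out_independence.
Context d (T : measurableType d) (R : realType) (P : probability T R).
Context dU (U : measurableType dU) (n : nat) (X : 'I_n -> T -> U).
Hypothesis mX : forall j, measurable_fun setT (X j).
Hypothesis indX : mutually_independent P X.

Definition rest (i : 'I_n) (w : T) : 'rV[U]_n.-1 := \row_j X (lift i j) w.

Lemma measurable_rest i : measurable_fun setT (rest i).
Proof.
apply: measurable_fun_mx => a j.
rewrite [X in measurable_fun _ X](_ : _ = X (lift i j))//.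
by apply/funext => w; rewrite mxE.
Qed.

Let lift_bigcap i (B : 'I_n -> set U) :
  \bigcap_(j in [set` [set lift i l | l in [set: 'I_n.-1]]%SET]) X j @^-1` B j =
  \bigcap_(l in [set: 'I_n.-1]) X (lift i l) @^-1` B (lift i l).
Proof.
apply/seteqP; split=> w h j /=.
  by move=> _; apply: h => /=; apply/imsetP; exists j; rewrite ?inE.
by move=> /imsetP[l _ ->]; exact: h.
Qed.

Lemma mutually_independent_lift i :
  mutually_independent P (fun j : 'I_n.-1 => X (lift i j)).
Proof.
move=> S B mB.
pose C j := if unlift i j is Some l then B l else setT.
have CE l : C (lift i l) = B l by rewrite /C liftK.
have mC j : measurable (C j) by rewrite /C; case: unliftP.
have := indX [set lift i l | l in S]%SET mC.
rewrite big_imset /=; last by move=> ? ? _ _; exact: lift_inj.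
under eq_bigr do rewrite CE.
move=> <-; congr (P _); apply/seteqP; split=> w h j /=.
  by move=> /imsetP[l lS ->]; rewrite CE; exact: h.
move=> jS; rewrite -CE; apply: h => /=; apply/imsetP; by exists j.
Qed.

(** For fixed [A], the sets [C] that satisfy the product formula form a Dynkin system. It contains
    the rectangles, by mutual independence applied to all indices and to all but [i]. *)
Lemma independent_rest i : independent_of P (X i) (rest i).
Proof.
move=> A C mA mC.
have mXA : measurable (X i @^-1` A) by rewrite -[X in measurable X]setTI; exact: mX.
have mrC (D : set 'rV[U]_n.-1) : measurable D -> measurable (rest i @^-1` D).
  by move=> mD; rewrite -[X in measurable X]setTI; exact: measurable_rest.
have PA : P (X i @^-1` A) \is a fin_num by exact: fin_num_measure.
move: C mC; rewrite measurable_row_rectangles => C.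
pose Q (C : set 'rV[U]_n.-1) :=
  P (X i @^-1` A `&` rest i @^-1` C) = (P (X i @^-1` A) * P (rest i @^-1` C))%E.
apply: (dynkin_induction (P := Q) (measurable_row_rectangles U n.-1)
  (@setI_closed_row_rectangles _ U n.-1)); rewrite /Q.
- by rewrite !preimage_setT setIT probability_setT mule1.
- move=> _ [B [mB ->]].
  pose D j := if unlift i j is Some l then B l else A.
  have DE l : D (lift i l) = B l by rewrite /D liftK.
  have Di : D i = A by rewrite /D unlift_none.
  have mD j : measurable (D j) by rewrite /D; case: unliftP.
  have E1 := indX [set: 'I_n]%SET mD.
  have E2 := indX [set lift i l | l in [set: 'I_n.-1]]%SET mD.
  rewrite lift_bigcap big_imset /= in E2; last by move=> ? ? _ _; exact: lift_inj.
  have -> : rest i @^-1` [set M : 'rV[U]_n.-1 | forall j, B j (M 0 j)] =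
     \bigcap_(l in [set: 'I_n.-1]) X (lift i l) @^-1` D (lift i l).
    apply/seteqP; split=> w h j /=.
      by move=> _; rewrite DE; have := h j; rewrite mxE.
    by rewrite mxE -DE; exact: h.
  rewrite E2.
  have -> : X i @^-1` A `&` \bigcap_(l in [set: 'I_n.-1]) X (lift i l) @^-1` D (lift i l)
     = \bigcap_(j in [set` [set: 'I_n]%SET]) X j @^-1` D j.
    apply/seteqP; split=> w /=.
      move=> [wA h] j _ /=; case: (unliftP i j) => [l ->|->]; last by rewrite Di.
      exact: h.
    move=> h; split; first by rewrite -Di; apply: h => /=; rewrite inE.
    by move=> l _; apply: h => /=; rewrite inE.
  rewrite E1 (bigD1_ord i)//= ?inE// Di; congr (_ * _)%E.
  by apply: eq_bigl => l; rewrite !inE.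
- move=> S mS PS.
  have -> : X i @^-1` A `&` rest i @^-1` (~` S) =
     X i @^-1` A `\` (X i @^-1` A `&` (rest i @^-1` S)).
    by rewrite setDIr setDv set0U.
  rewrite measureD//; [|exact: measurableI (mrC _ mS)|by rewrite ltey_eq PA].
  rewrite setIA setIid.
  transitivity (P (X i @^-1` A) - P (X i @^-1` A) * P (rest i @^-1` S))%E.
    by congr (_ - _)%E; exact: PS.
  transitivity (P (X i @^-1` A) * (1 - P (rest i @^-1` S)))%E; last first.
    by congr (_ * _)%E; exact/esym/probability_setC/mrC.
  by rewrite muleBr// ?mule1//; apply: fin_num_adde_defr.
- move=> F mF tF PF.
  have tpF : trivIset setT (fun k => rest i @^-1` F k).
    apply/trivIsetP => k l _ _ kl; rewrite -preimage_setI.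
    by have /trivIsetP -> := tF; rewrite ?preimage_set0.
  rewrite preimage_bigcup setI_bigcupr.
  rewrite !measure_bigcup//=.
  + rewrite -(fineK PA) -nneseriesZl//; apply: eq_eseriesr => j _.
    by rewrite fineK//; exact: PF.
  + by move=> k _; exact: mrC.
  + by move=> k _; apply: measurableI => //; exact: mrC.
  + exact: trivIset_setIl tpF.
Qed.

End leave_one_out_independence.

Section has_law.
Context d (T : measurableType d) (R : realType) (P : probability T R).
Context dU (U : measurableType dU) (X : T -> U) (mu : probability U R).
Hypothesis mX : measurable_fun setT X.
Hypothesis law : has_law P X mu.

HB.instance Definition _ := isMeasurableFun.Build _ _ _ _ X mX.

Lemma has_law_ge0_integral (f : U -> \bar R) : measurable_fun setT f ->
  (forall u, 0 <= f u)%E -> (\int[P]_w f (X w) = \int[mu]_u f u)%E.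
Proof.
move=> mf f0; rewrite -[LHS](ge0_integral_distribution X)//.
by apply: eq_measure_integral => A mA _; exact: law.
Qed.

Lemma has_law_integral (f : U -> R) : measurable_fun setT f ->
  P.-integrable setT (fun w => (f (X w))%:E) ->
  \int[P]_w f (X w) = \int[mu]_u f u.
Proof.
move=> mf fi; rewrite /Rintegral; congr fine.
have mE : measurable_fun setT (EFin \o f) by exact: measurableT_comp.
rewrite -[LHS](integral_distribution (X := X) mE)//.
by apply: eq_measure_integral => A mA _; exact: law.
Qed.

End has_law.

(** * Exponential tilting and transport-entropy duality *)

Section tilt.
Context (R : realType) (mu : probability R R).
Context (a : R -> R) (M : R).
Hypothesis ma : measurable_fun setT a.
Hypothesis aM : forall x, `|a x| <= M.
Hypothesis int_a : \int[mu]_x expR (a x) = 1.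

Let mexp : measurable_fun setT (fun x => expR (a x)).
Proof. exact: measurableT_comp. Qed.

Let exp_bounded x : `|expR (a x)| <= expR M.
Proof.
by rewrite ger0_norm ?expR_ge0// ler_expR (le_trans (ler_norm _)).
Qed.

Let iexp : mu.-integrable setT (fun x => (expR (a x))%:E).
Proof. exact: (@integrable_bounded _ _ _ mu (fun x => expR (a x)) (expR M)). Qed.

(** The competitor to which the T2 inequality is applied; its log-density [a] is bounded, so its
    divergence from [mu] is explicit. *)
Definition tilt (A : set R) : \bar R := (\int[mu]_(x in A) (expR (a x))%:E)%E.

Let tilt0 : tilt set0 = 0%E. Proof. by rewrite /tilt integral_set0. Qed.

Let tilt_ge0 A : (0 <= tilt A)%E.
Proof. by apply: integral_ge0 => x _; rewrite lee_fin expR_ge0. Qed.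

Let tilt_sigma_additive : semi_sigma_additive tilt.
Proof.
move=> /= A mA tA mUA.
rewrite /tilt/= integral_bigcup//=; last first.
  by apply: (integrableS _ _ (subsetT _)).
apply: is_cvg_ereal_nneg_natsum_cond => n _ _.
by apply: integral_ge0 => /= x ?; rewrite lee_fin expR_ge0.
Qed.

HB.instance Definition _ := isMeasure.Build _ _ _
  tilt tilt0 tilt_ge0 tilt_sigma_additive.

Let tilt_setT : tilt setT = 1%E.
Proof. by rewrite /tilt -EFin_Rintegral// int_a. Qed.

HB.instance Definition _ := @Measure_isProbability.Build _ _ R tilt tilt_setT.

Lemma tilt_dominates : tilt `<< mu.
Proof.
apply/null_content_dominatesP => A mA muA0.
by apply: null_set_integral => //; apply: measurable_funTS; exact: measurableT_comp.
Qed.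

Local Notation RN := (Radon_Nikodym (charge_of_finite_measure tilt) mu).

Lemma tilt_RN : ae_eq mu setT RN (fun x => (expR (a x))%:E).
Proof.
apply: integral_ae_eq => //.
- by apply: Radon_Nikodym_integrable => /=; exact: tilt_dominates.
- exact: measurableT_comp.
- move=> A _ mA; rewrite -Radon_Nikodym_integral//=; exact: tilt_dominates.
Qed.

Lemma tilt_integral (f : R -> R) N : measurable_fun setT f -> (forall x, `|f x| <= N) ->
  \int[tilt]_x f x = \int[mu]_x (f x * expR (a x)).
Proof.
move=> mf fN; rewrite /Rintegral; congr fine.
have itf : tilt.-integrable setT (EFin \o f) by exact: integrable_bounded mf fN.
have := @Radon_Nikodym_change_of_variables _ _ _ tilt mu tilt_dominates (EFin \o f) setT measurableT itf.
move=> /= <-; apply: ae_eq_integral => //.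
- apply: emeasurable_funM; first exact: measurableT_comp.
  by apply: measurable_int; apply: Radon_Nikodym_integrable; exact: tilt_dominates.
- by apply: measurableT_comp => //; exact: measurable_funM.
- under [X in ae_eq _ _ _ X]eq_fun do rewrite EFinM.
  exact: ae_eqe_mul2l tilt_RN.
Qed.

Lemma KL_tilt : KL tilt mu = (\int[tilt]_x a x)%:E.
Proof.
rewrite /KL asboolT; last exact: tilt_dominates.
rewrite EFin_Rintegral; last exact: integrable_bounded ma aM.
have mRN : measurable_fun setT RN.
  by apply: measurable_int; apply: Radon_Nikodym_integrable; exact: tilt_dominates.
apply: ae_eq_integral => //.
- apply: measurableT_comp => //; apply: measurableT_comp; first exact: measurable_ln.
  exact: measurableT_comp (fine_measurable measurableT) mRN.
- exact: measurableT_comp.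
(* The density formula holds [mu]-almost everywhere; domination makes the exceptional set
   [tilt]-null. *)
have [N [mN muN sub]] := tilt_RN.
exists N; split => //; first exact: (null_content_dominatesP _ _).1 tilt_dominates _ mN muN.
apply: subset_trans sub; apply: subsetC => x /= h _; rewrite h//=.
by rewrite expRK.
Qed.

(** Gibbs' inequality, from [a * expR a >= expR a - 1], whose right-hand side has integral zero. *)
Lemma KL_tilt_ge0 : 0 <= \int[tilt]_x a x.
Proof.
rewrite (tilt_integral ma aM).
have i1 : mu.-integrable setT (EFin \o (fun x => expR (a x) - 1)).
  apply: (@integrable_bounded _ _ _ _ _ (expR M + 1)).
    exact: measurable_funB.
  by move=> x; apply: le_trans (ler_normB _ _) _; rewrite normr1 lerD2r.
have -> : 0 = \int[mu]_x (expR (a x) - 1).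
  by rewrite RintegralB// ?int_a ?Rintegral_cstT ?subrr//;
    exact: finite_measure_integrable_cst.
apply: le_Rintegral => //.
  apply: (@integrable_bounded _ _ _ _ _ (M * expR M)).
    exact: measurable_funM.
  move=> x; rewrite normrM; apply: ler_pM => //.
move=> x _; have := expR_ge1Dx (- a x); rewrite expRN => h.
have e0 := expR_gt0 (a x).
have : (1 - a x) * expR (a x) <= (expR (a x))^-1 * expR (a x) by rewrite ler_wpM2r// ltW.
rewrite mulVf ?gt_eqF//; lra.
Qed.

(** Integrated against any coupling, the pointwise inequality bounds [k - m] by a multiple of the
    transport cost, where [k] is the mean of [a] under the tilt and [m] that of [h] under [mu].
    Since [k] is also the divergence, T2 gives [k - m <= k]. Writing [sigma + 1] keeps the inverse
    meaningful when [sigma = 0]; the slack is absorbed because [k] is nonnegative. *)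
Lemma tilt_T2 (sigma : R) (h : R -> R) N : T2_inequality mu sigma ->
  measurable_fun setT h -> (forall x, `|h x| <= N) ->
  (forall u v, a u <= h v + (2 * (sigma + 1) ^+ 2)^-1 * (u - v) ^+ 2) ->
  0 <= \int[mu]_x h x.
Proof.
move=> [s0 T2] mh hN ah.
have KLfin : (KL tilt mu < +oo)%E by rewrite KL_tilt ltry.
have := T2 _ KLfin; rewrite KL_tilt; set k := \int[tilt]_x a x.
have k0 : 0 <= k := KL_tilt_ge0.
rewrite -EFinM lee_sqrt ?lee_fin ?mulr_ge0 ?sqr_ge0//.
set c : R := 2 * (sigma + 1) ^+ 2.
have c0 : 0 < c by rewrite mulr_gt0// exprn_gt0// ltr_wpDl.
set m := \int[mu]_x h x => W.
suff : ((c * (k - m))%:E <= (2 * sigma ^+ 2 * k)%:E)%E.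
  rewrite lee_fin /c => le; rewrite -subr_ge0 in le.
  have : (sigma ^+ 2) * k <= (sigma + 1) ^+ 2 * k.
    by rewrite ler_wpM2r// ler_sqr ?nnegrE ?addr_ge0// lerDl.
  move=> le2; have : 0 <= (sigma + 1) ^+ 2 * m by lra.
  by rewrite pmulr_rge0// exprn_gt0// ltr_wpDl.
apply: le_trans W; apply/ereal_infP => _ [pi cpl <-].
have l1 : has_law pi fst mu by move=> A mA; exact: (cpl A mA).1.
have l2 : has_law pi snd tilt by move=> A mA; exact: (cpl A mA).2.
have iF : pi.-integrable setT (EFin \o (fun u => a u.2)).
  by apply: (@integrable_bounded _ _ _ pi _ M) => //; exact: measurableT_comp.
have iG : pi.-integrable setT (EFin \o (fun u => h u.1)).
  by apply: (@integrable_bounded _ _ _ pi _ N) => //; exact: measurableT_comp.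
have iFG : pi.-integrable setT (EFin \o (fun u => c * (a u.2 - h u.1))).
  apply: (@integrable_bounded _ _ _ pi _ (c * (M + N))).
    apply: measurable_funM => //; apply: measurable_funB; exact: measurableT_comp.
  move=> u; rewrite normrM gtr0_norm// ler_pM2l//.
  by apply: le_trans (ler_normB _ _) _; exact: lerD.
have E : c * (k - m) = \int[pi]_u (c * (a u.2 - h u.1)).
  rewrite RintegralZl//; last exact: integrableB iF iG.
  rewrite RintegralB// (has_law_integral _ l2)// (has_law_integral _ l1)//.
rewrite E EFin_Rintegral//.
have msq : measurable_fun setT (fun u : R * R => ((u.1 - u.2) ^+ 2)%:E).
  by apply: measurableT_comp => //; apply: measurable_funX; exact: measurable_funB.
have [->|fin] := eqVneq (\int[pi]_u ((u.1 - u.2) ^+ 2)%:E)%E +oo%E; first by rewrite leey.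
apply: le_integral => //.
  apply/integrableP; split=> //; rewrite lt_neqAle leey andbT.
  by under eq_integral do rewrite gee0_abs ?lee_fin ?sqr_ge0//.
move=> [u v] _ /=; rewrite lee_fin; have := ah v u.
rewrite -lerBlDl ler_pdivlMl// => /le_trans; apply; rewrite -sqrrN opprB//.
Qed.

End tilt.

(** * The dual transport inequality: tensorization and concentration *)

Section transport_bound.
Context d (T : measurableType d) (R : realType) (P : probability T R).

(* Dual form of a transport inequality with cost [c] for the law of [X]
   (Maurey's property tau); unlike the inequality between couplings it
   tensorizes by Fubini alone. *)
Definition transport_bound dU (U : measurableType dU) (X : T -> U)
    (c : U -> U -> R) : Prop :=
  forall (g h : U -> R) (M : R), measurable_fun setT g -> measurable_fun setT h ->
    (forall u, `|g u| <= M) -> (forall u, `|h u| <= M) ->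
    (forall u v, g u <= h v + c u v) ->
  \int[P]_w expR (g (X w)) <= expR (\int[P]_w h (X w)).

(** [tilt_T2] is applied to [g - ln Z], with [Z] the normalizing integral. Subtracting the same
    constant from [h] preserves the hypothesis, and the conclusion reads: [ln Z] is at most the mean
    of [h]. *)
Lemma transport_bound_T2 (X : T -> R) (mu : probability R R) sigma :
  measurable_fun setT X -> has_law P X mu -> T2_inequality mu sigma ->
  transport_bound X (fun u v => (2 * (sigma + 1) ^+ 2)^-1 * (u - v) ^+ 2).
Proof.
move=> mX law T2 g h M mg mh gM hM gh.
have meg : measurable_fun setT (fun u => expR (g u)) by exact: measurableT_comp.
have egM u : `|expR (g u)| <= expR M.
  by rewrite ger0_norm ?expR_ge0// ler_expR (le_trans (ler_norm _)).
rewrite (has_law_integral mX law meg); last first.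
  apply: (@integrable_bounded _ _ _ P (fun w => expR (g (X w))) (expR M)) => //.
  exact: measurableT_comp meg mX.
rewrite (has_law_integral mX law mh); last first.
  apply: (@integrable_bounded _ _ _ P (fun w => h (X w)) M) => //.
  exact: measurableT_comp mh mX.
set Z := \int[mu]_u expR (g u).
have ieg : mu.-integrable setT (EFin \o (fun u => expR (g u))).
  exact: integrable_bounded meg egM.
have Z0 : 0 < Z.
  apply: (@lt_le_trans _ _ (expR (- M))); first exact: expR_gt0.
  rewrite -[leLHS](Rintegral_cstT mu); apply: le_Rintegral => //.
    exact: finite_measure_integrable_cst.
  by move=> u _; rewrite ler_expR; have := gM u; rewrite ler_norml => /andP[].
have aM u : `|g u - ln Z| <= M + `|ln Z|.
  by apply: le_trans (ler_normB _ _) _; rewrite lerD2r.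
have ma : measurable_fun setT (fun u => g u - ln Z) by exact: measurable_funB.
have int_a : \int[mu]_u expR (g u - ln Z) = 1.
  under eq_Rintegral => u _ do rewrite expRD expRN lnK ?posrE// mulrC.
  by rewrite RintegralZl// mulVf ?gt_eqF.
have hN u : `|h u - ln Z| <= M + `|ln Z|.
  by apply: le_trans (ler_normB _ _) _; rewrite lerD2r.
have mhN : measurable_fun setT (fun u => h u - ln Z) by exact: measurable_funB.
have := tilt_T2 ma aM int_a T2 mhN hN.
have ih : mu.-integrable setT (EFin \o h) by exact: integrable_bounded mh hM.
rewrite RintegralB//; last exact: finite_measure_integrable_cst.
rewrite Rintegral_cstT subr_ge0 => le.
rewrite -[leLHS]lnK ?posrE// ler_expR; apply: le => u v.
by rewrite addrAC lerD2r.
Qed.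

End transport_bound.

Section transport_operations.
Context d (T : measurableType d) (R : realType) (P : probability T R).

Let integrable_exp dU (U : measurableType dU) (X : T -> U) (g : U -> R) M :
  measurable_fun setT X -> measurable_fun setT g -> (forall u, `|g u| <= M) ->
  P.-integrable setT (fun w => (expR (g (X w)))%:E).
Proof.
move=> mX mg gM.
apply: (@integrable_bounded _ _ _ P (fun w => expR (g (X w))) (expR M)).
  by apply: measurableT_comp => //; exact: measurableT_comp.
by move=> w; rewrite ger0_norm ?expR_ge0// ler_expR (le_trans (ler_norm _)).
Qed.

Let integrable_bd dU (U : measurableType dU) (X : T -> U) (g : U -> R) M :
  measurable_fun setT X -> measurable_fun setT g -> (forall u, `|g u| <= M) ->
  P.-integrable setT (fun w => (g (X w))%:E).
Proof.
move=> mX mg gM; apply: (@integrable_bounded _ _ _ P (fun w => g (X w)) M) => //.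
exact: measurableT_comp mg mX.
Qed.

Lemma transport_bound_map dU (U : measurableType dU) dV (V : measurableType dV)
    (X : T -> U) (phi : U -> V) (c : U -> U -> R) (c' : V -> V -> R) :
  measurable_fun setT phi -> (forall u v, c' (phi u) (phi v) <= c u v) ->
  transport_bound P X c -> transport_bound P (phi \o X) c'.
Proof.
move=> mphi cc tX g h M mg mh gM hM gh.
apply: (tX (g \o phi) (h \o phi) M) => //.
- exact: measurableT_comp.
- exact: measurableT_comp.
- by move=> u /=; exact: gM.
- by move=> u /=; exact: hM.
- move=> u v /=; apply: le_trans (gh _ _) _; apply: lerD => //; exact: cc.
Qed.

Lemma transport_bound_le dU (U : measurableType dU) (X : T -> U) (c c' : U -> U -> R) :
  (forall u v, c' u v <= c u v) -> transport_bound P X c -> transport_bound P X c'.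
Proof. by move=> cc; apply: (@transport_bound_map _ _ _ _ X id). Qed.

Section pair.
Context dU (U : measurableType dU) dV (V : measurableType dV).
Context (X : T -> U) (Y : T -> V) (c : U -> U -> R) (c' : V -> V -> R).
Hypothesis mX : measurable_fun setT X.
Hypothesis mY : measurable_fun setT Y.
Hypothesis XY : independent_of P X Y.

(** Integrating over [Y] alone produces the functions [ln (E u)] and [H u]. The bound for [Y], with
    both first coordinates frozen, says that they satisfy the hypothesis for [X] with cost [c]. *)
Lemma transport_bound_pair : transport_bound P X c -> transport_bound P Y c' ->
  transport_bound P (fun w => (X w, Y w)) (fun u v => c u.1 v.1 + c' u.2 v.2).
Proof.
move=> tX tY g h M mg mh gM hM gh.
have mXY : measurable_fun setT (fun w => (X w, Y w)) by exact: measurable_fun_pair.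
have mgu u : measurable_fun setT (fun v => g (u, v)).
  exact: measurableT_comp mg (pair1_measurable u).
have mhu u : measurable_fun setT (fun v => h (u, v)).
  exact: measurableT_comp mh (pair1_measurable u).
have meg : measurable_fun setT (fun z => expR (g z)) by exact: measurableT_comp.
pose E u := \int[P]_w expR (g (u, Y w)).
pose H u := \int[P]_w h (u, Y w).
have mE : measurable_fun setT E := measurable_partial_integral P mY meg.
have mH : measurable_fun setT H := measurable_partial_integral P mY mh.
have ieg u : P.-integrable setT (fun w => (expR (g (u, Y w)))%:E).
  exact: (integrable_exp mY (mgu u) (fun v => gM (u, v))).
have ih u : P.-integrable setT (fun w => (h (u, Y w))%:E).
  exact: (integrable_bd mY (mhu u) (fun v => hM (u, v))).
have gl z : - M <= g z by have := gM z; rewrite ler_norml => /andP[].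
have gr z : g z <= M by have := gM z; rewrite ler_norml => /andP[].
have hl z : - M <= h z by have := hM z; rewrite ler_norml => /andP[].
have hr z : h z <= M by have := hM z; rewrite ler_norml => /andP[].
have El u : expR (- M) <= E u.
  rewrite -[leLHS](Rintegral_cstT P); apply: le_Rintegral => //.
  - exact: finite_measure_integrable_cst.
  - exact: ieg.
  - by move=> w _; rewrite ler_expR.
have Er u : E u <= expR M.
  by apply: (Rintegral_le_cst (ieg u)) => w; rewrite ler_expR.
have E0 u : 0 < E u by apply: lt_le_trans (El u); exact: expR_gt0.
have HM u : `|H u| <= M.
  rewrite ler_norml; apply/andP; split.
    rewrite -[leLHS](Rintegral_cstT P); apply: le_Rintegral => //.
    exact: finite_measure_integrable_cst.
    exact: ih.
  by apply: (Rintegral_le_cst (ih u)) => w.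
have GM u : `|ln (E u)| <= M.
  rewrite ler_norml -ler_expR -[X in _ && X]ler_expR lnK ?posrE//.
  by rewrite El Er.
have mG : measurable_fun setT (fun u => ln (E u)).
  exact: measurableT_comp (@measurable_ln R) mE.
(* For [Y], the number [c u v] is a constant, carried by the second function. *)
have step u v : ln (E u) <= H v + c u v.
  rewrite -ler_expR lnK ?posrE//.
  have -> : H v + c u v = \int[P]_w (h (v, Y w) + c u v).
    by rewrite RintegralD ?Rintegral_cstT//;
      [exact: ih|exact: finite_measure_integrable_cst].
  apply: (tY (fun y => g (u, y)) (fun y => h (v, y) + c u v) (M + `|c u v|)) => //.
  - exact: measurable_funD.
  - by move=> y; rewrite (le_trans (gM _))// lerDl.
  - by move=> y; rewrite (le_trans (ler_normD _ _))// lerD2r.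
  - by move=> y y'; rewrite -addrA; exact: gh (u, y) (v, y').
rewrite (independent_integral mX mY XY meg) => //; last first.
  exact: (integrable_exp mXY mg gM).
rewrite (independent_integral mX mY XY mh) => //; last first.
  exact: (integrable_bd mXY mh hM).
under eq_Rintegral => w _ do rewrite -/(E (X w)) -[E (X w)]lnK ?posrE//.
exact: (tX (fun u => ln (E u)) H M).
Qed.

End pair.

Lemma transport_bound_row dU (U : measurableType dU) (c : U -> U -> R) n
    (X : 'I_n -> T -> U) :
  (forall j, measurable_fun setT (X j)) -> mutually_independent P X ->
  (forall j, transport_bound P (X j) c) ->
  transport_bound P (fun w => \row_j X j w) (fun u v => \sum_j c (u 0 j) (v 0 j)).
Proof.
elim: n X => [|n IH] X mX iX tX.
  move=> g h M mg mh gM hM gh.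
  (* The only row of length zero; its entries come from an absurd index. *)
  pose r0 : 'rV[U]_0 :=
    \row_(j < 0) False_rect U (Bool.diff_false_true (ltn_ord j)).
  have E w : \row_j X j w = r0 by apply/rowP => -[].
  under eq_Rintegral => w _ do rewrite E.
  rewrite Rintegral_cstT ler_expR; apply: le_trans (gh r0 r0) _.
  under [in leRHS]eq_Rintegral => w _ do rewrite E.
  by rewrite big_ord0 addr0 Rintegral_cstT.
pose phi (z : U * 'rV[U]_n) : 'rV[U]_n.+1 :=
  \row_j (if unlift ord0 j is Some l then z.2 0 l else z.1).
have -> : (fun w => \row_j X j w) = phi \o (fun w => (X ord0 w, rest X ord0 w)).
  apply/funext => w; apply/rowP => j; rewrite !mxE /=.
  by case: unliftP => [l ->|->]; rewrite ?mxE.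
apply: transport_bound_map (transport_bound_pair _ _ (independent_rest mX iX ord0)
    (tX ord0) (IH (fun j => X (lift ord0 j)) _ _ _)) => //.
- apply: measurable_fun_mx => a j.
  under eq_fun do rewrite mxE.
  case: unliftP => [l _|_]; last exact: measurable_fst.
  exact: (measurableT_comp (@measurable_mx_coord _ U 1 n 0 l) measurable_snd).
- move=> u v; rewrite big_ord_recl !mxE unlift_none lerD2l.
  by apply: ler_sum => j _; rewrite !mxE liftK.
- exact: measurable_rest.
- exact: (mutually_independent_lift iX ord0).
Qed.

Section concentration.
Context dU (U : measurableType dU) (X : T -> U) (c : U -> U -> R).
Hypothesis mX : measurable_fun setT X.
Hypothesis tX : transport_bound P X c.
Hypothesis c_ge0 : forall u v, 0 <= c u v.

Lemma transport_concentration (G : set U) (F : U -> R) (B l : R) : measurable G ->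
  measurable_fun setT F -> 0 <= l -> (forall u, G u -> `|F u| <= B) -> 0 <= B ->
  (forall u v, G u -> G v -> F u <= F v + c u v + l) ->
  \int[P]_w (expR (F (X w)) * \1_G (X w)) <=
  expR (\int[P]_w (F (X w) * \1_G (X w) + B * \1_(~` G) (X w) + l)).
Proof.
move=> mG mF l0 FB B0 FL.
have m1 : measurable_fun setT (\1_G : U -> R) by exact: measurable_indic.
have m2 : measurable_fun setT (\1_(~` G) : U -> R).
  by apply: measurable_indic; exact: measurableC.
pose g u := F u * \1_G u - B * \1_(~` G) u.
pose h u := F u * \1_G u + B * \1_(~` G) u + l.
have gin u : G u -> g u = F u.
  by move=> Gu; rewrite /g !indicE mem_set// memNset/=; [rewrite mulr1 mulr0 subr0|exact].
have gout u : ~ G u -> g u = - B.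
  by move=> Gu; rewrite /g !indicE memNset// mem_set//= mulr0 mulr1 sub0r.
have hin u : G u -> h u = F u + l.
  by move=> Gu; rewrite /h !indicE mem_set// memNset/=; [rewrite mulr1 mulr0 addr0|exact].
have hout u : ~ G u -> h u = B + l.
  by move=> Gu; rewrite /h !indicE memNset// mem_set//= mulr0 mulr1 add0r.
have mg : measurable_fun setT g.
  by apply: measurable_funB; apply: measurable_funM.
have mh : measurable_fun setT h.
  by apply: measurable_funD => //; apply: measurable_funD; apply: measurable_funM.
have gB u : `|g u| <= B + l.
  have [Gu|Gu] := pselect (G u); first by rewrite gin// (le_trans (FB _ Gu))// lerDl.
  by rewrite gout// normrN ger0_norm// lerDl.
have hB u : `|h u| <= B + l.
  have [Gu|Gu] := pselect (G u); last by rewrite hout// ger0_norm// addr_ge0.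
  by rewrite hin// (le_trans (ler_normD _ _))// (ger0_norm l0) lerD2r FB.
apply: le_trans (tX mg mh gB hB _); last first.
  move=> u v; have [Gv|Gv] := pselect (G v); have [Gu|Gu] := pselect (G u).
  - by rewrite gin// hin// addrAC; exact: FL.
  - rewrite gout// hin//; have := FB _ Gv; rewrite ler_norml => /andP[FvB _].
    have := c_ge0 u v; lra.
  - rewrite gin// hout//; have := FB _ Gu; rewrite ler_norml => /andP[_ FuB].
    have := c_ge0 u v; lra.
  - rewrite gout// hout//; have := c_ge0 u v; lra.
apply: le_Rintegral => //.
- apply: (@le_integrable _ _ _ _ _ measurableT _ (fun w => (expR (g (X w)))%:E)).
  + apply: measurableT_comp => //; apply: measurable_funM.
      by apply: measurableT_comp => //; exact: measurableT_comp.
    exact: measurableT_comp.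
  + move=> w _; rewrite lee_fin !ger0_norm ?mulr_ge0 ?expR_ge0//.
    have [Gu|Gu] := pselect (G (X w)).
      by rewrite gin// indicE mem_set// mulr1.
    by rewrite indicE memNset// mulr0 expR_ge0.
  + exact: integrable_exp mX mg gB.
- exact: integrable_exp mX mg gB.
- move=> w _; have [Gu|Gu] := pselect (G (X w)).
    by rewrite gin// indicE mem_set// mulr1.
  by rewrite indicE memNset// mulr0 expR_ge0.
Qed.

Definition clamp (m x : R) : R := Num.max (- m) (Num.min m x).

Lemma clamp_bound m x : 0 <= m -> `|clamp m x| <= m.
Proof.
rewrite /clamp => m0.
by case: (lerP m x) => ?; case: (lerP (- m) _) => ?; rewrite ler_norml; lra.
Qed.

Lemma clamp_abs m x : 0 <= m -> `|clamp m x| <= `|x|.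
Proof.
move=> m0; have := ler_norm x; have := ler_norm (- x); rewrite normrN /clamp.
by case: (lerP m x) => ?; case: (lerP (- m) _) => ? ? ?; rewrite ler_norml; lra.
Qed.

Lemma clamp_id m x : `|x| <= m -> clamp m x = x.
Proof.
rewrite ler_norml /clamp => /andP[? ?].
by case: (lerP m x) => ?; case: (lerP (- m) _) => ?; lra.
Qed.

(** Truncation is monotone and 1-Lipschitz, so it preserves one-sided Lipschitz inequalities. *)
Lemma clamp_le m x y a : 0 <= m -> 0 <= a -> x <= y + a -> clamp m x <= clamp m y + a.
Proof.
rewrite /clamp => ? ? ?; case: (lerP m x) => ?; case: (lerP m y) => ?.
- by case: (lerP (- m) m) => ?; lra.
- by case: (lerP (- m) m) => ?; case: (lerP (- m) y) => ?; lra.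
- by case: (lerP (- m) m) => ?; case: (lerP (- m) x) => ?; lra.
- by case: (lerP (- m) y) => ?; case: (lerP (- m) x) => ?; lra.
Qed.

Lemma measurable_clamp m : measurable_fun setT (clamp m).
Proof.
apply: measurable_maxr => //; exact: measurable_minr.
Qed.

(** Truncation at level [n] reduces to bounded functions; Fatou's lemma handles the exponential and
    dominated convergence the mean. *)
Lemma transport_subgaussian (F : U -> R) (l : R) :
  measurable_fun setT F -> 0 <= l -> P.-integrable setT (fun w => (F (X w))%:E) ->
  (forall u v, F u <= F v + c u v + l) ->
  (\int[P]_w (expR (F (X w)))%:E <= (expR (\int[P]_w F (X w) + l))%:E)%E.
Proof.
move=> mF l0 iF FL.
have mFX : measurable_fun setT (fun w => F (X w)) by exact: measurableT_comp.
pose Fn (n : nat) u := clamp n%:R (F u).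
have mFn n : measurable_fun setT (Fn n) by exact: measurableT_comp (measurable_clamp _) mF.
have mFnX n : measurable_fun setT (fun w => Fn n (X w)) by exact: measurableT_comp.
have FnB n u : `|Fn n u| <= n%:R by exact: clamp_bound.
have iFn n : P.-integrable setT (fun w => (Fn n (X w))%:E).
  exact: integrable_bd mX (mFn n) (FnB n).
have le n : \int[P]_w expR (Fn n (X w)) <= expR (\int[P]_w Fn n (X w) + l).
  have -> : \int[P]_w Fn n (X w) + l = \int[P]_w (Fn n (X w) + l).
    by rewrite RintegralD ?Rintegral_cstT//;
      [exact: iFn|exact: finite_measure_integrable_cst].
  apply: (tX (g := Fn n) (h := fun u => Fn n u + l) (M := n%:R + l)) => //.
  - exact: measurable_funD.
  - by move=> u; rewrite (le_trans (FnB n u))// lerDl.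
  - by move=> u; rewrite (le_trans (ler_normD _ _))// (ger0_norm l0) lerD2r.
  - move=> u v; rewrite addrAC -addrA; apply: clamp_le => //.
      by rewrite addr_ge0.
    by rewrite addrA addrAC (addrAC _ l); exact: FL.
have cvgF w : (Fn n (X w))%:E @[n --> \oo] --> (F (X w))%:E.
  apply: cvg_near_cst; near=> n; congr EFin; apply: clamp_id.
  near: n; exact: nbhs_infty_ger.
have cvgE w : (expR (Fn n (X w)))%:E @[n --> \oo] --> (expR (F (X w)))%:E.
  apply: cvg_near_cst; near=> n; congr (expR _)%:E; apply: clamp_id.
  near: n; exact: nbhs_infty_ger.
have cvgI : (\int[P]_w (Fn n (X w))%:E)%E @[n --> \oo] --> (\int[P]_w (F (X w))%:E)%E.
  apply: (@dominated_cvg _ _ _ P setT measurableT (fun n w => (Fn n (X w))%:E)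
    (fun w => (F (X w))%:E) (fun w => `|F (X w)|%:E)) => //.
  - by move=> n; exact: measurableT_comp.
  - exact: integrable_abse iF.
  - by move=> n w _; rewrite lee_fin; exact: clamp_abs.
have cvgR : (\int[P]_w Fn n (X w))%R @[n --> \oo] --> (\int[P]_w F (X w))%R.
  by apply: fine_cvg; rewrite fineK//; exact: integrable_fin_num.
have cvgB : (expR (\int[P]_w Fn n (X w) + l))%:E @[n --> \oo] -->
    (expR (\int[P]_w F (X w) + l))%:E.
  apply/fine_cvgP; split; first by near=> n.
  have cR : expR (\int[P]_w Fn n (X w) + l) @[n --> \oo] --> expR (\int[P]_w F (X w) + l).
    apply: continuous_cvg; first exact: continuous_expR.
    by apply: cvgD => //; exact: cvg_cst.
  exact: cR.
apply: (@le_trans _ _ (\int[P]_w limn_einf (fun n => (expR (Fn n (X w)))%:E))%E).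
  apply: le_of_eq; apply: eq_integral => w _.
  by rewrite (cvg_limn_einf_sup (cvgE w)).1.
apply: le_trans.
  apply: fatou => //.
  by move=> n; apply: measurableT_comp => //; exact: measurableT_comp.
rewrite limn_einf_lim -(cvg_lim _ cvgB)//; apply: lee_lim.
- exact: is_cvg_einfs.
- by apply/cvg_ex; eexists; exact: cvgB.
- near=> n; apply: (@le_trans _ _ (\int[P]_w (expR (Fn n (X w)))%:E)%E).
    by apply: ereal_inf_lbound; exists n => /=.
  by rewrite -EFin_Rintegral ?lee_fin//; exact: integrable_exp mX (mFn n) (FnB n).
Unshelve. all: by end_near. Qed.

End concentration.

End transport_operations.

(** * Measurability of continuous functions for the product sigma-algebra *)

Section continuous_measurability.
Context (R : realType).

(** The sigma-algebra is generated by the entries, so openness has to be reduced to countably many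
    boxes: those with rational centre and radius [1 / (k + 1)] that lie in [O]. *)
Lemma measurable_open_cV q (O : set 'cV[R]_q) :
  (forall u, O u -> exists2 e : R, 0 < e &
     forall v : 'cV[R]_q, (forall i, `|v i 0 - u i 0| < e) -> O v) ->
  measurable O.
Proof.
move=> Oo.
pose box (z : 'cV[rat]_q * nat) :=
  [set v : 'cV[R]_q | forall i, `|v i 0 - ratr (z.1 i 0)| < z.2.+1%:R^-1].
pose F z := if `[< box z `<=` O >] then box z else set0.
have -> : O = \bigcup_z F z.
  apply/seteqP; split => [u Ou|u [z _]]; last first.
    by rewrite /F; case: asboolP => // sub; exact: sub.
  have [e e0 eO] := Oo u Ou.
  (* The radius [1 / (k + 1)] is below [e / 2], so a box whose rational centre is that close to [u]
     stays within [e] of [u]. *)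
  pose k := Num.truncn (2 / e).
  have k0 : 0 < k.+1%:R^-1 :> R by rewrite invr_gt0 ltr0n.
  have ke : 2 * k.+1%:R^-1 < e.
    by rewrite ltr_pdivrMr ?ltr0n// mulrC -ltr_pdivrMr// real_truncnS_gt// num_real.
  set c : R := k.+1%:R^-1 in k0 ke.
  have /choice[r hr] (i : 'I_q) : exists x : rat, `|u i 0 - ratr x| < c.
    have hlt : u i 0 - c < u i 0 + c by lra.
    have [x] := rat_in_itvoo hlt.
    rewrite in_itv /= => /andP[h1 h2]; exists x; rewrite ltr_norml; lra.
  exists (\col_i r i, k) => //; rewrite /F asboolT.
    by move=> i /=; rewrite mxE.
  move=> v /= hv; apply: eO => i; have := hv i; rewrite mxE -/c => hvi.
  have := hr i; move: hvi; rewrite !ltr_norml => /andP[? ?] /andP[? ?]; lra.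
apply: countable_bigcupT_measurable; first exact: countableP.
move=> z; rewrite /F; case: ifP => // _.
have -> : box z = \bigcap_(i in [set: 'I_q])
    ((fun v : 'cV[R]_q => `|v i 0 - ratr (z.1 i 0)|) @^-1` [set x | x < z.2.+1%:R^-1]).
  by apply/seteqP; split => v /= h i => [_|]; exact: h.
apply: fin_bigcap_measurable => // i _.
rewrite -[X in measurable X]setTI.
have mf : measurable_fun setT (fun v : 'cV[R]_q => `|v i 0 - ratr (z.1 i 0)|).
  apply: measurableT_comp => //; apply: measurable_funB => //.
  exact: measurable_mx_coord.
have -> : [set x : R | x < z.2.+1%:R^-1] = `]-oo, z.2.+1%:R^-1[%classic.
  by apply/seteqP; split => x /=; rewrite in_itv.
exact: mf.
Qed.

Lemma measurable_fun_cV q (f : 'cV[R]_q -> R) :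
  (forall (u : 'cV[R]_q) (e : R), 0 < e -> exists2 a : R, 0 < a &
     forall v : 'cV[R]_q, (forall i, `|v i 0 - u i 0| < a) -> `|f v - f u| < e) ->
  measurable_fun setT f.
Proof.
move=> fc; apply: (measurability _ (RGenOInfty.measurableE R)) => _ [_ [x ->] <-].
rewrite setTI; apply: measurable_open_cV => u /=; rewrite in_itv /= andbT => xu.
have [a a0 h] := fc u (f u - x) ltac:(by rewrite subr_gt0).
exists a => // v /h; rewrite in_itv /= andbT ltr_norml => /andP[]; lra.
Qed.

Lemma frob_lt_coord q (v : 'cV[R]_q) (e : R) : 0 < e ->
  (forall i, `|v i 0| < e) -> frob v <= Num.sqrt q%:R * e.
Proof.
move=> e0 h; rewrite -l2normE; apply: ler_sqrt_sum.
  by rewrite mulr_ge0 ?sqrtr_ge0// ltW.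
rewrite exprMn sqr_sqrtr ?ler0n//.
rewrite -[q in q%:R]card_ord mulr_natl -sumr_const; apply: ler_sum => i _.
by rewrite -real_normK ?num_real// ler_sqr ?nnegrE// ?ltW.
Qed.

Lemma measurable_lipschitz q (f : 'cV[R]_q -> R) :
  (forall u v, `|f u - f v| <= frob (u - v)) -> measurable_fun setT f.
Proof.
move=> fL; apply: measurable_fun_cV => u e e0.
have s0 : 0 <= Num.sqrt q%:R :> R by exact: sqrtr_ge0.
have s1 : 0 < Num.sqrt q%:R + 1 :> R by rewrite ltr_wpDl.
exists (e / (Num.sqrt q%:R + 1)); first by rewrite divr_gt0.
move=> v h; apply: le_lt_trans (fL _ _) _.
apply: (@le_lt_trans _ _ (Num.sqrt q%:R * (e / (Num.sqrt q%:R + 1)))).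
  by apply: frob_lt_coord => [|i]; [rewrite divr_gt0|rewrite !mxE; exact: h].
rewrite mulrA ltr_pdivrMr// mulrC ltr_pM2l//; lra.
Qed.

Lemma measurable_frob m n : measurable_fun setT (@frob R m n).
Proof.
have -> : @frob R m n = Num.sqrt \o (fun A => \sum_(ij : 'I_m * 'I_n) A ij.1 ij.2 ^+ 2) by [].
apply: measurableT_comp.
  apply: continuous_measurable_fun; exact: sqrt_continuous.
apply: measurable_sum => ij; apply: measurable_funX; exact: measurable_mx_coord.
Qed.

Lemma measurable_frob_comp d (T : measurableType d) m n (g : T -> 'M[R]_(m, n)) :
  measurable_fun setT g -> measurable_fun setT (fun w => frob (g w)).
Proof. by move=> mg; exact: measurableT_comp (@measurable_frob m n) mg. Qed.

Lemma measurable_mulmx d (T : measurableType d) m n p (g : T -> 'M[R]_(m, n))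
    (h : T -> 'M[R]_(n, p)) :
  measurable_fun setT g -> measurable_fun setT h ->
  measurable_fun setT (fun w => g w *m h w).
Proof.
move=> mg mh; apply: measurable_fun_mx => i j; under eq_fun do rewrite mxE.
apply: measurable_sum => l; apply: measurable_funM.
  exact: measurableT_comp (measurable_mx_coord i l) mg.
exact: measurableT_comp (measurable_mx_coord l j) mh.
Qed.

Lemma measurable_continuous2 (psi : R * R -> R) : continuous psi ->
  measurable_fun setT psi.
Proof.
move=> psic.
(* Pairs are read as vectors of length two, so that the argument by rational boxes applies. *)
pose f (u : 'cV[R]_2) := psi (u 0 0, u 1 0).
pose phi (z : R * R) : 'cV[R]_2 := \col_(i < 2) (if i == 0 then z.1 else z.2).
have mphi : measurable_fun setT phi.
  apply: measurable_fun_mx => i j; under eq_fun do rewrite mxE.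
  by case: (i == 0); [exact: measurable_fst|exact: measurable_snd].
have -> : psi = f \o phi.
  by apply/funext => -[a b]; rewrite /f /= !mxE.
apply: measurableT_comp mphi.
apply: measurable_fun_cV => u e e0.
have /cvgrPdist_lt/(_ e e0) := psic (u 0 0, u 1 0).
move=> [[A B] /= [/nbhs_ballP[a1 /= a10 hA] /nbhs_ballP[a2 /= a20 hB]] sub].
exists (Num.min a1 a2); first by rewrite lt_min a10.
move=> v hv; rewrite distrC; apply: (sub (v 0 0, v 1 0)); split => /=.
  by apply: hA; rewrite /ball /= distrC; apply: lt_le_trans (hv 0) _; rewrite ge_min lexx.
by apply: hB; rewrite /ball /= distrC; apply: lt_le_trans (hv 1) _; rewrite ge_min lexx orbT.
Qed.

End continuous_measurability.

Section matrix_operations.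
Context (R : realType) d (T : measurableType d).

Lemma measurable_addmx m n (g h : T -> 'M[R]_(m, n)) : measurable_fun setT g ->
  measurable_fun setT h -> measurable_fun setT (fun w => g w + h w).
Proof.
move=> mg mh; apply: measurable_fun_mx => i j; under eq_fun do rewrite mxE.
by apply: measurable_funD; exact: measurableT_comp (measurable_mx_coord i j) _.
Qed.

Lemma measurable_scalemx m n (c : R) (g : T -> 'M[R]_(m, n)) : measurable_fun setT g ->
  measurable_fun setT (fun w => c *: g w).
Proof.
move=> mg; apply: measurable_fun_mx => i j; under eq_fun do rewrite mxE.
by apply: measurable_funM => //; exact: measurableT_comp (measurable_mx_coord i j) _.
Qed.

Lemma measurable_trmx m n (g : T -> 'M[R]_(m, n)) : measurable_fun setT g ->
  measurable_fun setT (fun w => (g w)^T).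
Proof.
move=> mg; apply: measurable_fun_mx => i j; under eq_fun do rewrite mxE.
exact: measurableT_comp (measurable_mx_coord j i) mg.
Qed.

End matrix_operations.

(** * One sample: covariance, transport inequality and moments *)

Section opnorm.
Context (R : realType) (p : nat).

Lemma frob_opnorm (A : 'M[R]_p) (v : 'cV[R]_p) : frob (A *m v) <= opnorm A * frob v.
Proof.
have sA : has_sup [set l2norm (A *m v) | v in [set v : 'cV[R]_p | l2norm v <= 1]].
  split.
    exists (l2norm (A *m 0)), 0 => //=.
    by rewrite l2normE frob0.
  exists (frob A) => _ [w /= w1 <-]; rewrite l2normE.
  apply: le_trans (frob_mul _ _) _; rewrite -l2normE.
  by rewrite ler_piMr ?frob_ge0.
have [v0|v0] := eqVneq (frob v) 0.
  apply: le_trans (frob_mul _ _) _; by rewrite v0 !mulr0.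
have v1 : 0 < frob v by rewrite lt0r v0 frob_ge0.
rewrite -ler_pdivrMr//.
have := sup_upper_bound sA; apply.
exists ((frob v)^-1 *: v) => /=.
  by rewrite l2normE frobZ ger0_norm ?invr_ge0 ?frob_ge0// mulVf.
by rewrite l2normE -scalemxAr frobZ ger0_norm ?invr_ge0 ?frob_ge0// mulrC.
Qed.

(** Since [S] is symmetric with square [A], the squared norm of [S *m v] is the quadratic form of
    [A] at [v]. *)
Lemma frob_psd_sqrt (S A : 'M[R]_p) s (v : 'cV[R]_p) : is_psd_sqrt S A -> opnorm A <= s ->
  frob (S *m v) ^+ 2 <= s * frob v ^+ 2.
Proof.
move=> [[ST _] SS] As.
rewrite frob_sqr_dot trmx_mul ST -mulmxA (mulmxA S S) SS.
apply: le_trans (ler_norm _) _; apply: le_trans (dot_frob _ _) _.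
rewrite expr2 mulrCA ler_wpM2l ?frob_ge0//.
apply: le_trans (frob_opnorm _ _) _.
by rewrite ler_wpM2r ?frob_ge0.
Qed.

End opnorm.

Section integral_sums.
Context d (T : measurableType d) (R : realType) (P : probability T R).

Lemma integrable_sumR (I : Type) (s : seq I) (f : I -> T -> R) :
  (forall i, P.-integrable setT (EFin \o f i)) ->
  P.-integrable setT (EFin \o (fun w => \sum_(i <- s) f i w)) /\
  \int[P]_w (\sum_(i <- s) f i w) = \sum_(i <- s) \int[P]_w f i w.
Proof.
move=> fi; elim: s => [|i s [IH1 IH2]].
  have -> : (fun w => \sum_(i <- [::]) f i w) = cst 0.
    by apply/funext => w; rewrite big_nil.
  split; first exact: finite_measure_integrable_cst.
  by rewrite big_nil Rintegral_cstT.
have E : (fun w => \sum_(j <- i :: s) f j w) =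
    (fun w => f i w + \sum_(j <- s) f j w) by apply/funext => w; rewrite big_cons.
rewrite E big_cons; split; first exact: (integrableD measurableT (fi i) IH1).
by rewrite RintegralD// IH2.
Qed.

Lemma integral0_integrable (mu : probability R R) :
  (\int[mu]_x x%:E = 0)%E -> mu.-integrable setT (EFin : R -> \bar R).
Proof.
move=> E0; apply/integrableP; split.
  by have /measurable_EFinP := @measurable_id _ R setT.
have := @integral_fin_num_abs _ _ _ mu setT idfun measurableT (@measurable_id _ _ _).
by rewrite /= E0 => ->.
Qed.

End integral_sums.

Section sample.
Context (R : realType) (q : nat).

Definition dist2 (u v : 'cV[R]_q * R) : R := frob (u.1 - v.1) ^+ 2 + (u.2 - v.2) ^+ 2.

Lemma dist2_ge0 u v : 0 <= dist2 u v.
Proof. by rewrite addr_ge0 ?sqr_ge0. Qed.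

(** Completing the square. It trades linear growth in a distance for the quadratic transport cost
    plus a constant. *)
Lemma young (k r : R) : 0 < k -> r <= k * r ^+ 2 + (4 * k)^-1.
Proof.
move=> k0; have : 0 <= k * (r - (2 * k)^-1) ^+ 2 by rewrite mulr_ge0 ?sqr_ge0// ltW.
have -> : k * (r - (2 * k)^-1) ^+ 2 = k * r ^+ 2 - r + (4 * k)^-1.
  field; exact: lt0r_neq0.
lra.
Qed.

End sample.

Section sample_law.
Context d (T : measurableType d) (R : realType) (P : probability T R) (p : nat).
Context (mu_z mu_eps : probability R R) (Sigma S : 'M[R]_p) (f : 'cV[R]_(p + 1) -> R).
Context (z : T -> 'cV[R]_p) (x : T -> 'cV[R]_(p + 1)) (eps y : T -> R).
Context (sigma_z sigma_Sigma sigma_eps L : R).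
Hypothesis mz : measurable_fun setT z.
Hypothesis mx : measurable_fun setT x.
Hypothesis meps : measurable_fun setT eps.
Hypothesis my : measurable_fun setT y.
Hypothesis xE : forall w, x w = col_mx (S *m z w) 1.
Hypothesis z_indep : mutually_independent P (fun (j : 'I_p) w => z w j 0).
Hypothesis z_law : forall j : 'I_p, has_law P (fun w => z w j 0) mu_z.
Hypothesis S_sqrt : is_psd_sqrt S Sigma.
Hypothesis mu_z_mean : ('E_mu_z[idfun] = 0%:E)%E.
Hypothesis mu_z_T2 : T2_inequality mu_z sigma_z.
Hypothesis Sigma_le : opnorm Sigma <= sigma_Sigma.
Hypothesis yE : forall w, y w = f (x w) + eps w.
Hypothesis eps_indep : independent_of P eps x.
Hypothesis eps_law : has_law P eps mu_eps.
Hypothesis mu_eps_T2 : T2_inequality mu_eps sigma_eps.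
Hypothesis f_lip : l2_lipschitz L f.
Hypothesis L_le1 : L <= 1.

(** The minimum is over the transport constants of features and noise, the former divided by a bound
    on the covariance. The factor 3 pays for the response: two samples have squared distance at most
    [3 * r ^+ 2 + 2 * (a - b) ^+ 2], with [r] the feature distance and [a - b] the noise
    difference. *)
Definition kappa : R :=
  Num.min ((2 * (sigma_z + 1) ^+ 2)^-1 / (`|sigma_Sigma| + 1))
          ((2 * (sigma_eps + 1) ^+ 2)^-1) / 3.

Lemma kappa_gt0 : 0 < kappa.
Proof.
have s1 : 0 < (2 * (sigma_z + 1) ^+ 2)^-1.
  by rewrite invr_gt0 mulr_gt0// exprn_gt0// ltr_wpDl//; case: mu_z_T2.
have s2 : 0 < (2 * (sigma_eps + 1) ^+ 2)^-1.
  by rewrite invr_gt0 mulr_gt0// exprn_gt0// ltr_wpDl//; case: mu_eps_T2.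
by rewrite divr_gt0// lt_min s2 andbT divr_gt0// ltr_wpDl.
Qed.

Let f_lip1 u v : `|f u - f v| <= frob (u - v).
Proof.
apply: le_trans (f_lip u v) _; rewrite l2normE.
by apply: le_trans (ler_wpM2r (frob_ge0 _) L_le1) _; rewrite mul1r.
Qed.

(** The sample is a Lipschitz image of independent coordinates: the entries of [z] tensorize, the
    square root of the covariance maps them to the features, the noise is adjoined, and [f] is
    applied last. *)
Lemma sample_transport : transport_bound P (fun w => (x w, y w))
  (fun u v => kappa * dist2 u v).
Proof.
pose kz : R := (2 * (sigma_z + 1) ^+ 2)^-1; pose ke : R := (2 * (sigma_eps + 1) ^+ 2)^-1.
pose s : R := `|sigma_Sigma| + 1.
have s0 : 0 < s by rewrite ltr_wpDl.
have kz0 : 0 < kz.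
  by rewrite invr_gt0 mulr_gt0// exprn_gt0// ltr_wpDl//; case: mu_z_T2.
have mzj (j : 'I_p) : measurable_fun setT (fun w => z w j 0).
  exact: measurableT_comp (measurable_mx_coord j 0) mz.
have t1 := transport_bound_row mzj z_indep
  (fun j => transport_bound_T2 (mzj j) (z_law j) mu_z_T2).
pose phi (r : 'rV[R]_p) : 'cV[R]_(p + 1) := col_mx (S *m r^T) 1.
have mphi : measurable_fun setT phi.
  apply: measurable_fun_mx => i j; rewrite /phi.
  under eq_fun do rewrite mxE.
  case: (fintype.split i) => k; last exact: measurable_cst.
  under eq_fun do rewrite mxE.
  apply: measurable_sum => l; apply: measurable_funM => //.
  under eq_fun do rewrite mxE; exact: measurable_mx_coord.
have t2 : transport_bound P x (fun u v => (kz / s) * frob (u - v) ^+ 2).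
  have -> : x = phi \o (fun w => \row_j z w j 0).
    apply/funext => w; rewrite xE /phi /=; congr col_mx; congr (_ *m _).
    by apply/colP => j; rewrite !mxE.
  apply: (transport_bound_map mphi _ t1) => u v.
  rewrite -mulr_sumr -mulrA ler_wpM2l// ?(ltW kz0)//.
  rewrite mulrC ler_pdivrMr// mulrC.
  have -> : phi u - phi v = col_mx (S *m (u - v)^T) 0.
    by rewrite /phi opp_col_mx add_col_mx subrr -mulmxBr -linearB.
  have -> : frob (col_mx (S *m (u - v)^T) (0 : 'cV[R]_1)) = frob (S *m (u - v)^T).
    rewrite -!l2normE /l2norm big_split_ord /= big_ord1 col_mxEd mxE expr0n addr0.
    by congr Num.sqrt; apply: eq_bigr => i _; rewrite col_mxEu.
  apply: le_trans (frob_psd_sqrt _ S_sqrt Sigma_le) _.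
  have -> : \sum_i (u 0 i - v 0 i) ^+ 2 = frob (u - v)^T ^+ 2.
    by rewrite frob_tr frob_sqr big_ord1; apply: eq_bigr => i _; rewrite !mxE.
  rewrite ler_wpM2r ?sqr_ge0//; apply: le_trans (ler_norm _) _; rewrite /s; lra.
have t3 := transport_bound_T2 meps eps_law mu_eps_T2.
have t4 := transport_bound_pair mx meps (independent_of_sym eps_indep) t2 t3.
have mf : measurable_fun setT f by exact: measurable_lipschitz.
pose chi (u : 'cV[R]_(p + 1) * R) := (u.1, f u.1 + u.2).
have mchi : measurable_fun setT chi.
  apply: measurable_fun_pair => //; apply: measurable_funD => //.
  exact: measurableT_comp.
have -> : (fun w => (x w, y w)) = chi \o (fun w => (x w, eps w)).
  by apply/funext => w; rewrite /chi /= yE.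
apply: (transport_bound_map mchi _ t4) => -[u a] [v b] /=.
rewrite /dist2 /chi /= -/kz -/ke.
have k0 : 0 <= 3 * kappa by rewrite mulr_ge0// ltW// kappa_gt0.
have k1 : 3 * kappa <= kz / s.
  by rewrite /kappa mulrC divfK// ge_min lexx.
have k2 : 3 * kappa <= ke.
  by rewrite /kappa mulrC divfK// ge_min lexx orbT.
have := f_lip1 u v; set r := frob (u - v) => fr.
have r0 : 0 <= r := frob_ge0 _.
have : (f u + a - (f v + b)) ^+ 2 <= 2 * r ^+ 2 + 2 * (a - b) ^+ 2.
  have : (f u - f v) ^+ 2 <= r ^+ 2.
    by rewrite -real_normK ?num_real// ler_sqr ?nnegrE.
  have := sqr_ge0 ((f u - f v) - (a - b)); nra.
move=> h.
have h1 := ler_wpM2r (sqr_ge0 r) k1.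
have h2 := ler_wpM2r (sqr_ge0 (a - b)) k2.
have K0 := ltW kappa_gt0.
have h3 := ler_wpM2l K0 h.
have h4 := mulr_ge0 K0 (sqr_ge0 (a - b)).
rewrite mulrDr; lra.
Qed.

(** The entries of [z] are centred, so only the intercept coefficient survives. *)
Lemma feature_mean (b : 'cV[R]_(p + 1)) :
  P.-integrable setT (EFin \o (fun w => ((x w)^T *m b) 0 0)) /\
  \int[P]_w ((x w)^T *m b) 0 0 = dsubmx b 0 0.
Proof.
have mzj (j : 'I_p) : measurable_fun setT (fun w => z w j 0).
  exact: measurableT_comp (measurable_mx_coord j 0) mz.
have muE : (\int[mu_z]_x x%:E = 0)%E by move: mu_z_mean; rewrite unlock.
have imu := integral0_integrable muE.
have mEF : measurable_fun setT (EFin : R -> \bar R).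
  by have /measurable_EFinP := @measurable_id _ R setT.
have iz (j : 'I_p) : P.-integrable setT (EFin \o (fun w => z w j 0)).
  apply/integrableP; split; first exact: measurableT_comp.
  rewrite (has_law_ge0_integral (mzj j) (z_law j) (f := fun t => `|t%:E|%E))//.
    by have /integrableP[] := imu.
  apply: measurableT_comp; [exact: abse_measurable|exact: mEF].
have ez (j : 'I_p) : \int[P]_w z w j 0 = 0.
  have mid : measurable_fun setT (fun t : R => t) by exact: measurable_id.
  by rewrite (has_law_integral (mzj j) (z_law j) mid (iz j)) /Rintegral muE.
pose a := S^T *m usubmx b.
have E : (fun w => ((x w)^T *m b) 0 0) =
    (fun w => \sum_(l < p) a l 0 * z w l 0 + dsubmx b 0 0).
  apply/funext => w; rewrite xE tr_col_mx -{1}[b]vsubmxK mul_row_col trmx1 mul1mx mxE.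
  congr (_ + _); rewrite trmx_mul -mulmxA -/a mxE.
  by apply: eq_bigr => l _; rewrite !mxE mulrC.
have iaz (l : 'I_p) : P.-integrable setT (EFin \o (fun w => a l 0 * z w l 0)).
  exact: (integrableZl measurableT (a l 0) (iz l)).
have [i1 e1] := integrable_sumR (index_enum 'I_p) iaz.
have icst : P.-integrable setT (EFin \o cst (dsubmx b 0 0)).
  exact: finite_measure_integrable_cst.
rewrite E; split; first exact: (integrableD measurableT i1 icst).
rewrite RintegralD// Rintegral_cstT e1 big1 ?add0r// => l _.
by rewrite RintegralZl// ez mulr0.
Qed.

Let mxb (b : 'cV[R]_(p + 1)) :
  measurable_fun setT (fun u : 'cV[R]_(p + 1) * R => ((u.1)^T *m b) 0 0).
Proof.
under eq_fun do rewrite mxE.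
apply: measurable_sum => l; apply: measurable_funM => //.
under eq_fun do rewrite mxE.
exact: measurableT_comp (measurable_mx_coord l 0) measurable_fst.
Qed.

(** The linear form is 1-Lipschitz in the sample, and [young] turns it into the cost plus
    [(4 * kappa)^-1]. The summand 1 bounds its mean, the intercept coefficient of [b]. *)
Lemma feature_exp_moment (b : 'cV[R]_(p + 1)) : frob b <= 1 ->
  (\int[P]_w (expR (((x w)^T *m b) 0 0))%:E <= (expR (1 + (4 * kappa)^-1))%:E)%E.
Proof.
move=> b1; have [ib eb] := feature_mean b.
have mxy : measurable_fun setT (fun w => (x w, y w)) by exact: measurable_fun_pair.
have k0 := kappa_gt0.
have kd0 : 0 <= (4 * kappa)^-1 by rewrite invr_ge0 mulr_ge0// ltW.
have cost0 (u v : 'cV[R]_(p + 1) * R) : 0 <= kappa * dist2 u v by rewrite mulr_ge0 ?dist2_ge0// ltW.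
have H := transport_subgaussian mxy sample_transport cost0 (mxb b) kd0 ib.
apply: (le_trans (H _)).
  move=> [u a] [v c] /=; rewrite -addrA -lerBlDl.
  have -> : (u^T *m b) 0 0 - (v^T *m b) 0 0 = ((u - v)^T *m b) 0 0.
    by rewrite linearB mulmxBl !mxE.
  apply: le_trans (ler_norm _) _; apply: le_trans (dot_frob _ _) _.
  apply: (@le_trans _ _ (frob (u - v))); first by rewrite ler_piMr ?frob_ge0.
  apply: le_trans (young _ k0) _.
  by rewrite lerD2r ler_pM2l// /dist2 /= lerDl sqr_ge0.
rewrite lee_fin ler_expR lerD2r eb; apply: le_trans b1; apply: le_trans (ler_norm _) _.
by have := ler_abs_frob b (rshift p 0) 0; rewrite !mxE.
Qed.

(** 512 is twice [4 ^ 4]: [r ^+ 4 <= 256 * (expR r + expR (- r))], and each of the two exponential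
    moments obeys [feature_exp_moment]. *)
Definition moment4_bound : R := 512 * expR (1 + (4 * kappa)^-1).

Lemma feature_moment4 (b : 'cV[R]_(p + 1)) : frob b <= 1 ->
  P.-integrable setT (EFin \o (fun w => ((x w)^T *m b) 0 0 ^+ 4)) /\
  \int[P]_w (((x w)^T *m b) 0 0 ^+ 4) <= moment4_bound.
Proof.
move=> b1.
have h1 := feature_exp_moment b1.
have b1' : frob (- b) <= 1 by rewrite frobN.
have h2 := feature_exp_moment b1'.
set t := fun w => ((x w)^T *m b) 0 0.
have tN w : ((x w)^T *m - b) 0 0 = - t w by rewrite mulmxN mxE.
have mt : measurable_fun setT t.
  have mxy : measurable_fun setT (fun w => (x w, y w)) by exact: measurable_fun_pair.
  exact: measurableT_comp (mxb b) mxy.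
have me1 : measurable_fun setT (fun w => (expR (t w))%:E).
  by apply: measurableT_comp => //; exact: measurableT_comp.
have me2 : measurable_fun setT (fun w => (expR (- t w))%:E).
  apply: measurableT_comp => //; apply: measurableT_comp => //; exact: measurableT_comp.
have pw (r : R) : r ^+ 4 <= 256 * (expR r + expR (- r)).
  have h := @exp_ge_power R `|r| 4 isT (normr_ge0 r).
  have : r ^+ 4 / 256 = (`|r| / 4) ^+ 4.
    rewrite expr_div_n; have -> : `|r| ^+ 4 = r ^+ 4.
      by rewrite -normrX ger0_norm// exprn_even_ge0.
    by field.
  have := expR_ge0 r; have := expR_ge0 (- r).
  by move: h; case: (ler0P r) => _ *; lra.
have m4 : measurable_fun setT (fun w => (t w ^+ 4)%:E).
  by apply: measurableT_comp => //; exact: measurable_funX.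
have t40 w : 0 <= t w ^+ 4 by exact: exprn_even_ge0.
have B : (\int[P]_w (t w ^+ 4)%:E <= moment4_bound%:E)%E.
  apply: (@le_trans _ _ (\int[P]_w (256%:E * ((expR (t w))%:E + (expR (- t w))%:E)))%E).
    apply: ge0_le_integral => //.
    - by move=> w _; rewrite lee_fin.
    - apply: emeasurable_funM => //; exact: emeasurable_funD.
    - by move=> w _; rewrite -EFinD -EFinM lee_fin.
  rewrite ge0_integralZl_EFin//; last 2 first.
  - by move=> w _; rewrite -EFinD lee_fin addr_ge0 ?expR_ge0.
  - exact: emeasurable_funD.
  rewrite ge0_integralD//.
  under [X in (_ * (_ + X) <= _)%E]eq_integral => w _ do rewrite -tN.
  have -> : (moment4_bound%:E = 256%:E * ((expR (1 + (4 * kappa)^-1))%:E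
     + (expR (1 + (4 * kappa)^-1))%:E))%E.
    by rewrite -EFinD -EFinM /moment4_bound; congr EFin; ring.
  by rewrite lee_pmul2l// leeD.
have i4 : P.-integrable setT (EFin \o (fun w => t w ^+ 4)).
  apply/integrableP; split=> //.
  under eq_integral => w _ do rewrite /= ger0_norm//.
  by apply: le_lt_trans B _; rewrite ltry.
by split=> //; rewrite -lee_fin EFin_Rintegral.
Qed.

End sample_law.

(** * A lattice net of the unit ball and the operator norm *)

Section net.
Context (R : realType) (q : nat).
Hypothesis q_gt0 : (0 < q)%N.

Let s : R := Num.sqrt q%:R.
Let s_gt0 : 0 < s. Proof. by rewrite sqrtr_gt0 ltr0n. Qed.
Let ss : s ^+ 2 = q%:R. Proof. by rewrite sqr_sqrtr// ler0n. Qed.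

(** Integer coordinates of lattice points of mesh [1 / (2 * sqrt q)] in the positive orthant. A
    vector of norm at most 1 there has coordinate sum at most [sqrt q], which after scaling is the
    bound [2 * q]. *)
Definition net_index : {set q.-tuple 'I_(2 * q).+1} :=
  [set t : q.-tuple 'I_(2 * q).+1 | (\sum_(i <- t) i <= 2 * q)%N]%SET.

Definition net_point (t : q.-tuple 'I_(2 * q).+1) : 'cV[R]_q :=
  \col_i ((tnth t i)%:R / (2 * s)).

(** Stars and bars give a binomial coefficient, one term in the expansion of
    [(1 + 1) ^ (q + 2 * q)]. *)
Lemma card_net_index : (#|net_index| <= 8 ^ q)%N.
Proof.
rewrite /net_index card_partial_ord_partitions.
have -> : (8 ^ q = (1 + 1) ^ (q + 2 * q))%N by rewrite -(expnM 2 3) mulSn.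
have lt : (q < (q + 2 * q).+1)%N by rewrite ltnS leq_addr.
rewrite Pascal (bigD1 (Ordinal lt))//= !exp1n !muln1.
exact: leq_addr.
Qed.

(** Rounding every coordinate down keeps the point in the unit ball and leaves a nonnegative
    remainder, so the approximation can be iterated. *)
Lemma net_approx (v : 'cV[R]_q) : (forall i, 0 <= v i 0) -> frob v <= 1 ->
  exists2 t, t \in net_index & [/\ frob (net_point t) <= 1,
    forall i, 0 <= (v - net_point t) i 0 & frob (v - net_point t) <= 1 / 2].
Proof.
move=> v0 v1.
have s2 : 0 < 2 * s by rewrite mulr_gt0.
have vs i : 0 <= 2 * s * v i 0 by rewrite mulr_ge0// ltW.
have s_le_q : s <= q%:R.
  rewrite -ss expr2 ler_peMr ?(ltW s_gt0)//.
  by rewrite -(@ler_pXn2r _ 2)// ?nnegrE ?(ltW s_gt0)// ss expr1n ler1n.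
have lt i : (Num.truncn (2 * s * v i 0)%R < (2 * q).+1)%N.
  rewrite ltnS -(ler_nat R); apply: le_trans (_ : 2 * s * v i 0 <= _).
    by rewrite truncn_le.
  have vi : v i 0 <= 1.
    by apply: le_trans (ler_norm _) _; apply: le_trans (ler_abs_frob _ _ _) v1.
  apply: (@le_trans _ _ (2 * s)); first by rewrite ler_piMr// ltW.
  by rewrite natrM ler_pM2l.
pose t := [tuple (Ordinal (lt i)) | i < q].
have tE i : net_point t i 0 = (Num.truncn (2 * s * v i 0))%:R / (2 * s).
  by rewrite mxE tnth_mktuple.
have tv i : net_point t i 0 <= v i 0.
  by rewrite tE ler_pdivrMr// [leRHS]mulrC truncn_le.
have tp i : 0 <= net_point t i 0 by rewrite tE divr_ge0// ltW.
exists t.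
  rewrite inE -(ler_nat R) big_tuple natr_sum.
  apply: (@le_trans _ _ (\sum_(i < q) (2 * s) * (v i 0))).
    apply: ler_sum => i _; rewrite tnth_mktuple /=; by rewrite truncn_le.
  rewrite -mulr_sumr.
  have : \sum_(i < q) 1 * v i 0 <= s * frob v.
    apply: le_trans (cauchy_schwarz _ _) _.
    have -> : \sum_(i < q) (1 : R) ^+ 2 = q%:R.
      by rewrite (eq_bigr (fun=> 1)) ?sumr_const ?card_ord// => i _; rewrite expr1n.
    by rewrite -/s -/(l2norm v) l2normE.
  under eq_bigr do rewrite mul1r.
  move=> h; have h2 : \sum_(i < q) v i 0 <= s.
    by apply: le_trans h _; rewrite ler_piMr// ltW.
  by rewrite natrM -ss expr2 mulrA; exact: ler_wpM2l (ltW s2) _ _ h2.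
have vtE i : (v - net_point t) i 0 = v i 0 - net_point t i 0.
  by rewrite mxE [X in _ + X]mxE.
split.
- apply: le_trans v1; rewrite -!l2normE; apply: ler_wsqrtr; apply: ler_sum => i _.
  by rewrite ler_sqr ?nnegrE.
- by move=> i; rewrite vtE subr_ge0.
- have e0 : 0 < (2 * s)^-1 by rewrite invr_gt0.
  have := frob_lt_coord (v := v - net_point t) e0.
  rewrite -/s (_ : s * (2 * s)^-1 = 1 / 2); last by field; exact: lt0r_neq0.
  apply=> i; rewrite vtE ger0_norm ?subr_ge0//.
  rewrite tE ltrBlDr -(ltr_pM2l s2) mulrDr mulfV ?gt_eqF//.
  rewrite (mulrC (2 * s) (_ / _)) divfK ?gt_eqF//.
  by rewrite addrC natr1 real_truncnS_gt// num_real.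
Qed.

(** Approximating twice the remainder over and over gives the series [B + B / 2 + B / 4 + ...],
    hence [2 * B] on the positive orthant; positive and negative parts double this. *)
Lemma opb_net m (X : 'M[R]_(m, q)) (B : R) : 0 <= B ->
  (forall t, t \in net_index -> frob (net_point t) <= 1 ->
     frob (X *m net_point t) <= B) ->
  opb X (4 * B).
Proof.
move=> B0 netB.
have step j (v : 'cV[R]_q) : (forall i, 0 <= v i 0) -> frob v <= 1 ->
    frob (X *m v) <= 2 * B + frob X / 2 ^+ j.
  elim: j v => [|j IH] v v0 v1.
    rewrite expr0 divr1; apply: le_trans (frob_mul _ _) _.
    apply: (@le_trans _ _ (frob X)); first by rewrite ler_piMr ?frob_ge0.
    by rewrite lerDr mulr_ge0.
  have [t tN [t1 tv tf]] := net_approx v0 v1.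
  have := IH (2 *: (v - net_point t)).
  rewrite -scalemxAr !frobZ ger0_norm//.
  move=> /(_ _ _)/wrap[].
    by move=> i; rewrite mxE mulr_ge0.
    by move: tf; lra.
  have -> : X *m v = X *m net_point t + X *m (v - net_point t).
    by rewrite -mulmxDr addrC subrK.
  move=> h; apply: le_trans (frobD _ _) _; have := netB t tN t1.
  rewrite exprS invfM; move: h; lra.
have pos (v : 'cV[R]_q) : (forall i, 0 <= v i 0) -> frob v <= 1 ->
    frob (X *m v) <= 2 * B.
  move=> v0 v1; rewrite leNgt; apply/negP => lt.
  pose e := frob (X *m v) - 2 * B.
  have e0 : 0 < e by rewrite subr_gt0.
  (* For this [j] the crude remainder [frob X / 2 ^+ j] is smaller than the supposed excess [e]. *)
  pose j := Num.truncn (frob X / e).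
  have : frob X / e < 2 ^+ j.
    apply: lt_le_trans (_ : j.+1%:R <= _); first by rewrite real_truncnS_gt// num_real.
    by rewrite -natrX ler_nat ltn_expl.
  rewrite ltr_pdivrMr// mulrC -ltr_pdivrMr ?exprn_gt0//.
  have := step j v v0 v1; move: (frob X / 2 ^+ j) => c; rewrite /e; lra.
have gen (v : 'cV[R]_q) : frob v <= 1 -> frob (X *m v) <= 4 * B.
  move=> v1; pose vp : 'cV[R]_q := \col_i Num.max (v i 0) 0.
  pose vn : 'cV[R]_q := \col_i Num.max (- v i 0) 0.
  have -> : v = vp - vn.
    apply/colP => i; rewrite !mxE; case: lerP => h1; case: lerP => h2; lra.
  have le (w : 'cV[R]_q) : (forall i, `|w i 0| <= `|v i 0|) -> frob w <= 1.
    move=> wv; apply: le_trans v1; rewrite -!l2normE; apply: ler_wsqrtr.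
    apply: ler_sum => i _; rewrite -(real_normK (num_real (w i 0))).
    by rewrite -(real_normK (num_real (v i 0))) ler_sqr ?nnegrE.
  rewrite mulmxBr; apply: le_trans (frobB _ _) _.
  have -> : 4 * B = 2 * B + 2 * B by ring.
  apply: lerD; apply: pos.
  - by move=> i; rewrite mxE le_max lexx orbT.
  - by apply: le => i; rewrite mxE; case: (lerP (v i 0) 0) => h;
      rewrite ?normr0 ?normr_ge0 ?lexx.
  - by move=> i; rewrite mxE le_max lexx orbT.
  - by apply: le => i; rewrite mxE; case: (lerP (- v i 0) 0) => h;
      rewrite ?normr0 ?normrN ?normr_ge0 ?lexx.
split=> [|v]; first by rewrite mulr_ge0.
have [v0|v0] := eqVneq (frob v) 0.
  by apply: le_trans (frob_mul _ _) _; rewrite v0 !mulr0.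
have v1 : 0 < frob v by rewrite lt0r v0 frob_ge0.
have := gen ((frob v)^-1 *: v); rewrite -scalemxAr !frobZ.
rewrite ger0_norm ?invr_ge0 ?frob_ge0// mulVf// => /(_ (lexx _)).
by rewrite mulrC ler_pdivrMr.
Qed.

End net.

(** * Union and exponential tail bounds *)

Section tails.
Context d (T : measurableType d) (R : realType) (P : probability T R).

Lemma measure_finite_union (I : eqType) (s : seq I) (A : I -> set T) (c : R) :
  (forall i, measurable (A i)) -> (forall i, i \in s -> (P (A i) <= c%:E)%E) ->
  (P (\big[setU/set0]_(i <- s) A i) <= ((size s)%:R * c)%:E)%E.
Proof.
move=> mA; elim: s => [|i s IH] Pc; first by rewrite big_nil measure0 mul0r.
rewrite big_cons; apply: le_trans (measureU2 _ _ _) _ => //.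
  by apply: bigsetU_measurable.
have -> : ((size (i :: s))%:R * c)%:E = (c%:E + ((size s)%:R * c)%:E)%E.
  by rewrite -EFinD /= -natr1; congr EFin; ring.
apply: leeD.
  by apply: Pc; rewrite mem_head.
by apply: IH => j js; apply: Pc; rewrite in_cons js orbT.
Qed.

Lemma chernoff (f : T -> R) (t c : R) : measurable_fun setT f ->
  (\int[P]_w (expR (f w))%:E <= (expR c)%:E)%E ->
  (P [set w | (t < f w)%R] <= (expR (c - t))%:E)%E.
Proof.
move=> mf fc.
have mA : measurable [set w | (t < f w)%R] by exact: measurable_set_lt.
have mE : measurable_fun setT (fun w => (expR (f w))%:E).
  by apply: measurableT_comp => //; exact: measurableT_comp.
have : ((expR t)%:E * P [set w | (t < f w)%R] <= (expR c)%:E)%E.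
  rewrite -integral_cst//; apply: le_trans fc.
  apply: (@le_trans _ _ (\int[P]_(w in [set w | (t < f w)%R]) (expR (f w))%:E)%E).
    apply: ge0_le_integral => //.
    - by move=> w _; rewrite lee_fin expR_ge0.
    - exact: measurable_funTS.
    - by move=> w /= tw; rewrite lee_fin ler_expR ltW.
  apply: ge0_subset_integral => //.
have PA : P [set w | (t < f w)%R] \is a fin_num by exact: fin_num_measure.
rewrite -(fineK PA) -EFinM !lee_fin expRD expRN.
by rewrite ler_pdivlMr ?expR_gt0// mulrC.
Qed.

End tails.

Section data.
Context (R : realType) (n q : nat).

Definition feature_matrix (u : 'rV['cV[R]_q * R]_n) : 'M[R]_(n, q) :=
  design (fun i => (u 0 i).1).

Definition label_vector (u : 'rV['cV[R]_q * R]_n) : 'cV[R]_n :=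
  response (fun i => (u 0 i).2).

Definition data_dist2 (u v : 'rV['cV[R]_q * R]_n) : R :=
  frob (feature_matrix u - feature_matrix v) ^+ 2
  + frob (label_vector u - label_vector v) ^+ 2.

Lemma data_dist2E u v : data_dist2 u v = \sum_i dist2 (u 0 i) (v 0 i).
Proof.
rewrite /data_dist2 !frob_sqr -big_split; apply: eq_bigr => i _ /=.
rewrite big_ord1 !mxE /dist2; congr (_ + _).
rewrite -l2normE l2norm_sqr; apply: eq_bigr => j _; by rewrite !mxE.
Qed.

Lemma measurable_feature_matrix : measurable_fun setT feature_matrix.
Proof.
apply: measurable_fun_mx => i j; under eq_fun do rewrite mxE.
apply: measurableT_comp (measurable_mx_coord j 0) _.
exact: measurableT_comp measurable_fst (measurable_mx_coord 0 i).
Qed.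

Lemma measurable_label_vector : measurable_fun setT label_vector.
Proof.
apply: measurable_fun_mx => i j; under eq_fun do rewrite mxE.
exact: measurableT_comp measurable_snd (measurable_mx_coord 0 i).
Qed.

End data.

(** * Moments and regularity of the population risk *)

Section population_risk.
Context d (T : measurableType d) (R : realType) (P : probability T R) (q : nat).
Context (psi : R * R -> R) (C_psi Cbar_psi C4 m4 : R).
Hypothesis hpsi : forall u, differentiable psi u.
Hypothesis hC : 0 <= C_psi.
Hypothesis hCbar : 0 <= Cbar_psi.
Hypothesis hgrad :
  forall u, l2norm2 (grad2 psi u) <= C_psi * l2norm2 u + Cbar_psi.
Context (x : T -> 'cV[R]_q) (y : T -> R).
Hypothesis mx : measurable_fun setT x.
Hypothesis my : measurable_fun setT y.
Hypothesis moment4 : forall b : 'cV[R]_q, frob b <= 1 ->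
  P.-integrable setT (EFin \o (fun w => ((x w)^T *m b) 0 0 ^+ 4)) /\
  \int[P]_w (((x w)^T *m b) 0 0 ^+ 4) <= C4.
Hypothesis moment4y :
  P.-integrable setT (EFin \o (fun w => y w ^+ 4)) /\ \int[P]_w (y w ^+ 4) <= m4.

Definition pop_risk (b : 'cV[R]_q) : R := \int[P]_w loss psi (y w) (x w) b.

Definition psi_growth : R := `|psi (0, 0)| + 4 * (C_psi + Cbar_psi).

Lemma psi_growth_ge0 : 0 <= psi_growth.
Proof. by rewrite addr_ge0// mulr_ge0// addr_ge0. Qed.

Lemma measurable_psi : measurable_fun setT psi.
Proof.
apply: measurable_continuous2 => u; exact: differentiable_continuous.
Qed.

Lemma psi_quadratic (a t : R) : `|psi (a, t)| <= psi_growth * (1 + a ^+ 2 + t ^+ 2).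
Proof.
have h := psi_local_lip hpsi hC hCbar hgrad a t 0 0.
rewrite !normr0 !addr0 !subr0 in h.
have l0 : 0 <= C_psi + Cbar_psi by rewrite addr_ge0.
have h2 : `|psi (a, t)| <= `|psi (0, 0)| + `|psi (a, t) - psi (0, 0)|.
  by rewrite -[in leLHS](subrK (psi (0,0)) (psi (a, t))) addrC (ler_normD _ _).
have h3 : (1 + `|a| + `|t|) * (`|a| + `|t|) <= 4 * (1 + a ^+ 2 + t ^+ 2).
  rewrite -(real_normK (num_real a)) -(real_normK (num_real t)).
  have := normr_ge0 a; have := normr_ge0 t.
  move: `|a| `|t| => A B ? ?; have := sqr_ge0 (A - B); have := sqr_ge0 (A + B - 1); nra.
have h4 := ler_wpM2l l0 h3; rewrite mulrA in h4.
have h5 := le_trans h h4.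
have s0 : 0 <= a ^+ 2 + t ^+ 2 by rewrite addr_ge0 ?sqr_ge0.
have h6 : `|psi (0, 0)| <= `|psi (0, 0)| * (1 + a ^+ 2 + t ^+ 2).
  by rewrite ler_peMr// -addrA lerDl.
apply: le_trans h2 _; rewrite /psi_growth mulrDl; apply: lerD => //.
by rewrite (le_trans h5)// mulrCA mulrA.
Qed.

Let mxb (b : 'cV[R]_q) : measurable_fun setT (fun w => ((x w)^T *m b) 0 0).
Proof.
apply: (measurableT_comp (measurable_mx_coord 0 0)).
apply: measurable_mulmx => //; apply: measurable_fun_mx => i j.
under eq_fun do rewrite mxE.
exact: measurableT_comp (measurable_mx_coord j i) mx.
Qed.

Lemma measurable_loss (b : 'cV[R]_q) :
  measurable_fun setT (fun w => loss psi (y w) (x w) b).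
Proof.
apply: (measurableT_comp measurable_psi); exact: measurable_fun_pair.
Qed.

Lemma moment4_scaled (b : 'cV[R]_q) (M : R) : 0 < M -> frob b <= M ->
  P.-integrable setT (EFin \o (fun w => ((x w)^T *m b) 0 0 ^+ 4)) /\
  \int[P]_w (((x w)^T *m b) 0 0 ^+ 4) <= M ^+ 4 * C4.
Proof.
move=> M0 bM.
have [i4 I4] : P.-integrable setT (EFin \o (fun w => ((x w)^T *m (M^-1 *: b)) 0 0 ^+ 4)) /\
   \int[P]_w (((x w)^T *m (M^-1 *: b)) 0 0 ^+ 4) <= C4.
  apply: moment4; rewrite frobZ ger0_norm ?invr_ge0 ?(ltW M0)//.
  by rewrite ler_pdivrMl// mulr1.
have -> : (fun w => ((x w)^T *m b) 0 0 ^+ 4) =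
    (fun w => M ^+ 4 * ((x w)^T *m (M^-1 *: b)) 0 0 ^+ 4).
  apply/funext => w; rewrite -scalemxAr [in RHS]mxE -exprMn mulrA mulfV ?mul1r//.
  exact: lt0r_neq0.
split; first exact: (integrable_scaleR (M ^+ 4) i4).
by rewrite RintegralZl// ler_wpM2l// exprn_ge0// ltW.
Qed.

(** The factor 3 is that of the square of a sum of three terms. *)
Definition loss_moment (M : R) : R := 3 * psi_growth ^+ 2 * (1 + m4 + M ^+ 4 * C4).

Lemma loss_sqr_le (a t : R) : psi (a, t) ^+ 2 <= 3 * psi_growth ^+ 2 * (1 + a ^+ 4 + t ^+ 4).
Proof.
have g0 := psi_growth_ge0.
have h := psi_quadratic a t.
rewrite -(real_normK (num_real (psi _))).
apply: (@le_trans _ _ ((psi_growth * (1 + a ^+ 2 + t ^+ 2)) ^+ 2)).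
  by rewrite ler_sqr ?nnegrE// (le_trans _ h).
have -> : 3 * psi_growth ^+ 2 * (1 + a ^+ 4 + t ^+ 4) =
  psi_growth ^+ 2 * (3 * (1 + a ^+ 4 + t ^+ 4)) by ring.
rewrite exprMn ler_wpM2l ?sqr_ge0//.
have -> : a ^+ 4 = (a ^+ 2) ^+ 2 by rewrite -exprM.
have -> : t ^+ 4 = (t ^+ 2) ^+ 2 by rewrite -exprM.
move: (a ^+ 2) (t ^+ 2) => A B.
have := sqr_ge0 (A - 1); have := sqr_ge0 (B - 1); have := sqr_ge0 (A - B); nra.
Qed.

Lemma loss_integrable (b : 'cV[R]_q) (M : R) : 0 < M -> frob b <= M ->
  [/\ P.-integrable setT (EFin \o (fun w => loss psi (y w) (x w) b)),
      P.-integrable setT (EFin \o (fun w => loss psi (y w) (x w) b ^+ 2)) &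
      \int[P]_w (loss psi (y w) (x w) b ^+ 2) <= loss_moment M].
Proof.
move=> M0 bM; have [i4 I4] := moment4_scaled M0 bM; have [iy Iy] := moment4y.
pose g w := 3 * psi_growth ^+ 2 * (1 + y w ^+ 4 + ((x w)^T *m b) 0 0 ^+ 4).
have i1 : P.-integrable setT (EFin \o (fun w => 1 + y w ^+ 4)).
  exact: (integrable_addR (integrable_cstR P 1) iy).
have i2 : P.-integrable setT (EFin \o (fun w => 1 + y w ^+ 4 + ((x w)^T *m b) 0 0 ^+ 4)).
  exact: (integrable_addR i1 i4).
have ig : P.-integrable setT (EFin \o g) by exact: (integrable_scaleR _ i2).
have ml := measurable_loss b.
have i3 : P.-integrable setT (EFin \o (fun w => loss psi (y w) (x w) b ^+ 2)).
  apply: (integrable_ler _ ig); first exact: measurable_funX.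
  by move=> w; rewrite ger0_norm ?sqr_ge0//; exact: loss_sqr_le.
split=> //; first exact: integrable_of_sqr.
apply: le_trans (le_Rintegral measurableT i3 ig (fun w _ => loss_sqr_le _ _)) _.
rewrite /g RintegralZl// ler_wpM2l ?(mulr_ge0 _ (sqr_ge0 _))//.
rewrite RintegralD// lerD// RintegralD//; last exact: integrable_cstR.
by rewrite Rintegral_cstT lerD2l.
Qed.

Lemma pop_risk_bound (b : 'cV[R]_q) (M : R) : 0 < M -> frob b <= M ->
  `|pop_risk b| <= 1 + loss_moment M.
Proof.
move=> M0 bM; have [i1 i2 I2] := loss_integrable M0 bM.
have i5 : P.-integrable setT (EFin \o (fun w => 1 + loss psi (y w) (x w) b ^+ 2)).
  exact: (integrable_addR (integrable_cstR P 1) i2).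
apply: le_trans (le_normr_Rintegral measurableT i1) _.
apply: (@le_trans _ _ (\int[P]_w (1 + loss psi (y w) (x w) b ^+ 2))).
  apply: le_Rintegral => //; first exact: integrable_norm.
  move=> w _ /=; rewrite -(real_normK (num_real (loss _ _ _ _))).
  by have := sqr_ge0 (`|loss psi (y w) (x w) b| - 1); nra.
rewrite RintegralD//; last exact: integrable_cstR.
by rewrite Rintegral_cstT lerD2l.
Qed.

(** The numbers come from [(1 + 2 * |y| + |t| + |t'|) * |r| <= 4 * (1 + 4 * y ^+ 2 + t ^+ 2 + t' ^+
    2) + r ^+ 2], where each square is then bounded by one plus the fourth power; thus 7 is
    [1 + 4 + 1 + 1]. *)
Definition pop_lip (M : R) : R :=
  (C_psi + Cbar_psi) * (4 * (7 + 4 * m4 + 2 * (M ^+ 4 * C4)) + (1 + C4)).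

Lemma pop_risk_lip (b b' : 'cV[R]_q) (M : R) : 0 < M -> frob b <= M -> frob b' <= M ->
  `|pop_risk b - pop_risk b'| <= pop_lip M * frob (b - b').
Proof.
move=> M0 bM bM'.
have [i1 _ _] := loss_integrable M0 bM; have [i1' _ _] := loss_integrable M0 bM'.
rewrite /pop_risk -RintegralB//.
have l0 : 0 <= C_psi + Cbar_psi by rewrite addr_ge0.
set D := frob (b - b').
have D0 : 0 <= D := frob_ge0 _.
(* The moment bound applies to a direction of norm at most 1. For [D = 0] the convention [0^-1 = 0]
   gives [e = 0], consistent with [b = b']. *)
pose e := D^-1 *: (b - b').
have e1 : frob e <= 1.
  rewrite frobZ -/D ger0_norm ?invr_ge0//.
  by have [->|Dn] := eqVneq D 0; [rewrite mulr0|rewrite mulVf].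
have eE : b - b' = D *: e.
  rewrite scalerA; have [D00|Dn] := eqVneq D 0; last by rewrite mulfV ?scale1r.
  rewrite D00 mul0r scale0r; apply/matrixP => i j; rewrite [RHS]mxE.
  by apply/eqP; rewrite -normr_le0 -D00 ler_abs_frob.
have [i4 I4] := moment4_scaled M0 bM; have [i4' I4'] := moment4_scaled M0 bM'.
have [ie Ie] := moment4 e1; have [iy Iy] := moment4y.
pose t w := ((x w)^T *m b) 0 0; pose t' w := ((x w)^T *m b') 0 0.
pose r w := ((x w)^T *m e) 0 0.
pose g w := 4 * (7 + 4 * y w ^+ 4 + (t w ^+ 4 + t' w ^+ 4)) + (1 + r w ^+ 4).
have ia : P.-integrable setT (EFin \o (fun w => 7 + 4 * y w ^+ 4)).
  by exact: (integrable_addR (integrable_cstR P 7) (integrable_scaleR 4 iy)).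
have ib : P.-integrable setT (EFin \o (fun w => t w ^+ 4 + t' w ^+ 4)).
  exact: (integrable_addR i4 i4').
have ic : P.-integrable setT (EFin \o (fun w => 4 * (7 + 4 * y w ^+ 4 + (t w ^+ 4 + t' w ^+ 4)))).
  exact: (integrable_scaleR 4 (integrable_addR ia ib)).
have id : P.-integrable setT (EFin \o (fun w => 1 + r w ^+ 4)).
  exact: (integrable_addR (integrable_cstR P 1) ie).
have ig : P.-integrable setT (EFin \o g) by exact: (integrable_addR ic id).
have gle : \int[P]_w g w <= 4 * (7 + 4 * m4 + 2 * (M ^+ 4 * C4)) + (1 + C4).
  have -> : \int[P]_w g w = 4 * (7 + 4 * \int[P]_w (y w ^+ 4) +
      (\int[P]_w (t w ^+ 4) + \int[P]_w (t' w ^+ 4))) + (1 + \int[P]_w (r w ^+ 4)).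
    rewrite /g RintegralD// RintegralZl//; last exact: (integrable_addR ia ib).
    rewrite RintegralD// RintegralD//; last exact: integrable_scaleR.
    rewrite RintegralZl// Rintegral_cstT.
    rewrite [X in _ * (_ + X) + _]RintegralD// [X in _ + X = _]RintegralD//.
    by rewrite Rintegral_cstT.
  all: try exact: integrable_cstR.
  have J1 : \int[P]_w (t w ^+ 4) <= M ^+ 4 * C4 := I4.
  have J2 : \int[P]_w (t' w ^+ 4) <= M ^+ 4 * C4 := I4'.
  have J3 : \int[P]_w (r w ^+ 4) <= C4 := Ie.
  lra.
have LD0 : 0 <= (C_psi + Cbar_psi) * D by rewrite mulr_ge0.
apply: le_trans (le_normr_Rintegral measurableT _) _.
  exact: (integrableB measurableT i1 i1').
apply: (@le_trans _ _ (\int[P]_w ((C_psi + Cbar_psi) * D * g w))); last first.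
  rewrite RintegralZl// /pop_lip; apply: le_trans (ler_wpM2l LD0 gle) _.
  by apply: le_of_eq; ring.
apply: le_Rintegral => //.
- apply: integrable_norm; exact: (integrableB measurableT i1 i1').
- exact: integrable_scaleR.
move=> w _ /=; apply: le_trans (psi_local_lip hpsi hC hCbar hgrad _ _ _ _) _.
rewrite subrr normr0 add0r -/(t w) -/(t' w).
have -> : t w - t' w = D * r w.
  rewrite /t /t' /r; have -> : D * ((x w)^T *m e) 0 0 = ((x w)^T *m (b - b')) 0 0.
    by rewrite eE -(scalemxAr D) [RHS]mxE.
  by rewrite mulmxBr [RHS]mxE [X in _ = _ + X]mxE.
rewrite normrM (ger0_norm D0).
have -> : forall c z : R, c * z * (D * `|r w|) = c * D * (z * `|r w|) by move=> *; ring.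
rewrite ler_wpM2l// /g.
have := sqr_le4 (y w); have := sqr_le4 (t w); have := sqr_le4 (t' w); have := sqr_le4 (r w).
rewrite -(real_normK (num_real (y w))) -(real_normK (num_real (t w))).
rewrite -(real_normK (num_real (t' w))) -(real_normK (num_real (r w))).
move: (y w ^+ 4) (t w ^+ 4) (t' w ^+ 4) (r w ^+ 4) => y4 t4 t4' r4.
have : forall a1 a2 a3 a4 : R, (1 + a1 + a2 + a1 + a3) * a4 <=
    4 * (1 + 4 * a1 ^+ 2 + a2 ^+ 2 + a3 ^+ 2) + a4 ^+ 2.
  move=> a1 a2 a3 a4.
  have := sqr_ge0 (1 + a1 + a2 + a1 + a3 - 2 * a4).
  have := sqr_ge0 (1 - 2 * a1); have := sqr_ge0 (1 - a2); have := sqr_ge0 (1 - a3).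
  have := sqr_ge0 (2 * a1 - a2); have := sqr_ge0 (2 * a1 - a3); have := sqr_ge0 (a2 - a3).
  have := sqr_ge0 a1; have := sqr_ge0 a2; have := sqr_ge0 a3.
  nra.
move=> /(_ `|y w| `|t w| `|t' w| `|r w|) h1 h2 h3 h4 h5.
apply: le_trans h1 _; lra.
Qed.

End population_risk.

Section measurable_descent.
Context (R : realType) d (T : measurableType d).

Lemma measurable_gd n m q (X : T -> 'M[R]_(m, q)) (Y : T -> 'cV[R]_m) delta b0 k :
  measurable_fun setT X -> measurable_fun setT Y ->
  measurable_fun setT (fun w => gd n (X w) (Y w) delta b0 k).
Proof.
move=> mX mY; elim: k => [|k IH] //=.
apply: measurable_addmx => //; apply: measurable_scalemx.
apply: measurable_mulmx; first exact: measurable_trmx.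
apply: measurable_addmx => //.
under eq_fun do rewrite -scaleN1r.
by apply: measurable_scalemx; exact: measurable_mulmx.
Qed.

End measurable_descent.

(** * Equal laws and conditional expectations *)

Section same_law.
Context d (T : measurableType d) (R : realType) (P : probability T R).
Context dU (U : measurableType dU) (X Y : T -> U).
Hypothesis mX : measurable_fun setT X.
Hypothesis mY : measurable_fun setT Y.
Hypothesis XY : same_law P X Y.

HB.instance Definition _ := isMeasurableFun.Build _ _ _ _ Y mY.

Lemma same_law_ge0_integral (f : U -> \bar R) : measurable_fun setT f ->
  (forall u, 0 <= f u)%E -> (\int[P]_w f (X w) = \int[P]_w f (Y w))%E.
Proof.
move=> mf f0; rewrite (has_law_ge0_integral (mu := distribution P Y) mX XY)//.
by rewrite ge0_integral_distribution.
Qed.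

Lemma same_law_integrable (f : U -> R) : measurable_fun setT f ->
  P.-integrable setT (EFin \o (fun w => f (Y w))) ->
  P.-integrable setT (EFin \o (fun w => f (X w))).
Proof.
move=> mf /integrableP[_ fi]; apply/integrableP; split.
  by apply: measurableT_comp => //; exact: measurableT_comp mf mX.
rewrite (same_law_ge0_integral (f := fun u => `|(f u)%:E|%E))//.
by apply: measurableT_comp => //; exact: measurableT_comp.
Qed.

Lemma same_law_integral (f : U -> R) : measurable_fun setT f ->
  P.-integrable setT (EFin \o (fun w => f (Y w))) ->
  \int[P]_w f (X w) = \int[P]_w f (Y w).
Proof.
move=> mf fi; have fiX := same_law_integrable mf fi.
rewrite (has_law_integral (mu := distribution P Y) mX XY)//.
rewrite /Rintegral integral_distribution//.
exact: measurableT_comp.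
Qed.

End same_law.

Section independent_square.
Context d (T : measurableType d) (R : realType) (P : probability T R).
Context dU (U : measurableType dU) dV (V : measurableType dV).
Context (X : T -> U) (Y : T -> V).
Hypothesis mX : measurable_fun setT X.
Hypothesis mY : measurable_fun setT Y.
Hypothesis XY : independent_of P X Y.

(** Tonelli applies to the square without prior integrability; integrability of [phi] itself follows
    from that of its square. *)
Lemma independent_sqr_integral (phi : U * V -> R) (c : R) : measurable_fun setT phi ->
  (forall u, P.-integrable setT (fun w => (phi (u, Y w) ^+ 2)%:E) /\
     \int[P]_w (phi (u, Y w) ^+ 2) <= c) ->
  [/\ measurable_fun setT (fun w => phi (X w, Y w)),
      P.-integrable setT (EFin \o (fun w => phi (X w, Y w) ^+ 2)),
      \int[P]_w (phi (X w, Y w) ^+ 2) <= c &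
      P.-integrable setT (EFin \o (fun w => phi (X w, Y w)))].
Proof.
move=> mphi phi2.
have mp2 : measurable_fun setT (fun z => phi z ^+ 2) by exact: measurable_funX.
have mE : measurable_fun setT (fun z => (phi z ^+ 2)%:E) by exact: measurableT_comp.
have E2 : (\int[P]_w (phi (X w, Y w) ^+ 2)%:E <= c%:E)%E.
  rewrite (independent_ge0_integral mX mY XY mE); last first.
    by move=> z; rewrite lee_fin sqr_ge0.
  have := EFin_Rintegral (integrable_cstR P c); rewrite Rintegral_cstT => ->.
  apply: ge0_le_integral => //.
  - by move=> w _; apply: integral_ge0 => ? _; rewrite lee_fin sqr_ge0.
  - have mq := measurable_partial_integral P mY mp2.
    have -> : (fun w => \int[P]_w' (phi (X w, Y w') ^+ 2)%:E)%E =
        (fun w => (\int[P]_w' (phi (X w, Y w') ^+ 2))%:E)%E.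
      by apply/funext => w; rewrite EFin_Rintegral//; have [] := phi2 (X w).
    by apply: measurableT_comp => //; exact: measurableT_comp mq mX.
  - by move=> w _; have [i2 I2] := phi2 (X w); rewrite -EFin_Rintegral// lee_fin.
have ml : measurable_fun setT (fun w => phi (X w, Y w)).
  by apply: (measurableT_comp mphi); exact: measurable_fun_pair.
have i2 : P.-integrable setT (EFin \o (fun w => phi (X w, Y w) ^+ 2)).
  apply/integrableP; split; first by apply: measurableT_comp => //; exact: measurable_funX.
  under eq_integral => w _ do rewrite /= ger0_norm ?sqr_ge0//.
  by apply: le_lt_trans E2 _; rewrite ltry.
split=> //; last exact: integrable_of_sqr.
by rewrite -lee_fin EFin_Rintegral.
Qed.

End independent_square.

Section cond_exp_independent.
Context d (T : measurableType d) (R : realType) (P : probability T R).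
Context dV (V : measurableType dV) dU (U : measurableType dU).
Context (D : T -> V) (Z : T -> U).
Hypothesis mD : measurable_fun setT D.
Hypothesis mZ : measurable_fun setT Z.
Hypothesis DZ : independent_of P D Z.
Context (phi : V * U -> R) (N : V -> R) (c : nat -> R).
Hypothesis mphi : measurable_fun setT phi.
Hypothesis mN : measurable_fun setT N.
Hypothesis phi2 : forall (m : nat) v, N v <= m%:R ->
  P.-integrable setT (fun w => (phi (v, Z w) ^+ 2)%:E) /\
  \int[P]_w (phi (v, Z w) ^+ 2) <= c m.
Context (Psi : T -> R).
Hypothesis cond : is_cond_exp P (sigma_of D) (fun w => phi (D w, Z w)) Psi.

Let g v := \int[P]_w phi (v, Z w).

Let mg : measurable_fun setT g.
Proof. exact: measurable_partial_integral. Qed.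

Lemma cond_exp_measurable : measurable_fun setT Psi.
Proof. by case: cond => _ /measurable_int /measurable_EFinP. Qed.

(** The second moments of [phi] are not bounded uniformly over [V], so the defining identity is
    tested on events where [N (D w) <= m]; there [independent_sqr_integral] supplies what Fubini
    needs. *)
Lemma cond_exp_integral_set (S : set V) (m : nat) : measurable S ->
    S `<=` [set v | N v <= m%:R] ->
  P.-integrable setT (EFin \o (fun w => g (D w) * \1_S (D w))) /\
  \int[P]_w (Psi w * \1_S (D w)) = \int[P]_w (g (D w) * \1_S (D w)).
Proof.
move=> mS SN; have [Pm Pi PE] := cond.
pose ph z := phi z * \1_S z.1.
have mph : measurable_fun setT ph.
  by apply: measurable_funM => //; apply: measurableT_comp => //; exact: measurable_indic.
have ph2 v : P.-integrable setT (fun w => (ph (v, Z w) ^+ 2)%:E) /\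
    \int[P]_w (ph (v, Z w) ^+ 2) <= Num.max 0 (c m).
  rewrite /ph /=; have [Sv|Sv] := pselect (S v).
    rewrite indicE mem_set//; under eq_fun do rewrite mulr1.
    under eq_Rintegral do rewrite mulr1.
    by have [i2 I2] := phi2 (SN _ Sv); split=> //; rewrite le_max I2 orbT.
  rewrite indicE memNset//; under eq_fun do rewrite mulr0 expr0n.
  under eq_Rintegral do rewrite mulr0 expr0n.
  by split; [exact: integrable_cstR|rewrite Rintegral_cstT le_max lexx].
have [_ _ _ iph] := independent_sqr_integral mD mZ DZ mph ph2.
have iphv v : P.-integrable setT (fun w => (ph (v, Z w))%:E).
  have [i2 _] := ph2 v; apply: integrable_of_sqr i2.
  by apply: (measurableT_comp mph); exact: measurable_fun_pair.
have gE v : \int[P]_w ph (v, Z w) = g v * \1_S v.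
  rewrite /ph /=; have [Sv|Sv] := pselect (S v).
    by rewrite indicE mem_set// mulr1; under eq_Rintegral do rewrite mulr1.
  rewrite indicE memNset// mulr0; under eq_Rintegral do rewrite mulr0.
  by rewrite Rintegral_cstT.
split.
  apply: (@integrable_bounded _ _ _ P _ (1 + Num.max 0 (c m))).
    apply: measurable_funM; first exact: measurableT_comp.
    by apply: measurableT_comp mD; exact: measurable_indic.
  move=> w; rewrite -gE; have [i2 I2] := ph2 (D w).
  apply: le_trans (le_normr_Rintegral measurableT (iphv (D w))) _.
  apply: (@le_trans _ _ (\int[P]_w' (1 + ph (D w, Z w') ^+ 2))).
    apply: le_Rintegral => //; first exact: (integrable_norm (iphv _)).
      exact: (integrable_addR (integrable_cstR P 1) i2).
    move=> w' _; rewrite -(real_normK (num_real (ph _))).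
    by have := sqr_ge0 (`|ph (D w, Z w')| - 1); nra.
  by rewrite RintegralD//; [rewrite Rintegral_cstT lerD2l|exact: integrable_cstR].
transitivity (\int[P]_w ph (D w, Z w)); last first.
  rewrite (independent_integral mD mZ DZ mph iph iphv).
  by apply: eq_Rintegral => w _; exact: gE.
have mA : sigma_of D (D @^-1` S) by exists S => //; rewrite setTI.
have := PE _ mA; rewrite integral_mkcond [RHS]integral_mkcond !epatch_indic.
rewrite /Rintegral => ->.
by congr fine; apply: eq_integral => w _.
Qed.

(** Where the inequality fails, a rational lies strictly between the two sides and [N (D w)] is
    below some natural number. For each of these countably many choices the event is a preimage
    under [D] on which the difference is positive yet integrates to zero. The sign [e] serves both
    inequalities. *)
Lemma cond_exp_signed (e : R) : `|e| = 1 -> {ae P, forall w, e * Psi w <= e * g (D w)}.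
Proof.
move=> e1; have [Pm Pi PE] := cond.
(* [unpickle] enumerates the rationals by natural numbers, which [ae_foralln] requires. *)
suff: \forall w \ae P, forall m i : nat, ~ (e * g (D w) < ratr (odflt 0 (unpickle i)) < e * Psi w /\
    N (D w) <= m%:R).
  apply: filterS => w h; rewrite leNgt; apply/negP => lt.
  have [r hr] := rat_in_itvoo lt.
  have [m Nm] : exists m : nat, N (D w) <= m%:R.
    by exists (Num.truncn (Num.max 0 (N (D w)))).+1; rewrite (le_trans _ (ltW (real_truncnS_gt _)))
      ?num_real ?le_max ?lexx ?orbT.
  apply: (h m (pickle r)); split=> //; rewrite pickleK /=.
  by move: hr; rewrite in_itv.
apply: ae_foralln => m; apply: ae_foralln => i.
set r : R := ratr _.
(* A version of the conditional expectation is measurable for the sigma-algebra of [D], so this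
   event is the preimage of some [H]. *)
have [H mH HE] : sigma_of D (Psi @^-1` [set t | r < e * t]).
  by apply: Pm; apply: measurable_set_lt => //; exact: measurable_funM.
pose S := H `&` [set v | e * g v < r /\ N v <= m%:R].
have mS : measurable S.
  apply: measurableI => //.
  apply: (measurableI [set v | e * g v < r] [set v | N v <= m%:R]).
    by apply: measurable_set_lt => //; exact: measurable_funM.
  exact: measurable_set_le.
have SN : S `<=` [set v | N v <= m%:R] by move=> v [_ []].
have [ig Ig] := cond_exp_integral_set mS SN.
have mPsi := cond_exp_measurable.
have m1 : measurable_fun setT (fun w => \1_S (D w) : R).
  by apply: measurableT_comp mD; exact: measurable_indic.
have iP : P.-integrable setT (EFin \o (fun w => Psi w * \1_S (D w))).
  apply: (integrable_ler _ (integrable_norm Pi)); first exact: measurable_funM.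
  by move=> w; rewrite normrM ler_piMr// ger0_norm// indicE// lern1 leq_b1.
have HP w : S (D w) -> e * g (D w) < r < e * Psi w.
  move=> [HDw [h _]]; rewrite h /=.
  by have : (setT `&` D @^-1` H) w by []; rewrite HE.
pose F w := e * (Psi w * \1_S (D w)) + (- e) * (g (D w) * \1_S (D w)).
have iF : P.-integrable setT (EFin \o F).
  by apply: integrable_addR; exact: integrable_scaleR.
have F0 w : 0 <= F w.
  rewrite /F; have [Sw|Sw] := pselect (S (D w)).
    rewrite indicE mem_set// !mulr1 mulNr subr_ge0 ltW//.
    by case/andP: (HP _ Sw); exact: lt_trans.
  by rewrite indicE memNset// !mulr0 addr0.
have : (\int[P]_w `|(F w)%:E| = 0)%E.
  have -> : (fun w => `|(F w)%:E|)%E = EFin \o F.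
    by apply/funext => w /=; rewrite ger0_norm.
  rewrite -EFin_Rintegral// RintegralD//; try exact: integrable_scaleR.
  by rewrite !RintegralZl// Ig mulNr subrr.
move=> /(ae_eq_integral_abs _ measurableT (measurable_int _ iF)).
apply: filterS => w /(_ Logic.I) /= [Fw] [/andP[h1 h2] h3].
have Sw : S (D w).
  split; last by split.
  by have [] : (setT `&` D @^-1` H) w by rewrite HE.
move: Fw; rewrite /F indicE mem_set// !mulr1 mulNr => /eqP.
by rewrite subr_eq0 => /eqP Fw; have := lt_trans h1 h2; rewrite Fw ltxx.
Qed.

Lemma cond_exp_independent : {ae P, forall w, Psi w = \int[P]_w' phi (D w, Z w')}.
Proof.
have h1 := cond_exp_signed (normr1 R).
have h2 : {ae P, forall w, -1 * Psi w <= -1 * g (D w)}.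
  by apply: cond_exp_signed; rewrite normrN1.
apply: filterS2 h1 h2 => w; rewrite !mul1r !mulN1r lerN2 => h1 h2.
by apply/eqP; rewrite eq_le h1.
Qed.

End cond_exp_independent.

Lemma measurable_bigmax d (T : measurableType d) (R : realType) (I : Type) (s : seq I)
    (F : I -> T -> R) : (forall i, measurable_fun setT (F i)) ->
  measurable_fun setT (fun w => \big[Num.max/0]_(i <- s) F i w).
Proof.
move=> mF; elim: s => [|i s IH].
  by under eq_fun do rewrite big_nil; exact: measurable_cst.
by under eq_fun do rewrite big_cons; exact: measurable_maxr.
Qed.

(** * The data set and the probability of the good event *)

Section loo_error.
Context d (T : measurableType d) (R : realType) (P : probability T R) (n q : nat).
Context (x : 'I_n -> T -> 'cV[R]_q) (y : 'I_n -> T -> R) (kappa C4 m2 m4 : R).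
Hypothesis n_gt0 : (0 < n)%N.
Hypothesis q_gt0 : (0 < q)%N.
Hypothesis mx : forall i, measurable_fun setT (x i).
Hypothesis my : forall i, measurable_fun setT (y i).
Hypothesis indep : mutually_independent P (fun i w => (x i w, y i w)).
Hypothesis kappa_gt0 : 0 < kappa.
Hypothesis transport : forall i,
  transport_bound P (fun w => (x i w, y i w)) (fun u v => kappa * dist2 u v).
Hypothesis moment4 : forall i (b : 'cV[R]_q), frob b <= 1 ->
  P.-integrable setT (EFin \o (fun w => ((x i w)^T *m b) 0 0 ^+ 4)) /\
  \int[P]_w (((x i w)^T *m b) 0 0 ^+ 4) <= C4.
Hypothesis moment2y : forall i,
  P.-integrable setT (EFin \o (fun w => y i w ^+ 2)) /\ \int[P]_w (y i w ^+ 2) <= m2.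
Hypothesis moment4y : forall i,
  P.-integrable setT (EFin \o (fun w => y i w ^+ 4)) /\ \int[P]_w (y i w ^+ 4) <= m4.
Let s : R := Num.sqrt n%:R.
Let s_gt0 : 0 < s. Proof. by rewrite sqrtr_gt0 ltr0n. Qed.
Let ss : s ^+ 2 = n%:R. Proof. by rewrite sqr_sqrtr// ler0n. Qed.

Definition data (w : T) : 'rV['cV[R]_q * R]_n := \row_i (x i w, y i w).

Lemma measurable_data : measurable_fun setT data.
Proof.
apply: measurable_fun_mx => a i; under eq_fun do rewrite mxE.
exact: measurable_fun_pair.
Qed.

Lemma data_transport : transport_bound P data (fun u v => kappa * data_dist2 u v).
Proof.
apply: transport_bound_le (transport_bound_row _ indep transport) => //.
  by move=> u v; rewrite data_dist2E mulr_sumr.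
by move=> i; exact: measurable_fun_pair.
Qed.

Lemma data_dist2_ge0 u v : 0 <= kappa * @data_dist2 R n q u v.
Proof. by rewrite mulr_ge0 ?(ltW kappa_gt0)// addr_ge0 ?sqr_ge0. Qed.

(** The mean is at most [(1 + m) * s] by the second moment. A further excess [tau * s], of order
    [sqrt n], has a probability exponentially small in [n], which survives a union over
    exponentially many net points. *)
Lemma lipschitz_tail (F : 'rV['cV[R]_q * R]_n -> R) (m tau : R) :
  measurable_fun setT F -> (forall u, 0 <= F u) ->
  (forall u v, exists2 a, F u <= F v + a & a ^+ 2 <= data_dist2 u v) ->
  P.-integrable setT (EFin \o (fun w => F (data w) ^+ 2)) ->
  \int[P]_w (F (data w) ^+ 2) <= n%:R * m -> 0 <= tau -> 0 <= m ->
  (P [set w | ((1 + m + tau) * s < F (data w))%R] <= (expR (- (kappa * tau ^+ 2 * n%:R)))%:E)%E.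
Proof.
move=> mF F0 FL iF2 F2 t0 m0.
have mFd : measurable_fun setT (fun w => F (data w)).
  exact: measurableT_comp measurable_data.
have le w : F (data w) <= s^-1 * F (data w) ^+ 2 + s.
  have : 0 <= s^-1 * (F (data w) - s) ^+ 2 by rewrite mulr_ge0 ?sqr_ge0 ?invr_ge0 ?ltW.
  have -> : s^-1 * (F (data w) - s) ^+ 2 = s^-1 * F (data w) ^+ 2 - 2 * F (data w) + s.
    field; exact: lt0r_neq0.
  have := F0 (data w); lra.
have iG : P.-integrable setT (EFin \o (fun w => s^-1 * F (data w) ^+ 2 + s)).
  exact: (integrable_addR (integrable_scaleR s^-1 iF2) (integrable_cstR P s)).
have iF : P.-integrable setT (EFin \o (fun w => F (data w))).
  by apply: (integrable_ler mFd iG) => w; rewrite ger0_norm.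
have EF : \int[P]_w F (data w) <= s * (1 + m).
  apply: le_trans (le_Rintegral measurableT iF iG (fun w _ => le w)) _.
  rewrite RintegralD//; last 2 first.
    exact: (integrable_scaleR s^-1 iF2).
    exact: integrable_cstR.
  rewrite Rintegral_cstT RintegralZl// mulrDr mulr1 addrC lerD2l.
  rewrite ler_pdivrMl// mulrA -expr2 ss; exact: F2.
(* This value minimizes the Chernoff exponent [lam ^+ 2 / (4 * kappa) - lam * tau * s]; the minimum
   is [- (kappa * tau ^+ 2 * n)]. *)
pose lam := 2 * kappa * tau * s.
have lam0 : 0 <= lam by rewrite !mulr_ge0// ltW.
pose l := lam ^+ 2 / (4 * kappa).
have l0 : 0 <= l by rewrite divr_ge0 ?sqr_ge0// mulr_ge0// ltW.
have mlF : measurable_fun setT (fun u => lam * F u) by exact: measurable_funM.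
have ilF : P.-integrable setT (fun w => (lam * F (data w))%:E).
  exact: (integrable_scaleR lam iF).
have H := transport_subgaussian measurable_data data_transport data_dist2_ge0
  mlF l0 ilF.
have {H} : (\int[P]_w (expR (lam * F (data w)))%:E <=
    (expR (\int[P]_w (lam * F (data w)) + l))%:E)%E.
  apply: H => u v; have [a Fa a2] := FL u v.
  apply: (@le_trans _ _ (lam * F v + lam * a)); first by rewrite -mulrDr ler_wpM2l.
  rewrite -addrA lerD2l; apply: (@le_trans _ _ (kappa * a ^+ 2 + l)); last first.
    by rewrite lerD2r ler_pM2l.
  have : 0 <= kappa * (a - lam / (2 * kappa)) ^+ 2 by rewrite mulr_ge0 ?sqr_ge0// ltW.
  have -> : kappa * (a - lam / (2 * kappa)) ^+ 2 = kappa * a ^+ 2 - lam * a + l.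
    rewrite /l; field; exact: lt0r_neq0.
  lra.
move=> H; have := chernoff (f := fun w => lam * F (data w)) (lam * ((1 + m + tau) * s)) _ H.
move=> /(_ (measurableT_comp mlF measurable_data)).
have [lam00|lamn0] := eqVneq lam 0.
  have -> : tau = 0.
    move/eqP: lam00; rewrite !mulf_eq0 (gt_eqF s_gt0) orbF (gt_eqF kappa_gt0) orbF.
    by rewrite pnatr_eq0 /= => /eqP.
  by move=> _; rewrite expr0n mulr0 mul0r oppr0 expR0 probability_le1//; exact: measurable_set_lt.
have lam1 : 0 < lam by rewrite lt0r lamn0.
have -> : [set w | (lam * ((1 + m + tau) * s) < lam * F (data w))%R] =
    [set w | ((1 + m + tau) * s < F (data w))%R].
  by apply/seteqP; split => w /=; rewrite ltr_pM2l.
move=> h; apply: le_trans h _; rewrite lee_fin ler_expR RintegralZl//.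
have : lam * \int[P]_w F (data w) <= lam * (s * (1 + m)) by rewrite ler_wpM2l.
have -> : l = kappa * tau ^+ 2 * n%:R.
  rewrite /l /lam -ss; field; exact: lt0r_neq0.
have -> : lam * ((1 + m + tau) * s) = lam * (s * (1 + m)) + 2 * (kappa * tau ^+ 2 * n%:R).
  rewrite /lam -ss; ring.
lra.
Qed.

(** The operator norm is controlled through finitely many net points, so the set is measurable and
    its complement is a finite union of tail events. *)
Definition good_set (B : R) : set 'rV['cV[R]_q * R]_n :=
  [set u | (forall t, t \in net_index q -> frob (net_point R t) <= 1 ->
              frob (feature_matrix u *m net_point R t) <= B * s) /\
           frob (label_vector u) <= B * s].

Lemma good_set_good B u : 0 <= B -> good_set B u ->
  good (4 * B) n (feature_matrix u) (label_vector u).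
Proof.
move=> B0 [h1 h2]; split.
  have -> : 4 * B * Num.sqrt n%:R = 4 * (B * s) by rewrite mulrA.
  by apply: opb_net => //; rewrite mulr_ge0// ltW.
apply: le_trans h2 _; rewrite -/s -mulrA ler_peMl ?mulr_ge0 ?(ltW s_gt0)//.
by rewrite ler1n.
Qed.

(** The norm of [feature_matrix u *m b] is 1-Lipschitz in the data since [frob b <= 1]. Each entry
    has mean square at most one plus its fourth moment, whence the condition on [m]. *)
Lemma feature_tail (b : 'cV[R]_q) (m tau : R) : frob b <= 1 -> 0 <= tau ->
  0 <= m -> 1 + C4 <= m ->
  (P [set w | ((1 + m + tau) * s < frob (feature_matrix (data w) *m b))%R] <=
     (expR (- (kappa * tau ^+ 2 * n%:R)))%:E)%E.
Proof.
move=> b1 t0 m0 C4m.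
have mF : measurable_fun setT
    (fun u : 'rV['cV[R]_q * R]_n => frob (feature_matrix u *m b)).
  apply/measurable_frob_comp/measurable_mulmx => //.
  exact: measurable_feature_matrix.
have i2 i : P.-integrable setT (EFin \o (fun w => ((x i w)^T *m b) 0 0 ^+ 2)) /\
    \int[P]_w (((x i w)^T *m b) 0 0 ^+ 2) <= m.
  have [i4 I4] := moment4 i b1.
  have mt : measurable_fun setT (fun w => ((x i w)^T *m b) 0 0).
    under eq_fun do rewrite mxE.
    apply: measurable_sum => l; apply: measurable_funM => //.
    under eq_fun do rewrite mxE.
    exact: measurableT_comp (measurable_mx_coord l 0) (mx i).
  have i5 : P.-integrable setT (EFin \o (fun w => 1 + ((x i w)^T *m b) 0 0 ^+ 4)).
    exact: (integrable_addR (integrable_cstR P 1) i4).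
  have i6 : P.-integrable setT (EFin \o (fun w => ((x i w)^T *m b) 0 0 ^+ 2)).
    apply: (integrable_ler _ i5); first exact: measurable_funX.
    by move=> w; rewrite ger0_norm ?sqr_ge0 ?sqr_le4.
  split=> //; apply: le_trans C4m.
  apply: le_trans (le_Rintegral measurableT i6 i5 (fun w _ => sqr_le4 _)) _.
  rewrite RintegralD//; last exact: integrable_cstR.
  by rewrite Rintegral_cstT lerD2l.
have E w : frob (feature_matrix (data w) *m b) ^+ 2 = \sum_i ((x i w)^T *m b) 0 0 ^+ 2.
  rewrite frob_sqr; apply: eq_bigr => i _; rewrite big_ord1; congr (_ ^+ 2).
  by rewrite !mxE; apply: eq_bigr => l _; rewrite !mxE.
have [i3 e3] := integrable_sumR (index_enum 'I_n) (fun i => (i2 i).1).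
apply: (lipschitz_tail (F := fun u : 'rV['cV[R]_q * R]_n => frob (feature_matrix u *m b))) => //.
- by move=> u; exact: frob_ge0.
- move=> u v; exists (frob (feature_matrix u - feature_matrix v)); last first.
    by rewrite lerDl sqr_ge0.
  have -> : feature_matrix u *m b =
      feature_matrix v *m b + (feature_matrix u - feature_matrix v) *m b.
    by rewrite mulmxBl addrC subrK.
  apply: le_trans (frobD _ _) _; rewrite lerD2l; apply: le_trans (frob_mul _ _) _.
  by rewrite ler_piMr ?frob_ge0.
- by under eq_fun do rewrite E.
- under eq_Rintegral => w _ do rewrite E.
  rewrite e3 mulr_natl -[n in leRHS]card_ord -sumr_const.
  by apply: ler_sum => i _; exact: (i2 i).2.
Qed.

Lemma label_tail (m tau : R) : 0 <= tau -> 0 <= m -> m2 <= m ->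
  (P [set w | ((1 + m + tau) * s < frob (label_vector (data w)))%R] <=
     (expR (- (kappa * tau ^+ 2 * n%:R)))%:E)%E.
Proof.
move=> t0 m0 m2m.
have mF : measurable_fun setT (fun u => frob (@label_vector R n q u)).
  apply: measurable_frob_comp; exact: measurable_label_vector.
have E w : frob (label_vector (data w)) ^+ 2 = \sum_i y i w ^+ 2.
  by rewrite frob_sqr; apply: eq_bigr => i _; rewrite big_ord1 !mxE.
have [i3 e3] := integrable_sumR (index_enum 'I_n) (fun i => (moment2y i).1).
apply: (lipschitz_tail (F := fun u : 'rV['cV[R]_q * R]_n => frob (label_vector u))) => //.
- by move=> u; exact: frob_ge0.
- move=> u v; exists (frob (label_vector u - label_vector v)); last first.
    by rewrite lerDr sqr_ge0.
  rewrite -lerBlDl; exact: le_trans (ler_norm _) (ler_frob_dist _ _).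
- by under eq_fun do rewrite E.
- under eq_Rintegral => w _ do rewrite E.
  rewrite e3 mulr_natl -[n in leRHS]card_ord -sumr_const.
  by apply: ler_sum => i _; apply: le_trans (moment2y i).2 _.
Qed.

Lemma good_set_compl B : data @^-1` (~` good_set B) =
  [set w | B * s < frob (label_vector (data w))] `|`
  \big[setU/set0]_(t <- [seq t <- enum (net_index q) | frob (net_point R t) <= 1])
    [set w | B * s < frob (feature_matrix (data w) *m net_point R t)].
Proof.
apply/seteqP; split => w /=.
  move=> /not_andP[|]; last by move/negP; rewrite -ltNge; left.
  move=> /existsNP[t /not_implyP[tN /not_implyP[t1 /negP]]]; rewrite -ltNge => lt.
  right; rewrite -bigcup_seq; exists t => //=.
  by rewrite mem_filter t1 mem_enum.
move=> [lt [_]|]; first by rewrite leNgt lt.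
rewrite -bigcup_seq => -[t /=]; rewrite mem_filter mem_enum => /andP[t1 tN] lt [h _].
by have := h t tN t1; rewrite leNgt lt.
Qed.

Lemma good_set_prob (m tau : R) : 0 <= tau -> 0 <= m -> m2 <= m -> 1 + C4 <= m ->
  (P (data @^-1` (~` good_set (1 + m + tau))) <=
   ((8 ^ q).+1%:R * expR (- (kappa * tau ^+ 2 * n%:R)))%:E)%E.
Proof.
move=> t0 m0 m2m C4m; rewrite good_set_compl.
set N := [seq _ <- _ | _]; set e := expR _.
have mlab : measurable_fun setT (fun w => frob (label_vector (data w)) : R).
  apply: measurable_frob_comp.
  exact: measurableT_comp (@measurable_label_vector R n q) measurable_data.
have mfea t : measurable_fun setT (fun w => frob (feature_matrix (data w) *m net_point R t) : R).
  apply/measurable_frob_comp/measurable_mulmx => //.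
  exact: measurableT_comp (@measurable_feature_matrix R n q) measurable_data.
apply: le_trans (measureU2 _ _ _) _; first exact: measurable_set_lt.
  by apply: bigsetU_measurable => t _; exact: measurable_set_lt.
apply: (@le_trans _ _ (e%:E + ((size N)%:R * e)%:E)%E); last first.
  rewrite -EFinD lee_fin -natr1 mulrDl mul1r addrC lerD2r ler_wpM2r ?expR_ge0//.
  rewrite ler_nat (leq_trans _ (card_net_index q))// /N size_filter.
  by rewrite cardE; exact: count_size.
apply: leeD; first exact: label_tail.
apply: measure_finite_union => t; first exact: measurable_set_lt.
by rewrite mem_filter => /andP[t1 _]; exact: feature_tail.
Qed.

Lemma measurable_good_set B : measurable (good_set B).
Proof.
have mle (f : 'rV['cV[R]_q * R]_n -> R) (c : R) : measurable_fun setT f ->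
    measurable [set u | f u <= c].
  by move=> mf; exact: measurable_set_le.
have -> : good_set B =
  \bigcap_(t in [set t | t \in net_index q /\ frob (net_point R t) <= 1])
    [set u | frob (feature_matrix u *m net_point R t) <= B * s] `&`
  [set u | frob (label_vector u) <= B * s].
  apply/seteqP; split => u [h1 h2]; split => // t; first by move=> [? ?]; exact: h1.
  by move=> ? ?; exact: h1.
apply: measurableI; last first.
  apply: mle; apply: measurable_frob_comp; exact: measurable_label_vector.
apply: fin_bigcap_measurable; first exact: finite_finset.
move=> t _; apply: mle; apply: measurable_frob_comp; apply: measurable_mulmx => //.
exact: measurable_feature_matrix.
Qed.

(** * The error of the leave-one-out risk and its centred approximation *)

Context (x0 : T -> 'cV[R]_q) (y0 : T -> R).
Hypothesis mx0 : measurable_fun setT x0.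
Hypothesis my0 : measurable_fun setT y0.
Hypothesis law0 : forall i, same_law P (fun w => (x0 w, y0 w)) (fun w => (x i w, y i w)).

Context (psi : R * R -> R) (C_psi Cbar_psi : R).
Hypothesis hpsi : forall u, differentiable psi u.
Hypothesis hC : 0 <= C_psi.
Hypothesis hCbar : 0 <= Cbar_psi.
Hypothesis hgrad :
  forall u, l2norm2 (grad2 psi u) <= C_psi * l2norm2 u + Cbar_psi.

Context (Delta B0 : R) (K : nat) (delta : nat -> R) (b0 : 'cV[R]_q).
Hypothesis delta_ge0 : forall k, (k < K)%N -> 0 <= delta k.
Hypothesis sum_delta : \sum_(0 <= k < K) delta k <= Delta.
Hypothesis b0B : frob b0 <= B0.

Let U := ('cV[R]_q * R)%type.
Let i0 : 'I_n := Ordinal n_gt0.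

Let mxy i : measurable_fun setT (fun w => (x i w, y i w)).
Proof. exact: measurable_fun_pair. Qed.

Let mxy0 : measurable_fun setT (fun w => (x0 w, y0 w)).
Proof. exact: measurable_fun_pair. Qed.

Let mloss (b : 'cV[R]_q) : measurable_fun setT (fun z : U => loss psi z.2 z.1 b).
Proof.
apply: (measurableT_comp (measurable_psi hpsi)); apply: measurable_fun_pair => //.
apply: (measurableT_comp (measurable_mx_coord 0 0)).
by apply: measurable_mulmx => //; exact: measurable_trmx.
Qed.

Lemma pop_riskE i b : pop_risk P psi x0 y0 b = pop_risk P psi (x i) (y i) b.
Proof.
have M0 : 0 < frob b + 1 by rewrite ltr_wpDl ?frob_ge0.
have bM : frob b <= frob b + 1 by rewrite lerDl.
have [i1 _ _] := loss_integrable hpsi hC hCbar hgrad (mx i) (my i) (moment4 i) (moment4y i) M0 bM.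
exact: (same_law_integral mxy0 (mxy i) (law0 i) (mloss b) i1).
Qed.

Lemma measurable_pop_risk : measurable_fun setT (pop_risk P psi x0 y0).
Proof.
have mphi : measurable_fun setT (fun z : 'cV[R]_q * U => loss psi z.2.2 z.2.1 z.1).
  apply: (measurableT_comp (measurable_psi hpsi)); apply: measurable_fun_pair => //.
    exact: measurableT_comp measurable_snd measurable_snd.
  apply: (measurableT_comp (measurable_mx_coord 0 0)).
  apply: measurable_mulmx => //; apply: measurable_trmx.
  exact: measurableT_comp measurable_fst measurable_snd.
exact: (measurable_partial_integral P mxy0 mphi).
Qed.

Section fixed_step.
Context (A : R) (k : nat).
Hypothesis A_ge0 : 0 <= A.
Hypothesis kK : (k <= K)%N.

(** The extra 1 makes the radius strictly positive, as the moment bounds require. *)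
Definition iter_radius : R := iter_bound A Delta B0 + 1.

Let M := iter_radius.

Let iter_bound_ge0 : 0 <= iter_bound A Delta B0.
Proof. by apply: (iter_bound_ge0 A delta_ge0 sum_delta b0B). Qed.

Let M_gt0 : 0 < M. Proof. by rewrite /M /iter_radius ltr_wpDl. Qed.

Lemma loss_moment_ge0 : 0 <= loss_moment psi C_psi Cbar_psi C4 m4 M.
Proof.
have bM : frob (0 : 'cV[R]_q) <= M by rewrite frob0 ltW.
have [_ _] := loss_integrable hpsi hC hCbar hgrad (mx i0) (my i0) (moment4 i0) (moment4y i0) M_gt0 bM.
by apply: le_trans; apply: Rintegral_ge0 => w _; exact: sqr_ge0.
Qed.

Definition excess_moment : R :=
  2 * loss_moment psi C_psi Cbar_psi C4 m4 M
  + 2 * (1 + loss_moment psi C_psi Cbar_psi C4 m4 M) ^+ 2.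

Definition descent m (u : 'rV[U]_m) : 'cV[R]_q :=
  gd n (feature_matrix u) (label_vector u) delta b0 k.

Lemma measurable_descent m : measurable_fun setT (@descent m).
Proof.
apply: measurable_gd; [exact: measurable_feature_matrix|exact: measurable_label_vector].
Qed.

(* Centred loss at an independent sample, cut off where the iterate is large. *)
Definition excess (z : 'rV[U]_n.-1 * U) : R :=
  (loss psi z.2.2 z.2.1 (descent z.1) - pop_risk P psi x0 y0 (descent z.1))
  * \1_[set r : 'rV[U]_n.-1 | frob (descent r) <= M] z.1.

Let mball : measurable [set r : 'rV[U]_n.-1 | frob (descent r) <= M].
Proof.
apply: measurable_set_le => //.
apply: measurable_frob_comp => //; exact: measurable_descent.
Qed.

Lemma measurable_excess : measurable_fun setT excess.
Proof.
have md : measurable_fun setT (fun z : 'rV[U]_n.-1 * U => descent z.1).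
  exact: measurableT_comp (@measurable_descent _) measurable_fst.
apply: measurable_funM; last first.
  by apply: measurableT_comp measurable_fst; exact: measurable_indic.
apply: measurable_funB; last exact: measurableT_comp measurable_pop_risk md.
apply: (measurableT_comp (measurable_psi hpsi)); apply: measurable_fun_pair => //.
  exact: measurableT_comp measurable_snd measurable_snd.
apply: (measurableT_comp (measurable_mx_coord 0 0)).
apply: measurable_mulmx => //; apply: measurable_trmx.
exact: measurableT_comp measurable_fst measurable_snd.
Qed.

(** With the iterate frozen, the sample is a draw from the law of the test point, so the centring is
    exact; the cut-off makes the second moment uniform in [r]. *)
Lemma excess_fixed i r :
  [/\ P.-integrable setT (fun w => (excess (r, (x i w, y i w)))%:E),
      \int[P]_w excess (r, (x i w, y i w)) = 0,
      P.-integrable setT (fun w => (excess (r, (x i w, y i w)) ^+ 2)%:E) &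
      \int[P]_w (excess (r, (x i w, y i w)) ^+ 2) <= excess_moment].
Proof.
have LM0 := loss_moment_ge0.
have Q0 : 0 <= excess_moment.
  by rewrite /excess_moment addr_ge0// mulr_ge0// sqr_ge0.
rewrite /excess /=; set b := descent r.
have [bM|bM] := pselect (frob b <= M); last first.
  have ind : \1_[set r : 'rV[U]_n.-1 | frob (descent r) <= M] r = 0 :> R.
    by rewrite indicE memNset.
  split.
  - by under eq_fun do rewrite ind mulr0; exact: integrable_cstR.
  - by under eq_Rintegral do rewrite ind mulr0; rewrite Rintegral_cstT.
  - by under eq_fun do rewrite ind mulr0 expr0n; exact: integrable_cstR.
  - by under eq_Rintegral do rewrite ind mulr0 expr0n; rewrite Rintegral_cstT.
have ind : \1_[set r : 'rV[U]_n.-1 | frob (descent r) <= M] r = 1 :> R.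
  by rewrite indicE mem_set.
have [i1 i2 I2] := loss_integrable hpsi hC hCbar hgrad (mx i) (my i) (moment4 i) (moment4y i) M_gt0 bM.
have rb := pop_risk_bound hpsi hC hCbar hgrad (mx i) (my i) (moment4 i) (moment4y i) M_gt0 bM.
have i3 : P.-integrable setT (EFin \o (fun w => loss psi (y i w) (x i w) b
    - pop_risk P psi (x i) (y i) b)).
  exact: (integrable_addR i1 (integrable_cstR P (- pop_risk P psi (x i) (y i) b))).
have ml : measurable_fun setT (fun w => loss psi (y i w) (x i w) b
    - pop_risk P psi (x i) (y i) b).
  by apply/measurable_EFinP; apply: measurable_int i3.
have ig := integrable_addR (integrable_scaleR 2 i2)
  (integrable_cstR P (2 * (1 + loss_moment psi C_psi Cbar_psi C4 m4 M) ^+ 2)).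
have le w : (loss psi (y i w) (x i w) b - pop_risk P psi (x i) (y i) b) ^+ 2 <=
    2 * loss psi (y i w) (x i w) b ^+ 2
    + 2 * (1 + loss_moment psi C_psi Cbar_psi C4 m4 M) ^+ 2.
  have : pop_risk P psi (x i) (y i) b ^+ 2 <=
      (1 + loss_moment psi C_psi Cbar_psi C4 m4 M) ^+ 2.
    rewrite -real_normK ?num_real// ler_sqr ?nnegrE// addr_ge0//.
  have := sqr_ge0 (loss psi (y i w) (x i w) b + pop_risk P psi (x i) (y i) b).
  nra.
have i4 : P.-integrable setT (EFin \o (fun w => (loss psi (y i w) (x i w) b
    - pop_risk P psi (x i) (y i) b) ^+ 2)).
  apply: (integrable_ler _ ig); first exact: measurable_funX.
  by move=> w; rewrite ger0_norm ?sqr_ge0.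
split.
- by under eq_fun do rewrite ind mulr1 (pop_riskE i).
- under eq_Rintegral do rewrite ind mulr1 (pop_riskE i).
  by rewrite RintegralB// ?Rintegral_cstT ?subrr//; exact: integrable_cstR.
- by under eq_fun do rewrite ind mulr1 (pop_riskE i).
- under eq_Rintegral do rewrite ind mulr1 (pop_riskE i).
  apply: le_trans (le_Rintegral measurableT i4 ig (fun w _ => le w)) _.
  rewrite RintegralD//; [|exact: integrable_scaleR|exact: integrable_cstR].
  by rewrite Rintegral_cstT RintegralZl// lerD2r ler_pM2l.
Qed.

Let Z i w : U := (x i w, y i w).

Definition loo_excess i w : R := excess (rest Z i w, Z i w).

(** The iterate without sample [i] is a function of the other samples, hence independent of sample
    [i]; integrating over the latter first gives mean zero. *)
Lemma loo_excess_integral i :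
  [/\ P.-integrable setT (EFin \o loo_excess i), \int[P]_w loo_excess i w = 0,
      P.-integrable setT (EFin \o (fun w => loo_excess i w ^+ 2)) &
      \int[P]_w (loo_excess i w ^+ 2) <= excess_moment].
Proof.
have mZ j : measurable_fun setT (Z j) by exact: mxy.
have mR : measurable_fun setT (rest Z i) by exact: measurable_rest.
have ind := independent_of_sym (independent_rest mZ indep i).
have [ml i2 I2 i1] := independent_sqr_integral mR (mZ i) ind measurable_excess
  (fun r => let: And4 _ _ i2 I2 := excess_fixed i r in conj i2 I2).
split=> //.
rewrite (independent_integral mR (mZ i) ind measurable_excess) => //.
  by under eq_Rintegral => w _ do
    (have [_ -> _ _] := excess_fixed i (rest Z i w)); rewrite Rintegral_cstT.
by move=> r; have [] := excess_fixed i r.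
Qed.

Lemma test_risk_bound b : frob b <= M ->
  `|pop_risk P psi x0 y0 b| <= 1 + loss_moment psi C_psi Cbar_psi C4 m4 M.
Proof.
move=> bM; rewrite (pop_riskE i0).
exact: (pop_risk_bound hpsi hC hCbar hgrad (mx i0) (my i0) (moment4 i0) (moment4y i0) M_gt0 bM).
Qed.

Lemma test_risk_lip b b' : frob b <= M -> frob b' <= M ->
  `|pop_risk P psi x0 y0 b - pop_risk P psi x0 y0 b'| <=
  pop_lip C_psi Cbar_psi C4 m4 M * frob (b - b').
Proof.
move=> bM bM'; rewrite !(pop_riskE i0).
exact: (pop_risk_lip hpsi hC hCbar hgrad (mx i0) (my i0) (moment4 i0) (moment4y i0) M_gt0 bM bM').
Qed.

Definition risk_gap (u : 'rV[U]_n) : R :=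
  loo_risk psi (fun i => (u 0 i).1) (fun i => (u 0 i).2) delta b0 k
  - pop_risk P psi x0 y0 (descent u).

Lemma measurable_risk_gap : measurable_fun setT risk_gap.
Proof.
apply: measurable_funB; last first.
  exact: measurableT_comp measurable_pop_risk (@measurable_descent n).
apply: measurable_funM => //; apply: measurable_sum => i.
have mi : measurable_fun setT (fun u : 'rV[U]_n => u 0 i) by exact: measurable_mx_coord.
have mrow m (g : 'rV[U]_n -> 'M[R]_(n, m)) : measurable_fun setT g ->
    measurable_fun setT (fun u => row' i (g u)).
  move=> mg; apply: measurable_fun_mx => a b; under eq_fun do rewrite mxE.
  exact: measurableT_comp (measurable_mx_coord (lift i a) b) mg.
apply: (measurableT_comp (measurable_psi hpsi)); apply: measurable_fun_pair.
  exact: measurableT_comp measurable_snd mi.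
apply: (measurableT_comp (measurable_mx_coord 0 0)).
apply: measurable_mulmx.
  apply: measurable_trmx; exact: measurableT_comp measurable_fst mi.
apply: measurable_gd; apply: mrow.
  exact: measurable_feature_matrix.
exact: measurable_label_vector.
Qed.

(** * Concentration of the error on the good event *)

Section good_data.
Context (B : R).
Hypothesis B_ge0 : 0 <= B.
Hypothesis AB : A = 4 * B.

Let G : set 'rV[U]_n := good_set B.

Let gG u : G u -> good A n (feature_matrix u) (label_vector u).
Proof. by move=> Gu; rewrite AB; exact: good_set_good. Qed.

Let descentM u : G u -> frob (descent u) <= M.
Proof.
move=> Gu; apply: (@le_trans _ _ (iter_bound A Delta B0)); last by rewrite lerDl.
exact: (gd_iter_bound delta_ge0 sum_delta n_gt0 b0B (gG Gu) kK).
Qed.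

Definition gap_max : R := risk_bound psi C_psi Cbar_psi A Delta B0
  + (1 + loss_moment psi C_psi Cbar_psi C4 m4 M).

Lemma risk_gap_bound u : G u -> `|risk_gap u| <= gap_max.
Proof.
move=> Gu; apply: le_trans (ler_normB _ _) _; apply: lerD.
  exact: (loo_risk_bound hpsi hC hCbar hgrad A_ge0 delta_ge0 sum_delta n_gt0 b0B (gG Gu) kK).
exact: test_risk_bound (descentM Gu).
Qed.

Definition gap_slope : R := risk_lip C_psi Cbar_psi A Delta B0
  + pop_lip C_psi Cbar_psi C4 m4 M * iter_lip A Delta B0.

Lemma pop_lip_ge0 : 0 <= pop_lip C_psi Cbar_psi C4 m4 M.
Proof.
have C40 : 0 <= C4.
  have o1 : frob (0 : 'cV[R]_q) <= 1 by rewrite frob0.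
  by have [_] := moment4 i0 o1; apply: le_trans; apply: Rintegral_ge0 => w _; exact: exprn_even_ge0.
have m40 : 0 <= m4.
  by have [_] := moment4y i0; apply: le_trans; apply: Rintegral_ge0 => w _; exact: exprn_even_ge0.
have M4 : 0 <= M ^+ 4 * C4 by rewrite mulr_ge0 ?exprn_ge0// ltW.
by rewrite mulr_ge0 ?addr_ge0// ?mulr_ge0// ?addr_ge0// mulr_ge0.
Qed.

Lemma risk_gap_lip u v : G u -> G v ->
  `|risk_gap u - risk_gap v| <= gap_slope * (Num.sqrt (data_dist2 u v) / s).
Proof.
move=> Gu Gv; rewrite /risk_gap subrBB; apply: le_trans (ler_normB _ _) _.
have dX : frob (feature_matrix u - feature_matrix v) <= Num.sqrt (data_dist2 u v).
  by rewrite -[leLHS]ger0_norm ?frob_ge0// -sqrtr_sqr ler_wsqrtr// lerDl sqr_ge0.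
have dY : frob (label_vector u - label_vector v) <= Num.sqrt (data_dist2 u v).
  by rewrite -[leLHS]ger0_norm ?frob_ge0// -sqrtr_sqr ler_wsqrtr// lerDr sqr_ge0.
rewrite /gap_slope mulrDl; apply: lerD.
  exact: (loo_risk_lip hpsi hC hCbar hgrad A_ge0 delta_ge0 sum_delta n_gt0 b0B (gG Gu) (gG Gv) dX dY kK).
apply: le_trans (test_risk_lip (descentM Gu) (descentM Gv)) _.
rewrite -mulrA ler_wpM2l ?pop_lip_ge0//.
exact: (gd_iter_lip A_ge0 delta_ge0 sum_delta n_gt0 b0B (gG Gu) (gG Gv) dX dY kK).
Qed.

Let xw w i := x i w.
Let yw w i := y i w.

Let dataE w : (fun i => (data w 0 i).1) = xw w /\ (fun i => (data w 0 i).2) = yw w.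
Proof. by split; apply/funext => i; rewrite mxE. Qed.

Lemma descent_rest i w : descent (rest Z i w) = gd_loo (xw w) (yw w) delta b0 k i.
Proof.
rewrite /descent /gd_loo; congr (gd _ _ _ _ _ _).
  by apply/matrixP => a b; rewrite !mxE.
by apply/matrixP => a b; rewrite !mxE.
Qed.

Definition bias_bound : R := pop_lip C_psi Cbar_psi C4 m4 M * gap_bound A Delta B0.

(** The empirical losses cancel. What remains is the average difference of population risks between
    leave-one-out and full iterates, and Cauchy-Schwarz bounds the average gap norm by the Frobenius
    norm of the gap matrix over [s]. *)
Lemma risk_gap_decomp w : G (data w) ->
  `|risk_gap (data w) - n%:R^-1 * \sum_i loo_excess i w| <= bias_bound / s.
Proof.
move=> Gw; have [E1 E2] := dataE w.
have g := gG Gw; rewrite /feature_matrix /label_vector E1 E2 in g.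
have looM i : frob (gd_loo (xw w) (yw w) delta b0 k i) <= M.
  apply: (@le_trans _ _ (iter_bound A Delta B0)); last by rewrite lerDl.
  exact: (gd_loo_bound delta_ge0 sum_delta n_gt0 b0B g i kK).
have dE : descent (data w) = gd_iter (xw w) (yw w) delta b0 k.
  by rewrite /descent /feature_matrix /label_vector E1 E2.
have exE i : loo_excess i w = loss psi (yw w i) (xw w i) (gd_loo (xw w) (yw w) delta b0 k i)
    - pop_risk P psi x0 y0 (gd_loo (xw w) (yw w) delta b0 k i).
  rewrite /loo_excess /excess /= descent_rest indicE mem_set ?mulr1//=.
  by rewrite descent_rest; exact: looM.
rewrite /risk_gap E1 E2 dE /loo_risk.
set b := gd_iter _ _ _ _ _.
have -> : \sum_i loo_excess i w =
   \sum_i loss psi (yw w i) (xw w i) (gd_loo (xw w) (yw w) delta b0 k i)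
   - \sum_i pop_risk P psi x0 y0 (gd_loo (xw w) (yw w) delta b0 k i).
  by rewrite -sumrB; apply: eq_bigr => i _; rewrite exE.
have -> : forall p q r : R, n%:R^-1 * p - r - n%:R^-1 * (p - q) =
    n%:R^-1 * (q - n%:R * r).
  by move=> p' q' r'; field; rewrite pnatr_eq0 -lt0n.
have -> : n%:R * pop_risk P psi x0 y0 b = \sum_(i < n) pop_risk P psi x0 y0 b.
  by rewrite sumr_const card_ord mulr_natl.
rewrite -sumrB normrM normfV normr_nat ler_pdivrMl ?ltr0n//.
apply: le_trans (ler_norm_sum _ _ _) _.
have bM : frob b <= M by rewrite /b -dE; exact: descentM.
apply: (@le_trans _ _ (pop_lip C_psi Cbar_psi C4 m4 M *
   \sum_i 1 * frob (col i (loo_gap (xw w) (yw w) delta b0 k)))).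
  rewrite mulr_sumr; apply: ler_sum => i _; rewrite mul1r.
  apply: le_trans (test_risk_lip (looM i) bM) _.
  rewrite ler_wpM2l ?pop_lip_ge0// frob_distC.
  by rewrite (_ : b - _ = col i (loo_gap (xw w) (yw w) delta b0 k))//;
    apply/colP => a; rewrite !mxE.
have -> : n%:R * (bias_bound / s) = pop_lip C_psi Cbar_psi C4 m4 M * (s * gap_bound A Delta B0).
  rewrite -ss /bias_bound; field; exact: lt0r_neq0.
rewrite ler_wpM2l ?pop_lip_ge0//; apply: le_trans (cauchy_schwarz _ _) _.
have -> : \sum_(i < n) (1 : R) ^+ 2 = n%:R.
  by rewrite (eq_bigr (fun=> 1)) ?sumr_const ?card_ord// => i _; rewrite expr1n.
rewrite ler_wpM2l ?sqrtr_ge0//.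
have -> : \sum_i frob (col i (loo_gap (xw w) (yw w) delta b0 k)) ^+ 2 =
    frob (loo_gap (xw w) (yw w) delta b0 k) ^+ 2.
  by rewrite frob_sqr_sum_col; apply: eq_bigr => i _; rewrite l2normE.
rewrite sqrtr_sqr ger0_norm ?frob_ge0//.
exact: (loo_gap_bound delta_ge0 sum_delta n_gt0 b0B g kK).
Qed.

Let mG : measurable G. Proof. exact: measurable_good_set. Qed.

Definition bad_mass : R := \int[P]_w \1_(~` G) (data w).

Let mind (H : set 'rV[U]_n) : measurable H ->
  measurable_fun setT (fun w => \1_H (data w) : R).
Proof. by move=> mH; apply: measurableT_comp measurable_data; exact: measurable_indic. Qed.

Let mgap : measurable_fun setT (fun w => risk_gap (data w)).
Proof. exact: measurableT_comp measurable_risk_gap measurable_data. Qed.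

Let iind (H : set 'rV[U]_n) : measurable H ->
  P.-integrable setT (EFin \o (fun w => \1_H (data w) : R)).
Proof.
move=> mH; apply: (@integrable_bounded _ _ _ P (fun w => \1_H (data w)) 1); first exact: mind.
by move=> w; rewrite indicE ger0_norm// lern1 leq_b1.
Qed.

Lemma gap_max_ge0 : 0 <= gap_max.
Proof.
rewrite addr_ge0//; last by rewrite addr_ge0// loss_moment_ge0.
have D0 : 0 <= Delta := le_trans (sum_delta_ge0 delta_ge0 (leqnn K)) sum_delta.
have g0 : 0 <= gap_bound A Delta B0.
  by rewrite mulr_ge0 ?expR_ge0// mulr_ge0// mulr_ge0 ?sqr_ge0// addr_ge0.
have h : 0 <= A * (1 + iter_bound A Delta B0 + gap_bound A Delta B0).
  by rewrite mulr_ge0// addr_ge0// addr_ge0.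
by rewrite addr_ge0// mulr_ge0// mulr_ge0 ?addr_ge0.
Qed.

Let igap : P.-integrable setT (EFin \o (fun w => risk_gap (data w) * \1_G (data w))).
Proof.
apply: (@integrable_bounded _ _ _ P (fun w => risk_gap (data w) * \1_G (data w)) gap_max).
  apply: measurable_funM => //; exact: mind.
move=> w; have [Gw|Gw] := pselect (G (data w)).
  by rewrite indicE mem_set// mulr1 risk_gap_bound.
by rewrite indicE memNset// mulr0 normr0 gap_max_ge0.
Qed.

(** The approximating average has mean zero over the whole space, not over the good event. Adding
    [s^-1] times the squares makes every summand at least [- s], so the bad event costs at most [s]
    times its probability, while the squares cost [excess_moment / s] in mean. *)
Lemma risk_gap_mean (e : R) : `|e| = 1 ->
  \int[P]_w (e * (risk_gap (data w) * \1_G (data w))) <=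
  (excess_moment + bias_bound) / s + s * bad_mass.
Proof.
move=> e1.
pose h w := n%:R^-1 * (\sum_i (e * loo_excess i w + s^-1 * loo_excess i w ^+ 2))
  + (s * \1_(~` G) (data w) + bias_bound / s).
have ie i : P.-integrable setT (EFin \o (fun w => e * loo_excess i w + s^-1 * loo_excess i w ^+ 2)).
  have [i1 _ i2 _] := loo_excess_integral i.
  exact: integrable_addR (integrable_scaleR _ i1) (integrable_scaleR _ i2).
have [is_ es] := integrable_sumR (index_enum 'I_n) ie.
have iC : P.-integrable setT (EFin \o (fun w => s * \1_(~` G) (data w) + bias_bound / s)).
  apply: integrable_addR (integrable_cstR _ _); apply: integrable_scaleR.
  by apply: iind; exact: measurableC.
have ih : P.-integrable setT (EFin \o h).
  exact: integrable_addR (integrable_scaleR _ is_) iC.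
have le w : e * (risk_gap (data w) * \1_G (data w)) <= h w.
  have si : 0 <= s^-1 by rewrite invr_ge0 ltW.
  have ni : 0 <= n%:R^-1 :> R by rewrite invr_ge0.
  have b0' : 0 <= bias_bound / s.
    have D0 : 0 <= Delta := le_trans (sum_delta_ge0 delta_ge0 (leqnn K)) sum_delta.
    rewrite divr_ge0 ?(ltW s_gt0)// mulr_ge0 ?pop_lip_ge0//.
    by rewrite mulr_ge0 ?expR_ge0// mulr_ge0// mulr_ge0 ?sqr_ge0// addr_ge0.
  have [Gw|Gw] := pselect (G (data w)).
    rewrite /h !indicE mem_set// memNset/=; last by move=> /(_ Gw).
    rewrite mulr1 mulr0 add0r.
    have := risk_gap_decomp Gw; set S := n%:R^-1 * _ => dec.
    have h1 : e * risk_gap (data w) <= e * S + bias_bound / s.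
      rewrite -lerBlDl -mulrBr; apply: le_trans (ler_norm _) _.
      by rewrite normrM e1 mul1r.
    apply: le_trans h1 _; rewrite lerD2r big_split /= mulrDr -mulr_sumr mulrCA lerDl.
    by rewrite mulr_ge0// sumr_ge0// => i _; rewrite mulr_ge0 ?sqr_ge0.
  rewrite /h !indicE memNset// mem_set//= !mulr0 mulr1.
  have : 0 <= n%:R^-1 * \sum_i (e * loo_excess i w + s^-1 * loo_excess i w ^+ 2) + s.
    (* From [s^-1 * (t - s) ^+ 2 >= 0], with [t] the absolute value of the excess. *)
    have hi i : - s <= e * loo_excess i w + s^-1 * loo_excess i w ^+ 2.
      have : `|e * loo_excess i w| = `|loo_excess i w| by rewrite normrM e1 mul1r.
      have := ler_norm (- (e * loo_excess i w)); rewrite normrN => h1 h2.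
      have : 0 <= s^-1 * (`|loo_excess i w| - s) ^+ 2 by rewrite mulr_ge0 ?sqr_ge0.
      rewrite sqrrB real_normK ?num_real// mulrDr mulrBr.
      have -> : s^-1 * s ^+ 2 = s by field; exact: lt0r_neq0.
      have -> : s^-1 * (`|loo_excess i w| * s *+ 2) = 2 * `|loo_excess i w|.
        by rewrite -mulr_natl; field; exact: lt0r_neq0.
      have := normr_ge0 (loo_excess i w); lra.
    have : \sum_(i < n) - s <= \sum_i (e * loo_excess i w + s^-1 * loo_excess i w ^+ 2).
      exact: ler_sum.
    rewrite sumr_const card_ord => hS; have := ler_wpM2l ni hS.
    have -> : n%:R^-1 * (- s *+ n) = - s.
      by rewrite -[- s *+ n]mulr_natl mulrA mulVf ?mul1r// pnatr_eq0 -lt0n.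
    by move=> hS2; rewrite -lerBlDr sub0r.
  move=> hs; lra.
apply: le_trans (le_Rintegral measurableT _ ih (fun w _ => le w)) _.
  exact: integrable_scaleR.
rewrite /h RintegralD//; last exact: integrable_scaleR.
rewrite RintegralZl// es RintegralD//; last 2 first.
- by apply: integrable_scaleR; apply: iind; exact: measurableC.
- exact: integrable_cstR.
rewrite Rintegral_cstT RintegralZl//; last by apply: iind; exact: measurableC.
have hi i : \int[P]_w (e * loo_excess i w + s^-1 * loo_excess i w ^+ 2) <= excess_moment / s.
  have [i1 I1 i2 I2] := loo_excess_integral i.
  rewrite RintegralD//; [|exact: integrable_scaleR|exact: integrable_scaleR].
  rewrite !RintegralZl// I1 mulr0 add0r mulrC ler_wpM2r// invr_ge0 ltW//.
have : n%:R^-1 * \sum_i \int[P]_w (e * loo_excess i w + s^-1 * loo_excess i w ^+ 2)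
    <= excess_moment / s.
  rewrite ler_pdivrMl ?ltr0n//; apply: le_trans (ler_sum _ (fun i _ => hi i)) _.
  by rewrite sumr_const card_ord mulr_natl.
rewrite -/bad_mass (mulrDl excess_moment bias_bound); lra.
Qed.

(** No term depends on [n]: [excess_moment + bias_bound + 2] bounds [s] times the mean,
    [2 * gap_max] is the cost of the bad event, and the last term is the constant from completing
    the square with slope [gap_slope]. *)
Definition gap_exponent : R := excess_moment + bias_bound + 2 + 2 * gap_max
  + gap_slope ^+ 2 / (4 * kappa).

(** The error has Lipschitz constant [gap_slope / s] on the good event, so even after multiplication
    by [s] its exponential moment stays bounded in [n]. *)
Lemma risk_gap_exp (e : R) : `|e| = 1 -> n%:R * bad_mass <= 2 ->
  \int[P]_w (expR (s * e * risk_gap (data w)) * \1_G (data w)) <= expR gap_exponent.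
Proof.
move=> e1 bad.
pose F u := s * e * risk_gap u.
have mF : measurable_fun setT F by apply: measurable_funM => //; exact: measurable_risk_gap.
pose l := gap_slope ^+ 2 / (4 * kappa).
have l0 : 0 <= l by rewrite divr_ge0 ?sqr_ge0// mulr_ge0// ltW.
have gm0 := gap_max_ge0.
have FB u : G u -> `|F u| <= s * gap_max.
  move=> Gu; rewrite /F !normrM e1 mulr1 (gtr0_norm s_gt0) ler_pM2l//.
  exact: risk_gap_bound.
have sgm0 : 0 <= s * gap_max by rewrite mulr_ge0// ltW.
have FL u v : G u -> G v -> F u <= F v + kappa * data_dist2 u v + l.
  move=> Gu Gv; set r := Num.sqrt (data_dist2 u v).
  have dd0 : 0 <= data_dist2 u v by rewrite addr_ge0 ?sqr_ge0.
  have r2 : data_dist2 u v = r ^+ 2 by rewrite sqr_sqrtr.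
  have h1 : F u - F v <= gap_slope * r.
    rewrite /F -mulrBr -mulrA; apply: le_trans (ler_norm _) _.
    rewrite !normrM e1 mul1r (gtr0_norm s_gt0).
    apply: le_trans (ler_wpM2l (ltW s_gt0) (risk_gap_lip Gu Gv)) _.
    by rewrite -/r mulrCA (mulrCA s) mulfV ?gt_eqF// mulr1.
  have : 0 <= kappa * (r - gap_slope / (2 * kappa)) ^+ 2 by rewrite mulr_ge0 ?sqr_ge0// ltW.
  have -> : kappa * (r - gap_slope / (2 * kappa)) ^+ 2 = kappa * r ^+ 2 - gap_slope * r + l.
    rewrite /l; field; exact: lt0r_neq0.
  rewrite r2; lra.
have H := transport_concentration measurable_data data_transport
  data_dist2_ge0 mG mF l0 FB sgm0 FL.
apply: le_trans H _; rewrite ler_expR.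
have iB : P.-integrable setT (EFin \o (fun w => \1_(~` G) (data w) : R)).
  by apply: iind; exact: measurableC.
have iFG : P.-integrable setT (EFin \o (fun w => F (data w) * \1_G (data w))).
  have := integrable_scaleR (s * e) igap.
  by apply: eq_integrable => // w _ /=; rewrite /F mulrA.
have iFB := integrable_addR iFG (integrable_scaleR (s * gap_max) iB).
rewrite RintegralD//; last exact: integrable_cstR.
rewrite RintegralD//; last exact: integrable_scaleR.
rewrite Rintegral_cstT RintegralZl// -/bad_mass.
have -> : \int[P]_w (F (data w) * \1_G (data w)) =
    s * \int[P]_w (e * (risk_gap (data w) * \1_G (data w))).
  rewrite -RintegralZl//; last exact: integrable_scaleR.
  by apply: eq_Rintegral => w _; rewrite /F !mulrA.
have h1 := ler_wpM2l (ltW s_gt0) (risk_gap_mean e1).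
have bad0 : 0 <= bad_mass by apply: Rintegral_ge0 => w _.
have s1 : 1 <= s.
  rewrite -(@ler_pXn2r _ 2)// ?nnegrE ?(ltW s_gt0)// ss expr1n ler1n.
  by [].
have h2 : s * ((excess_moment + bias_bound) / s + s * bad_mass) <=
    excess_moment + bias_bound + 2.
  rewrite mulrDr mulrCA mulfV ?gt_eqF// mulr1 mulrA -expr2 ss; lra.
(* Since [1 <= s], the factor [s] is at most [n], and [n * bad_mass <= 2]. *)
have h3 : s * gap_max * bad_mass <= 2 * gap_max.
  rewrite mulrAC ler_wpM2r//; apply: le_trans bad; rewrite -ss expr2 ler_wpM2r//.
  by rewrite ler_peMr// ltW.
rewrite /gap_exponent -/l; lra.
Qed.

(** Markov's inequality for the exponential restricted to the good event, applied with both signs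
    [e]. *)
Lemma risk_gap_tail (eps : R) : n%:R * bad_mass <= 2 ->
  (P [set w | G (data w) /\ (eps < `|risk_gap (data w)|)%R] <=
   (2 * expR (gap_exponent - s * eps))%:E)%E.
Proof.
move=> bad.
have one (e : R) : `|e| = 1 ->
   (P [set w | G (data w) /\ (eps < e * risk_gap (data w))%R] <=
    (expR (gap_exponent - s * eps))%:E)%E /\
   measurable [set w | G (data w) /\ (eps < e * risk_gap (data w))%R].
  move=> e1.
  set E := [set w | _].
  have mE : measurable E.
    apply: (measurableI (data @^-1` G) [set w | eps < e * risk_gap (data w)]).
      by rewrite -[X in measurable X]setTI; exact: measurable_data.
    by apply: measurable_set_lt => //; exact: measurable_funM.
  split=> //.
  have iE : P.-integrable setT (EFin \o (fun w => expR (s * eps) * \1_E w : R)).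
    apply: integrable_scaleR.
    apply: (@integrable_bounded _ _ _ P (\1_E) 1); first exact: measurable_indic.
    by move=> w; rewrite indicE ger0_norm// lern1 leq_b1.
  have iX : P.-integrable setT
      (EFin \o (fun w => expR (s * e * risk_gap (data w)) * \1_G (data w))).
    apply: (@integrable_bounded _ _ _ P
      (fun w => expR (s * e * risk_gap (data w)) * \1_G (data w)) (expR (s * gap_max))).
      apply: measurable_funM; last exact: mind.
      by apply: measurableT_comp => //; exact: measurable_funM.
    move=> w; rewrite ger0_norm ?mulr_ge0 ?expR_ge0//.
    have [Gw|Gw] := pselect (G (data w)); last by rewrite indicE memNset// mulr0 expR_ge0.
    rewrite indicE mem_set// mulr1 ler_expR -mulrA ler_pM2l//.
    apply: le_trans (ler_norm _) _; rewrite normrM e1 mul1r; exact: risk_gap_bound.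
  have h : \int[P]_w (expR (s * eps) * \1_E w) <= expR gap_exponent.
    apply: le_trans (risk_gap_exp e1 bad); apply: le_Rintegral => // w _.
    have [Ew|Ew] := pselect (E w); last first.
      by rewrite [\1_E w]indicE memNset// mulr0 mulr_ge0 ?expR_ge0.
    have [Gw lt] := Ew.
    by rewrite !indicE !mem_set// !mulr1 ler_expR -mulrA ler_pM2l// ltW.
  move: h; rewrite RintegralZl//; last first.
    apply: (@integrable_bounded _ _ _ P (\1_E) 1); first exact: measurable_indic.
    by move=> w; rewrite indicE ger0_norm// lern1 leq_b1.
  rewrite /Rintegral integral_indic// setIT expRD expRN => h.
  have PE : P E \is a fin_num by exact: fin_num_measure.
  by rewrite -(fineK PE) lee_fin ler_pdivlMr ?expR_gt0// mulrC.
have [h1 mU1] := one 1 (normr1 _).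
have [h2 mU2] := one (-1) ltac:(by rewrite normrN1).
apply: (@le_trans _ _ (P ([set w | G (data w) /\ (eps < 1 * risk_gap (data w))%R] `|`
   [set w | G (data w) /\ (eps < - 1 * risk_gap (data w))%R]))).
  apply: le_measure; rewrite ?inE//.
  - have -> : [set w | G (data w) /\ (eps < `|risk_gap (data w)|)%R] =
      [set w | G (data w) /\ (eps < 1 * risk_gap (data w))%R] `|`
      [set w | G (data w) /\ (eps < - 1 * risk_gap (data w))%R].
      apply/seteqP; split => w /=.
        by rewrite mul1r mulN1r; case: ler0P => _ [Gw h]; [right|left].
      rewrite mul1r mulN1r => -[[Gw h]|[Gw h]]; split=> //.
        exact: lt_le_trans h (ler_norm _).
      by rewrite -normrN; exact: lt_le_trans h (ler_norm _).
    exact: measurableU.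
  - exact: measurableU.
  - move=> w /= [Gw]; rewrite mul1r mulN1r.
    by case: ler0P => _ h; [right|left].
apply: le_trans (measureU2 _ mU1 mU2) _.
by rewrite mulr_natl mulr2n EFinD; exact: leeD.
Qed.

End good_data.

End fixed_step.

(** * The conditional risk and the deviation bound uniform over the steps *)

Let train w := (design (fun i => x i w), response (fun i => y i w)).

Lemma measurable_train : measurable_fun setT train.
Proof.
apply: measurable_fun_pair; apply: measurable_fun_mx => i j; under eq_fun do rewrite mxE.
  exact: measurableT_comp (measurable_mx_coord j 0) (mx i).
exact: my.
Qed.

(** The localizing function is the norm of the iterate: on each ball of iterates, fourth moments of
    the sample bound the loss in mean square. *)
Lemma cond_risk (Psi : T -> R) (k : nat) :
  independent_of P (fun w => (x0 w, y0 w)) train ->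
  is_cond_exp P (sigma_of train) (fun w => loss psi (y0 w) (x0 w)
    (gd_iter (fun i => x i w) (fun i => y i w) delta b0 k)) Psi ->
  {ae P, forall w, Psi w =
    pop_risk P psi x0 y0 (gd_iter (fun i => x i w) (fun i => y i w) delta b0 k)}.
Proof.
move=> /independent_of_sym ind cond.
pose beta (v : 'M[R]_(n, q) * 'cV[R]_n) := gd n v.1 v.2 delta b0 k.
have mbeta : measurable_fun setT beta by exact: measurable_gd.
pose phi (v : ('M[R]_(n, q) * 'cV[R]_n) * ('cV[R]_q * R)) := loss psi v.2.2 v.2.1 (beta v.1).
have mphi : measurable_fun setT phi.
  apply: (measurableT_comp (measurable_psi hpsi)); apply: measurable_fun_pair => //.
    exact: measurableT_comp measurable_snd measurable_snd.
  apply: (measurableT_comp (measurable_mx_coord 0 0)).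
  apply: measurable_mulmx; last exact: measurableT_comp mbeta measurable_fst.
  apply: measurable_trmx; exact: measurableT_comp measurable_fst measurable_snd.
pose i := i0.
apply: (cond_exp_independent measurable_train mxy0 ind mphi
  (N := fun v => frob (beta v))
  (c := fun m => loss_moment psi C_psi Cbar_psi C4 m4 (m%:R + 1))) => //.
  exact: measurable_frob_comp.
move=> m v vm.
have M0 : 0 < m%:R + 1 :> R by rewrite ltr_wpDl ?ler0n.
have vM : frob (beta v) <= m%:R + 1 by rewrite (le_trans vm)// lerDl.
have [_ i2 I2] := loss_integrable hpsi hC hCbar hgrad (mx i) (my i) (moment4 i) (moment4y i) M0 vM.
have ml := measurable_funX 2 (mloss (beta v)).
split; first exact: (same_law_integrable (Y := fun w => (x i w, y i w)) mxy0 (mxy i) (law0 i) ml i2).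
have := same_law_integral (Y := fun w => (x i w, y i w)) mxy0 (mxy i) (law0 i) ml i2.
by rewrite /= /phi /= => ->.
Qed.

Context (m tau c : R).
Hypothesis tau_ge0 : 0 <= tau.
Hypothesis m_ge0 : 0 <= m.
Hypothesis m2m : m2 <= m.
Hypothesis C4m : 1 + C4 <= m.
Hypothesis qn : q%:R <= c * n%:R.
Hypothesis tauE : c * ln 8 + 3 <= kappa * tau ^+ 2.

Let B := 1 + m + tau.
Let G : set 'rV[U]_n := good_set B.
Let D := data.
Let mD : measurable_fun setT D. Proof. exact: measurable_data. Qed.

(** The net has at most [8 ^ q] points with [q <= c * n]; the choice of [tau] beats this entropy
    [c * ln 8] per sample and leaves a rate 3. *)
Lemma good_data_prob : (P (D @^-1` (~` G)) <= (2 * expR (- (3 * n%:R)))%:E)%E.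
Proof.
apply: le_trans (good_set_prob tau_ge0 m_ge0 m2m C4m) _.
rewrite lee_fin.
have e8 : 8 ^+ q = expR (q%:R * ln 8) :> R.
  by rewrite expRM_natl lnK// posrE.
apply: (@le_trans _ _ (2 * expR (q%:R * ln 8) * expR (- (kappa * tau ^+ 2 * n%:R)))).
  rewrite ler_wpM2r ?expR_ge0// -e8 -natrX -natrM ler_nat.
  by rewrite mulSn mul1n -addn1 leq_add2l expn_gt0.
rewrite -mulrA ler_pM2l// -expRD ler_expR.
have l8 : 0 <= ln 8 :> R by rewrite ln_ge0// ler1n.
have h1 := ler_wpM2r l8 qn.
have h2 := ler_wpM2r (ler0n R n) tauE.
nra.
Qed.

(** The good event does not depend on the step, so its complement is paid once and only the
    deviations on it are summed over the steps. *)
Lemma loo_deviation (eps : R) : 0 <= eps ->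
  (P [set w | (eps < \big[Num.max/0]_(1 <= k < K.+1)
        `|risk_gap k (D w)|)%R] <=
   (2 * expR (- (3 * n%:R)) + K%:R * (2 * expR (gap_exponent (4 * B) - Num.sqrt n%:R * eps)))%:E)%E.
Proof.
move=> eps0.
have B0' : 0 <= B by rewrite /B !addr_ge0.
have A0 : 0 <= 4 * B by rewrite mulr_ge0.
pose F k w := `|risk_gap k (D w)|.
have mF k : measurable_fun setT (F k).
  apply: measurableT_comp => //; apply: measurableT_comp mD.
  exact: measurable_risk_gap.
have mDG : measurable (D @^-1` (~` G)).
  rewrite -[X in measurable X]setTI; apply: mD => //.
  by apply: measurableC; exact: measurable_good_set.
pose E k := [set w | G (D w) /\ eps < F k w].
have mE k : measurable (E k).
  apply: (measurableI (D @^-1` G) [set w | eps < F k w]); last exact: measurable_set_lt.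
  by rewrite -[X in measurable X]setTI; apply: mD => //; exact: measurable_good_set.
have bad : n%:R * bad_mass B <= 2.
  have -> : bad_mass B = fine (P (D @^-1` (~` G))).
    rewrite /bad_mass /Rintegral; congr fine.
    by rewrite -[X in P X]setIT -integral_indic.
  have h := good_data_prob.
  have PE : P (D @^-1` (~` G)) \is a fin_num by exact: fin_num_measure.
  rewrite -(fineK PE) lee_fin expRN in h.
  apply: le_trans (ler_wpM2l (ler0n R n) h) _.
  (* By [n <= expR (3 * n)], [n] times the bad mass stays below 2. *)
  rewrite mulrCA ler_piMr// ler_pdivrMr ?expR_gt0// mul1r.
  by apply: le_trans (expR_ge1Dx _); have := ler0n R n; lra.
have tail k : k \in index_iota 1 K.+1 -> (P (E k) <= (2 * expR (gap_exponent (4 * B) - Num.sqrt n%:R * eps))%:E)%E.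
  rewrite mem_index_iota => /andP[_ kK].
  exact: (risk_gap_tail A0 kK B0' erefl eps bad). 
have mU : measurable (\big[setU/set0]_(k <- index_iota 1 K.+1) E k).
  by apply: bigsetU_measurable.
apply: (@le_trans _ _ (P (D @^-1` (~` G) `|` \big[setU/set0]_(k <- index_iota 1 K.+1) E k))).
  apply: le_measure; rewrite ?inE//.
  - by apply: measurable_set_lt => //; exact: measurable_bigmax.
  - exact: measurableU.
  move=> w /= lt; have [Gw|Gw] := pselect (G (D w)); last by left.
  right; rewrite -bigcup_seq; apply: contrapT => no.
  move: lt; rewrite ltNge => /negP; apply.
  rewrite big_seq; apply: bigmax_le => // k kin; rewrite leNgt; apply/negP => h.
  by apply: no; exists k.
apply: le_trans (measureU2 _ mDG mU) _.
rewrite EFinD; apply: leeD; first exact: good_data_prob.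
apply: le_trans (measure_finite_union mE tail) _.
by rewrite lee_fin size_iota subn1.
Qed.

End loo_error.

(** * From tail bounds to almost sure convergence *)

Section almost_sure.
Context d (T : measurableType d) (R : realType) (P : probability T R).

(** The tails are summed by telescoping, from [1 / t ^+ 2 <= 2 * (1 / t - 1 / (t + 1))] for
    [t >= 1]. Sets before [N] are replaced by the empty set, and [E 0%N = set0] covers the index on
    which the tail hypothesis says nothing. *)
Lemma borel_cantelli_sqr (E : nat -> set T) (C : R) (N : nat) : 0 <= C ->
  (forall n, measurable (E n)) -> E 0%N = set0 ->
  (forall n, (N <= n)%N -> (0 < n)%N -> (P (E n) <= (C / n%:R ^+ 2)%:E)%E) ->
  {ae P, forall w, \forall n \near \oo, ~ E n w}.
Proof.
move=> C0 mE E0 PE.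
pose F n := if (N <= n)%N then E n else set0.
have mF n : measurable (F n) by rewrite /F; case: ifP.
have F0 : F 0%N = set0 by rewrite /F E0 if_same.
have PF n : (0 < n)%N -> (P (F n) <= (C / n%:R ^+ 2)%:E)%E.
  move=> n0; rewrite /F; case: ifP => [Nn|_]; first exact: PE.
  by rewrite measure0 lee_fin divr_ge0// sqr_ge0.
have sum m : (\sum_(0 <= i < m.+1) P (F i) <= (2 * C * (1 - m.+1%:R^-1))%:E)%E.
  elim: m => [|m IH]; first by rewrite big_nat1 F0 measure0 invr1 subrr mulr0.
  rewrite big_nat_recr//=.
  apply: le_trans (leeD IH (PF m.+1 (ltn0Sn m))) _.
  rewrite -EFinD lee_fin.
  have m0 : 0 < m.+1%:R :> R by rewrite ltr0n.
  have h2 : m.+2%:R = m.+1%:R + 1 :> R by rewrite -natr1.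
  rewrite h2; set t : R := m.+1%:R in m0 *.
  have t1 : 1 <= t by rewrite ler1n.
  rewrite -subr_ge0.
  have -> : 2 * C * (1 - (t + 1)^-1) - (2 * C * (1 - t^-1) + C / t ^+ 2) =
      C * ((t - 1) / (t ^+ 2 * (t + 1))) by field; rewrite !lt0r_neq0// addr_gt0.
  by rewrite mulr_ge0// divr_ge0 ?subr_ge0// mulr_ge0 ?sqr_ge0// addr_ge0// ltW.
have fin : (\sum_(0 <= n <oo) P (F n) < +oo)%E.
  apply: le_lt_trans (ltry (2 * C)); apply: lime_le; first exact: is_cvg_nneseries.
  exists 1%N => // -[//|m] _ /=; apply: le_trans (sum m) _.
  by rewrite lee_fin ler_piMr ?mulr_ge0// gerBl invr_ge0.
exists (lim_sup_set F); split; first 1 last.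
- exact: lim_sup_set_cvg0.
- move=> w /= nb n _; apply: contrapT => no; apply: nb.
  exists (maxn n N) => // m /=; rewrite geq_max => /andP[nm Nm] Em.
  by apply: no; exists m => //; rewrite /F Nm.
- apply: bigcap_measurable => [|n _]; first by exists 0%N.
  by apply: bigcup_measurable => i _.
Qed.

(** The countably many thresholds [1 / (j + 1)] suffice, each handled by Borel-Cantelli. *)
Lemma ae_cvg0 (V : nat -> T -> R) :
  (forall n, (0 < n)%N -> measurable_fun setT (V n)) ->
  (forall n w, 0 <= V n w) ->
  (forall eps, 0 < eps -> exists C N, 0 <= C /\ forall n, (N <= n)%N -> (0 < n)%N ->
     (P [set w | (eps < V n w)%R] <= (C / n%:R ^+ 2)%:E)%E) ->
  {ae P, forall w, V n w @[n --> \oo] --> (0 : R)}.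
Proof.
move=> mV V0 tail.
suff: \forall w \ae P, forall j : nat, \forall n \near \oo, ~ ((0 < n)%N /\ j.+1%:R^-1 < V n w).
  apply: filterS => w h; apply/cvgr0Pnorm_le => eps eps0.
  have [j _ je] := near_infty_natSinv_lt (PosNum eps0).
  have {}je := je j (leqnn j).
  near=> n; rewrite ger0_norm//.
  have : ~ ((0 < n)%N /\ j.+1%:R^-1 < V n w) by near: n.
  move=> no; apply: le_trans (ltW je); rewrite leNgt; apply/negP => lt; apply: no; split=> //.
  by near: n; exists 1%N.
apply: ae_foralln => j.
have e0 : 0 < j.+1%:R^-1 :> R by rewrite invr_gt0 ltr0n.
have [C [N [C0 PE]]] := tail _ e0.
apply: (@borel_cantelli_sqr (fun n => [set w | (0 < n)%N /\ j.+1%:R^-1 < V n w]) C N) => //.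
- move=> [|n].
    rewrite [X in measurable X](_ : _ = set0)//.
    by apply/seteqP; split=> w // [].
  rewrite [X in measurable X](_ : _ = [set w | j.+1%:R^-1 < V n.+1 w]).
    by apply: measurable_set_lt => //; exact: mV.
  by apply/seteqP; split=> w //= [].
- by apply/seteqP; split=> w // [].
- move=> n Nn n0; rewrite [X in P X](_ : _ = [set w | j.+1%:R^-1 < V n w]); first exact: PE.
  by apply/seteqP; split=> w //= [].
Unshelve. all: by end_near.
Qed.

End almost_sure.

(** * Summability of the tails *)

Section tail_arithmetic.
Context (R : realType).

(* The sixth power turns [expR (- sqrt n * eps)] into [n ^- 3]. *)
Lemma tail_summable (c eps : R) (n k : nat) : 0 < eps -> (0 < n)%N -> (k <= n)%N ->
  2 * expR (- (3 * n%:R)) + k%:R * (2 * expR (c - Num.sqrt n%:R * eps)) <=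
  (2 + 2 * expR c * (6 / eps) ^+ 6) / n%:R ^+ 2.
Proof.
move=> eps0 n0 kn; have nR : 0 < n%:R :> R by rewrite ltr0n.
have n1 : 1 <= n%:R :> R by rewrite ler1n.
rewrite [leRHS]mulrDl; apply: lerD.
  rewrite ler_pM2l// expRN lef_pV2 ?posrE ?expR_gt0 ?exprn_gt0//.
  have := @exp_ge_power R (3 * n%:R) 3 isT; rewrite mulrAC mulfV// mul1r.
  move=> /(_ ltac:(by rewrite mulr_ge0)); apply: le_trans.
  by rewrite exprS ler_peMl// exprn_ge0.
set s := Num.sqrt n%:R.
have s0 : 0 < s by rewrite sqrtr_gt0.
have ss : s ^+ 2 = n%:R by rewrite sqr_sqrtr// ltW.
have h : (s * eps / 6) ^+ 6 <= expR (s * eps).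
  by apply: exp_ge_power => //; rewrite mulr_ge0// ltW.
have k0 : 0 < (s * eps / 6) ^+ 6 by rewrite exprn_gt0// divr_gt0// mulr_gt0.
rewrite expRD expRN.
apply: (@le_trans _ _ (n%:R * (2 * (expR c * ((s * eps / 6) ^+ 6)^-1)))).
  have e0 : 0 <= 2 * (expR c * (expR (s * eps))^-1).
    by rewrite mulr_ge0// mulr_ge0// ?invr_ge0 expR_ge0.
  apply: ler_pM => //; first by rewrite ler_nat.
  by rewrite ler_pM2l// ler_pM2l ?expR_gt0// lef_pV2 ?posrE ?expR_gt0.
apply: le_of_eq; rewrite -ss.
by field; rewrite ?lt0r_neq0.
Qed.

(** Once [ln n >= 1] the logarithmic factor is at most 1, and the little-o with constant 1 gives the
    bound that the union over the steps needs. *)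
Lemma eventually_le_of_littleo (K : nat -> nat) :
  (fun n => (K n)%:R : R^o) =o_\oo
    (fun n => n%:R * (ln (n%:R : R)) `^ (- (3 / 2)) : R^o) ->
  exists N, forall n, (N <= n)%N -> (K n <= n)%N.
Proof.
move=> /eqoP /(_ 1 ltr01) [N _ hN].
exists (maxn N (Num.truncn (expR 1 : R)).+1) => n; rewrite geq_max => /andP[Nn ne].
have := hN n Nn => /=; rewrite mul1r normrM !ger0_norm ?powR_ge0//.
move=> h; rewrite -(ler_nat R); apply: le_trans h _.
rewrite ler_piMr//.
have l1 : 1 <= ln (n%:R : R).
  have e3 : expR 1 <= n%:R :> R.
    have h3 := real_truncnS_gt (num_real (expR 1 : R)).
    by apply: le_trans (ltW h3) _; rewrite ler_nat.
  by rewrite -[leLHS]expRK ler_ln ?posrE ?expR_gt0// (lt_le_trans (expR_gt0 1)).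
rewrite powRN invf_le1 ?powR_gt0 ?(lt_le_trans _ l1)//.
by rewrite -[leLHS](powRr0 (ln n%:R)) ler_powR// divr_ge0.
Qed.

End tail_arithmetic.

(** * Early stopping and the conclusion *)

(** The comparison passes through the estimated risk, which is left at the selected step and at the
    competing one; each passage costs one uniform error. *)
Lemma argmin_gap (R : realType) (loo Psi : nat -> R) (K k : nat) : (1 <= k <= K)%N ->
  (forall j, (1 <= j <= K)%N -> loo k <= loo j) ->
  `|Psi k - \big[Num.min/Psi 1%N]_(1 <= j < K.+1) Psi j| <=
  2 * \big[Num.max/0]_(1 <= j < K.+1) `|loo j - Psi j|.
Proof.
move=> kK kmin; set M := \big[Num.max/0]_(1 <= j < K.+1) _.
have in1 j : (1 <= j <= K)%N -> j \in index_iota 1 K.+1 by rewrite mem_index_iota ltnS.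
have dev j : (1 <= j <= K)%N -> `|loo j - Psi j| <= M.
  by move=> jK; apply: (@le_bigmax_seq _ _ _ _ 0 j xpredT (fun j => `|loo j - Psi j|)) => //; exact: in1.
(* Index 1 is in range, so the seed of the minimum is itself one of the compared values. *)
have K1 : (1 <= 1 <= K)%N by case/andP: kK => k1 kK; rewrite /= (leq_trans k1).
have low j : (1 <= j <= K)%N -> Psi k - 2 * M <= Psi j.
  move=> jK; have := dev _ jK; have := dev _ kK; have := kmin _ jK.
  by rewrite !ler_norml => ? /andP[? ?] /andP[? ?]; lra.
have up : \big[Num.min/Psi 1%N]_(1 <= j < K.+1) Psi j <= Psi k.
  by apply: (@ge_bigmin_seq _ _ _ _ _ k xpredT Psi) => //; exact: in1.
rewrite ger0_norm ?subr_ge0// lerBlDr -lerBlDl big_seq.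
apply: le_bigmin; first exact: low.
by move=> j; rewrite mem_index_iota ltnS; exact: low.
Qed.

Lemma moment_of_expectation d (T : measurableType d) (R : realType) (P : probability T R)
    (Y : T -> R) (k : nat) (m : R) : ~~ odd k -> measurable_fun setT Y ->
  ('E_P[fun w => (Y w ^+ k)%R] <= m%:E)%E ->
  P.-integrable setT (EFin \o (fun w => Y w ^+ k)) /\ \int[P]_w (Y w ^+ k) <= m.
Proof.
move=> ek mY; rewrite unlock => h.
have i : P.-integrable setT (EFin \o (fun w => Y w ^+ k)).
  apply/integrableP; split; first by apply: measurableT_comp => //; exact: measurable_funX.
  under eq_integral => w _ do rewrite /= ger0_norm ?exprn_even_ge0//.
  by apply: le_lt_trans h _; rewrite ltry.
by split=> //; rewrite -lee_fin EFin_Rintegral.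
Qed.

Theorem theorem3 (R : realType) (d : measure_display) (T : measurableType d)
  (P : probability T R) (p : nat -> nat)
  (* feature model *)
  (mu_z : nat -> probability R R)
  (Sigma Sigma_sqrt : forall n, 'M[R]_(p n))
  (z : forall n, 'I_n -> {RV P >-> 'cV[R]_(p n)})
  (x : forall n, 'I_n -> {RV P >-> 'cV[R]_(p n + 1)})
  (sigma_z sigma_Sigma : R)
  (* response model *)
  (mu_eps : nat -> probability R R)
  (f : forall n, 'cV[R]_(p n + 1) -> R)
  (L_f : nat -> R)
  (eps y : forall n, 'I_n -> {RV P >-> R})
  (sigma_eps m2 m4 m8 : R)
  (* test point *)
  (x0 : forall n, {RV P >-> 'cV[R]_(p n + 1)})
  (y0 : nat -> {RV P >-> R})
  (* gradient descent *)
  (K : nat -> nat) (delta : nat -> nat -> R)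
  (beta0 : forall n, 'cV[R]_(p n + 1))
  (Delta B0 zeta_L zeta_U : R)
  (psi : R * R -> R) (C_psi Cbar_psi : R)
  (Psi : nat -> nat -> T -> R)
  (h_iid : forall n, (0 < n)%N ->
     iid P (fun (i : 'I_n) w => (x n i w, y n i w)))
  (* (F1) *)
  (hF1_x : forall n, (0 < n)%N -> forall (i : 'I_n) w,
     x n i w = col_mx (Sigma_sqrt n *m z n i w) 1)
  (hF1_indep : forall n, (0 < n)%N -> forall i : 'I_n,
     mutually_independent P (fun (j : 'I_(p n)) w => z n i w j 0))
  (hF1_law : forall n, (0 < n)%N -> forall (i : 'I_n) (j : 'I_(p n)),
     has_law P (fun w => z n i w j 0) (mu_z n))
  (hF1_psd : forall n, (0 < n)%N -> psd (Sigma n))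
  (hF1_sqrt : forall n, (0 < n)%N -> is_psd_sqrt (Sigma_sqrt n) (Sigma n))
  (* (F2) *)
  (hF2_mean : forall n, (0 < n)%N -> ('E_(mu_z n)[idfun] = 0%:E)%E)
  (hF2_var : forall n, (0 < n)%N -> ('V_(mu_z n)[idfun] = 1%:E)%E)
  (hF2_T2 : forall n, (0 < n)%N -> T2_inequality (mu_z n) sigma_z)
  (* (F3) *)
  (hF3 : forall n, (0 < n)%N -> opnorm (Sigma n) <= sigma_Sigma)
  (* (Y1) *)
  (hY1_y : forall n, (0 < n)%N -> forall (i : 'I_n) w,
     y n i w = f n (x n i w) + eps n i w)
  (hY1_indep : forall n, (0 < n)%N -> forall i : 'I_n,
     independent_of P (eps n i) (x n i))
  (hY1_law : forall n, (0 < n)%N -> forall i : 'I_n,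
     has_law P (eps n i) (mu_eps n))
  (* (Y2) *)
  (hY2_mean : forall n, (0 < n)%N -> ('E_(mu_eps n)[idfun] = 0%:E)%E)
  (hY2_T2 : forall n, (0 < n)%N -> T2_inequality (mu_eps n) sigma_eps)
  (* (Y3) *)
  (hY3 : forall n, (0 < n)%N -> l2_lipschitz (L_f n) (f n))
  (hY3_L : forall n, (0 < n)%N -> L_f n <= 1)
  (* (Y4) *)
  (hY4_8 : forall n, (0 < n)%N -> forall i : 'I_n,
     ('E_P[fun w => (y n i w ^+ 8)%R] <= m8%:E)%E)
  (hY4_4 : forall n, (0 < n)%N -> forall i : 'I_n,
     ('E_P[fun w => (y n i w ^+ 4)%R] <= m4%:E)%E)
  (hY4_2 : forall n, (0 < n)%N -> forall i : 'I_n,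
     ('E_P[fun w => (y n i w ^+ 2)%R] <= m2%:E)%E)
  (* test point: same law as a training pair, independent of the training data *)
  (h0_law : forall n, (0 < n)%N -> forall i : 'I_n,
     same_law P (fun w => (x0 n w, y0 n w)) (fun w => (x n i w, y n i w)))
  (h0_indep : forall n, (0 < n)%N ->
     independent_of P (fun w => (x0 n w, y0 n w))
       (fun w => (design (fun i => x n i w), response (fun i => y n i w))))
  (* gradient descent, dimensions *)
  (hK : forall n, (0 < n)%N -> (0 < K n)%N)
  (hdelta : forall n, (0 < n)%N -> forall k, (k < K n)%N -> 0 < delta n k)
  (hDelta : forall n, (0 < n)%N ->
     \sum_(1 <= k < (K n).+1) delta n k.-1 <= Delta)
  (hB0 : forall n, (0 < n)%N -> l2norm (beta0 n) <= B0)
  (hzeta : 0 < zeta_L)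
  (hratio : forall n, (0 < n)%N -> zeta_L <= (p n)%:R / n%:R <= zeta_U)
  (hKo : (fun n => (K n)%:R : R^o) =o_\oo
         (fun n => n%:R * (ln (n%:R : R)) `^ (- (3 / 2)) : R^o))
  (* error functional *)
  (hpsi : forall u, differentiable psi u)
  (hC : 0 <= C_psi) (hCbar : 0 <= Cbar_psi)
  (hgrad : forall u, l2norm2 (grad2 psi u) <= C_psi * l2norm2 u + Cbar_psi)
  (* Psi n k is (any version of) E[psi(y0, x0^T beta_k) | X, y] *)
  (hPsi : forall n, (0 < n)%N -> forall k, (1 <= k <= K n)%N ->
     is_cond_exp P
       (sigma_of (fun w =>
          (design (fun i => x n i w), response (fun i => y n i w))))
       (fun w => loss psi (y0 n w) (x0 n w)
          (gd_iter (fun i => x n i w) (fun i => y n i w)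
                   (delta n) (beta0 n) k))
       (Psi n k)) :
  let loo n k w := loo_risk psi (fun i => x n i w) (fun i => y n i w)
                     (delta n) (beta0 n) k in
  {ae P, forall w,
     (fun n => \big[Num.max/0]_(1 <= k < (K n).+1) `|loo n k w - Psi n k w|)
       @ \oo --> (0 : R)} /\
  (forall kstar : nat -> T -> nat,
     (forall n w, (0 < n)%N ->
        (1 <= kstar n w <= K n)%N /\
        forall k, (1 <= k <= K n)%N -> loo n (kstar n w) w <= loo n k w) ->
     {ae P, forall w,
        (fun n => `|Psi n (kstar n w) w -
           \big[Num.min/Psi n 1%N w]_(1 <= k < (K n).+1) Psi n k w|)
          @ \oo --> (0 : R)}).
Proof.
move=> loo.
pose kap := kappa sigma_z sigma_Sigma sigma_eps.
pose C4 := moment4_bound sigma_z sigma_Sigma sigma_eps.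
(* The constants do not depend on [n], so the hypotheses at [n = 1] suffice. *)
have kap0 : 0 < kap := kappa_gt0 sigma_Sigma (hF2_T2 1%N isT) (hY2_T2 1%N isT).
have mx n i : measurable_fun setT (x n i) by exact: measurable_funPT.
have my n i : measurable_fun setT (y n i) by exact: measurable_funPT.
have mz n i : measurable_fun setT (z n i) by exact: measurable_funPT.
have me n i : measurable_fun setT (eps n i) by exact: measurable_funPT.
have mx0 n : measurable_fun setT (x0 n) by exact: measurable_funPT.
have my0 n : measurable_fun setT (y0 n) by exact: measurable_funPT.
have moment4 n (n0 : (0 < n)%N) (i : 'I_n) (b : 'cV[R]_(p n + 1)) : frob b <= 1 ->
    P.-integrable setT (EFin \o (fun w => ((x n i w)^T *m b) 0 0 ^+ 4)) /\
    \int[P]_w (((x n i w)^T *m b) 0 0 ^+ 4) <= C4.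
  exact: (feature_moment4 (mz n i) (mx n i) (me n i) (my n i) (hF1_x n n0 i)
    (hF1_indep n n0 i) (hF1_law n n0 i) (hF1_sqrt n n0) (hF2_mean n n0) (hF2_T2 n n0)
    (hF3 n n0) (hY1_y n n0 i) (hY1_indep n n0 i) (hY1_law n n0 i) (hY2_T2 n n0)
    (hY3 n n0) (hY3_L n n0)).
have transport n (n0 : (0 < n)%N) (i : 'I_n) : transport_bound P (fun w => (x n i w, y n i w))
    (fun u v => kap * dist2 u v).
  exact: (sample_transport (mz n i) (mx n i) (me n i) (hF1_x n n0 i)
    (hF1_indep n n0 i) (hF1_law n n0 i) (hF1_sqrt n n0) (hF2_T2 n n0)
    (hF3 n n0) (hY1_y n n0 i) (hY1_indep n n0 i) (hY1_law n n0 i) (hY2_T2 n n0)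
    (hY3 n n0) (hY3_L n n0)).
have moment4y n (n0 : (0 < n)%N) (i : 'I_n) :=
  moment_of_expectation (k := 4) isT (my n i) (hY4_4 n n0 i).
have moment2y n (n0 : (0 < n)%N) (i : 'I_n) :=
  moment_of_expectation (k := 2) isT (my n i) (hY4_2 n n0 i).
have delta0 n (n0 : (0 < n)%N) k (kK : (k < K n)%N) : 0 <= delta n k := ltW (hdelta n n0 k kK).
have sum_delta n (n0 : (0 < n)%N) : \sum_(0 <= k < K n) delta n k <= Delta.
  by have := hDelta n n0; rewrite big_add1.
have b0B n (n0 : (0 < n)%N) : frob (beta0 n) <= B0 by rewrite -l2normE hB0.
have zU : 0 <= zeta_U.
  by case/andP: (hratio 1%N isT) => h1 h2; rewrite ltW// (lt_le_trans hzeta)// (le_trans h1).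
(* The extra 1 accounts for the intercept: [p n + 1 <= zeta_U * n + n]. *)
pose c := zeta_U + 1.
have qn n (n0 : (0 < n)%N) : (p n + 1)%:R <= c * n%:R :> R.
  have n1 : 1 <= n%:R :> R by rewrite ler1n.
  case/andP: (hratio n n0) => _; rewrite ler_pdivrMr ?ltr0n// => h.
  by rewrite natrD /c mulrDl mul1r lerD.
pose m : R := `|m2| + `|1 + C4|.
(* Chosen to make [tauE] an equality: [c * ln 8] pays for the net and 3 for summability. *)
pose tau := Num.sqrt ((c * ln 8 + 3) / kap).
have tau0 : 0 <= tau := sqrtr_ge0 _.
have m0 : 0 <= m by rewrite addr_ge0.
have m2m : m2 <= m by rewrite (le_trans (ler_norm _))// lerDl.
have C4m : 1 + C4 <= m by rewrite (le_trans (ler_norm _))// lerDr.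
have tauE : c * ln 8 + 3 <= kap * tau ^+ 2.
  have l8 : 0 <= ln 8 :> R by rewrite ln_ge0// ler1n.
  rewrite sqr_sqrtr; first by rewrite mulrCA mulfV ?mulr1// lt0r_neq0.
  by rewrite divr_ge0 ?(ltW kap0)// addr_ge0// mulr_ge0// addr_ge0.
pose gap n k w := risk_gap P (x0 n) (y0 n) psi (delta n) (beta0 n) k
  (data (fun i => x n i) (fun i => y n i) w).
pose V n w := \big[Num.max/0]_(1 <= k < (K n).+1) `|gap n k w|.
have Vcvg : {ae P, forall w, V n w @[n --> \oo] --> (0 : R)}.
  apply: ae_cvg0.
  - move=> n n0; apply: measurable_bigmax => k; apply: measurableT_comp => //.
    apply: (measurableT_comp (measurable_risk_gap P (mx0 n) (my0 n) hpsi (delta n) (beta0 n) k)).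
    by apply: measurable_data.
  - by move=> n w; apply: bigmax_ge_id.
  move=> e e0; have [N KN] := eventually_le_of_littleo hKo.
  exists (2 + 2 * expR (gap_exponent kap C4 m4 psi C_psi Cbar_psi Delta B0
    (4 * (1 + m + tau))) * (6 / e) ^+ 6), N; split.
    by rewrite addr_ge0// mulr_ge0 ?exprn_ge0 ?divr_ge0 ?(ltW e0)// mulr_ge0// expR_ge0.
  move=> n Nn n0.
  have q0 : (0 < p n + 1)%N by rewrite addn1.
  have := loo_deviation n0 q0 (mx n) (my n) (proj1 (h_iid n n0)) kap0 (transport n n0)
    (moment4 n n0) (moment2y n n0) (moment4y n n0) (mx0 n) (my0 n) (h0_law n n0) hpsi hC
    hCbar hgrad (delta0 n n0) (sum_delta n n0) (b0B n n0) tau0 m0 m2m C4m (qn n n0)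
    tauE (ltW e0).
  move=> /le_trans; apply; rewrite lee_fin; exact: tail_summable e0 n0 (KN n Nn).
(* [Psi n k] is an arbitrary version of the conditional expectation; the exceptional sets are
   countably many, so one null set serves all [n] and [k]. *)
have PsiE : {ae P, forall w, forall n k, (0 < n)%N -> (1 <= k <= K n)%N ->
    `|loo n k w - Psi n k w| = `|gap n k w|}.
  apply: ae_foralln => n; apply: ae_foralln => k.
  have [n0|n0] := boolP (0 < n)%N; last by apply: aeW.
  have [kK|kK] := boolP (1 <= k <= K n)%N; last by apply: aeW.
  have := cond_risk n0 (mx n) (my n) (moment4 n n0) (moment4y n n0) (mx0 n) (my0 n)
    (h0_law n n0) hpsi hC hCbar hgrad (h0_indep n n0) (hPsi n n0 k kK).
  apply: filterS => w Pw _ _; rewrite Pw /gap /risk_gap /descent /feature_matrix /label_vector.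
  have -> : (fun i => (data (fun i => x n i) (fun i => y n i) w 0 i).1) = (fun i => x n i w).
    by apply/funext => i; rewrite mxE.
  have -> : (fun i => (data (fun i => x n i) (fun i => y n i) w 0 i).2) = (fun i => y n i w).
    by apply/funext => i; rewrite mxE.
  by [].
have first : {ae P, forall w, (fun n => \big[Num.max/0]_(1 <= k < (K n).+1)
    `|loo n k w - Psi n k w|) @ \oo --> (0 : R)}.
  apply: filterS2 Vcvg PsiE => w Vw Ew; apply: cvg_trans Vw; apply: near_eq_cvg.
  exists 1%N => // n n0 /=; rewrite /V; apply: eq_big_nat => k; rewrite ltnS => kK.
  by rewrite Ew.
split=> // kstar hk; apply: filterS first => w h.
apply: (@squeeze_cvgr _ _ _ _ (fun=> 0) (fun n => 2 * \big[Num.max/0]_(1 <= k < (K n).+1)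
    `|loo n k w - Psi n k w|)).
- exists 1%N => // n n0 /=; have [kK kmin] := hk n w n0.
  by rewrite normr_ge0; exact: argmin_gap.
- exact: cvg_cst.
- by have := cvgM (cvg_cst (2 : R)) h; rewrite mulr0; apply.
Qed.
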